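(* Let $C_1$ and $C_2$ be $PK^0$ curves. The product $X=C_1\times C_2$ is a ramified covering of a torus $\mathbb{T}$ (of complex dimension two) if and only if $C_1$ and $C_2$ both are ramified coverings of (one-dimensional complex) tori.
   Context: All manifolds are connected and compact. A $PK^0$ curve is a compact connected real surface with a fixed simplicial decomposition and a flat metric obtained by isometrically gluing flat triangles, such that the flat metric on the complement of the vertices has trivial holonomy. Near each vertex it is isometric to a cone of angle $2\pi\alpha$ (with $\alpha$ a positive integer), and it carries the complex structure which is the flat one away from the vertices and has chart $z\mapsto z^{\alpha}$ at a vertex. A product $C_1\times C_2$ of two $PK^0$ curves is endowed with the product metric and the product complex structure. A ramified covering of a torus means a finite-sheeted ramified holomorphic covering $\pi:X\to\mathbb{C}^n/\Lambda$, with $\Lambda$ a lattice in $\mathbb{C}^n$ and $n=\dim_{\mathbb{C}}X$, which is compatible with the flat structures, i.e. a local isometry (for a flat Kähler metric on $\mathbb{C}^n/\Lambda$ induced by a Hermitian inner product on $\mathbb{C}^n$) away from the singular and ramification loci. *)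

(* Defs.v *)
From HB Require Import structures.
From mathcomp Require Import all_boot all_order all_algebra.
From mathcomp Require Import complex.
From mathcomp Require Import all_classical all_reals all_analysis.
Set Implicit Arguments.
Unset Strict Implicit.
Unset Printing Implicit Defensive.
Import Order.TTheory GRing.Theory Num.Theory.
Import numFieldNormedType.Exports.
Local Open Scope classical_set_scope.
Local Open Scope ring_scope.
Local Open Scope complex_scope.
Local Open Scope quotient_scope.

(* [R[i]] packed as a [numClosedFieldType], so that it carries the topology
   and the normed-module structure (over itself) of its modulus. *)
Definition Cplx (R : realType) : numClosedFieldType := R[i].

Definition open_homeo (X Y : topologicalType) (A : set X) (B : set Y)
    (f : X -> Y) : Prop :=
  [/\ open A, open B, set_bij A B f,
      forall x, A x -> {for x, continuous f} &
      forall W, W `<=` A -> open W -> open (f @` W)].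

Record chart (X E : Type) := Chart { dom : set X; coord :> X -> E }.

Definition is_chart (X E : topologicalType) (c : chart X E) : Prop :=
  exists B : set E, open_homeo (dom c) B c.

(* An n-dimensional complex manifold which is flat off a singular locus:
   [hol_atlas] gives the complex structure, and [flat_atlas] consists of local
   holomorphic isometries with the Euclidean C^n. The singular locus of the
   metric is the set of points lying in no flat chart. *)
Record flat_space (R : realType) (n : nat) := FlatSpace {
  space :> topologicalType;
  hol_atlas : set (chart space 'rV[Cplx R]_n);
  flat_atlas : set (chart space 'rV[Cplx R]_n) }.

Section ProductSpace.
Variables (R : realType) (n m : nat).

Definition prod_chart (X Y : Type) (c : chart X 'rV[Cplx R]_n)
    (d : chart Y 'rV[Cplx R]_m) : chart (X * Y) 'rV[Cplx R]_(n + m) :=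
  Chart (dom c `*` dom d) (fun p => row_mx (c p.1) (d p.2)).

Definition prod_atlas (X Y : Type) (A : set (chart X 'rV[Cplx R]_n))
    (B : set (chart Y 'rV[Cplx R]_m)) :
    set (chart (X * Y) 'rV[Cplx R]_(n + m)) :=
  [set e | exists c d, [/\ A c, B d & e = prod_chart c d]].

Definition prod_space (X : flat_space R n) (Y : flat_space R m) :
    flat_space R (n + m) :=
  @FlatSpace R (n + m) (X * Y)%type
    (prod_atlas (@hol_atlas _ _ X) (@hol_atlas _ _ Y))
    (prod_atlas (@flat_atlas _ _ X) (@flat_atlas _ _ Y)).

End ProductSpace.

Section PK0.
Variable R : realType.
Notation C := (Cplx R).

(* The flat triangle of the 2-simplex [f] is the Euclidean triangle of C with
   corners [corner f 0], [corner f 1], [corner f 2]; [param f] maps it onto the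
   2-simplex and is irrelevant elsewhere. *)
Record triangulation := Triangulation {
  tri_space :> topologicalType;
  tri : finType;
  corner : tri -> 'I_3 -> C;
  param : tri -> C -> tri_space }.

Section Triangulation.
Variable S : triangulation.

Definition face (f : tri S) (I : set 'I_3) : set C :=
  [set u | exists l : 'I_3 -> R,
    [/\ forall i, 0 <= l i, forall i, ~ I i -> l i = 0, \sum_i l i = 1 &
        u = \sum_i (l i)%:C * corner f i]].

Definition triangle (f : tri S) : set C := face f setT.

Definition vertices : set S := [set x | exists f i, x = param f (corner f i)].

Definition nondegenerate : Prop :=
  forall (f : tri S) (l : 'I_3 -> R), \sum_i l i = 0 ->
    \sum_i (l i)%:C * corner f i = 0 -> forall i, l i = 0.

Definition simplicial : Prop :=
  [/\ forall f : tri S, {within triangle f, continuous (param f)} /\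
        set_inj (triangle f) (param f),
      forall x : S, exists f : tri S, (param f @` triangle f) x &
      forall f g : tri S, f <> g -> exists I J : set 'I_3,
        [/\ I <> setT, J <> setT,
            param f @` triangle f `&` param g @` triangle g
              = param f @` face f I &
            param f @` face f I = param g @` face g J]].

Definition isometric_gluing : Prop :=
  forall (f g : tri S) (u u' w w' : C),
    triangle f u -> triangle f u' -> triangle g w -> triangle g w' ->
    param f u = param g w -> param f u' = param g w' -> `|u - u'| = `|w - w'|.

(* In the flat coordinate of each triangle, D is locally a rotation followed
   by a translation. Excluding reflections fixes a coherent orientation of the
   triangles, hence the orientation defining the complex structure. *)
Definition developing (U : set S) (D : S -> C) : Prop :=
  forall (f : tri S) (u : C), triangle f u -> U (param f u) ->
    exists a b : C, `|a| = 1 /\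
      \forall u' \near u, triangle f u' -> D (param f u') = a * u' + b.

Definition flat_chart (c : chart S C) : Prop :=
  is_chart c /\ developing (dom c) c.

(* The cone of angle 2 pi alpha is parametrized by a disc of coordinate w
   through the flat coordinate z = w^alpha. *)
Definition cone_chart (x : S) (alpha : nat) (c : chart S C) : Prop :=
  [/\ (0 < alpha)%N, is_chart c, dom c x, c x = 0 &
      developing (dom c) (fun y => c y ^+ alpha)].

(* The flat metric near a common point x identifies the tangent vector of
   coordinate z in c with the one of coordinate a * z in c'. *)
Definition transition (c c' : chart S C) (x : S) (a : C) : Prop :=
  exists b : C, \forall y \near x, c' y = a * c y + b.

(* [v t c] is the coordinate, in the flat chart c, of the tangent vector at
   the point [g t]. *)
Definition parallel (g : R -> S) (v : R -> chart S C -> C) : Prop :=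
  forall (t : R) (c : chart S C), 0 <= t <= 1 -> flat_chart c -> dom c (g t) ->
    (forall c' a, flat_chart c' -> dom c' (g t) ->
       transition c c' (g t) a -> v t c' = a * v t c) /\
    (\forall s \near t, 0 <= s <= 1 -> v s c = v t c).

Definition trivial_holonomy : Prop :=
  forall g : R -> S, {within `[0, 1]%classic, continuous g} -> g 0 = g 1 ->
    (forall t, 0 <= t <= 1 -> ~ vertices (g t)) ->
    forall v, parallel g v ->
    forall c, flat_chart c -> dom c (g 0) -> v 1 c = v 0 c.

End Triangulation.

Record PK0curve := PK0Curve {
  PK0tri :> triangulation;
  PK0_nonempty : [set: PK0tri] !=set0;
  PK0_compact : compact [set: PK0tri];
  PK0_connected : connected [set: PK0tri];
  PK0_hausdorff : hausdorff_space PK0tri;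
  PK0_nondegenerate : nondegenerate PK0tri;
  PK0_simplicial : simplicial PK0tri;
  PK0_gluing : isometric_gluing PK0tri;
  PK0_flat : forall x : PK0tri, ~ vertices x ->
    exists2 c, flat_chart c & dom c x;
  PK0_cone : forall x : PK0tri, vertices x ->
    exists alpha c, cone_chart x alpha c;
  PK0_holonomy : trivial_holonomy PK0tri }.

Definition row_chart (X : Type) (c : chart X C) : chart X 'rV[C]_1 :=
  Chart (dom c) (fun x => const_mx (c x)).

Definition curve_space (S : PK0curve) : flat_space R 1 :=
  @FlatSpace R 1 S
    [set row_chart c | c in [set c : chart S C | flat_chart c \/
       exists x alpha, vertices x /\ cone_chart x alpha c]]
    [set row_chart c | c in [set c : chart S C | flat_chart c]].

End PK0.

Section Torus.
Variables (R : realType) (n : nat).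
Notation C := (Cplx R).

Record lattice := Lattice {
  lat_basis : 'I_(n + n) -> 'rV[C]_n;
  lat_free : forall l : 'I_(n + n) -> R,
    \sum_i (l i)%:C *: lat_basis i = 0 -> forall i, l i = 0 }.

Definition in_lattice (L : lattice) : set 'rV[C]_n :=
  [set v | exists m : 'I_(n + n) -> int, v = \sum_i lat_basis L i *~ m i].

Definition torus_rel (L : lattice) : rel 'rV[C]_n :=
  fun u v => `[< in_lattice L (u - v) >].

Lemma torus_rel_refl L : reflexive (torus_rel L).
Proof.
move=> u; apply/asboolP; exists (fun=> 0).
by rewrite subrr big1.
Qed.

Lemma torus_rel_sym L : symmetric (torus_rel L).
Proof.
have H u v : torus_rel L u v -> torus_rel L v u.
  move=> /asboolP[m e]; apply/asboolP; exists (fun i => - m i).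
  by rewrite -opprB e -sumrN; apply: eq_bigr => i _; rewrite mulrNz.
by move=> u v; apply/idP/idP; exact: H.
Qed.

Lemma torus_rel_trans L : transitive (torus_rel L).
Proof.
move=> v u w /asboolP[m e] /asboolP[p e']; apply/asboolP.
exists (fun i => m i + p i).
rewrite -(subrKA v) e e' -big_split; apply: eq_bigr => i _ /=.
by rewrite mulrzDr.
Qed.

Canonical torus_equiv L :=
  EquivRel (torus_rel L) (torus_rel_refl L) (torus_rel_sym L)
    (@torus_rel_trans L).

Definition torus (L : lattice) : topologicalType :=
  quotient_topology {eq_quot torus_equiv L}.

Definition torus_proj (L : lattice) : 'rV[C]_n -> torus L :=
  \pi_({eq_quot torus_equiv L}).

(* Closed, and locally contained in the zero set of a holomorphic function
   that vanishes on no nonempty open set. *)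
Definition thin (L : lattice) (B : set (torus L)) : Prop :=
  closed B /\ forall u : 'rV[C]_n,
    exists (W : set 'rV[C]_n) (g : 'rV[C]_n -> C),
      [/\ open W, W u, forall v, W v -> differentiable g v,
          interior (W `&` g @^-1` [set 0]) = set0 &
          forall v, W v -> B (torus_proj L v) -> g v = 0].

Section Covering.
Variables (X : flat_space R n) (L : lattice) (p : X -> torus L).

(* G expresses p near x as a C^n-valued map in the chart c; [differentiable]
   is over the complex numbers. *)
Definition local_lift (c : chart X 'rV[C]_n) (x : X)
    (G : 'rV[C]_n -> 'rV[C]_n) : Prop :=
  (\forall u \near c x, differentiable G u) /\
  (\forall y \near x, p y = torus_proj L (G (c y))).

Definition holomorphic_to_torus : Prop :=
  forall c x, hol_atlas c -> dom c x -> exists G, local_lift c x G.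

Definition ramification_locus : set X :=
  [set x | exists c G, [/\ hol_atlas c, dom c x, local_lift c x G &
    \det ('J G (c x)) = 0]].

(* The number of sheets d is finite; it is locally constant off the branch
   set B below, whose complement is connected. *)
Definition evenly_covered (y : torus L) : Prop :=
  exists (U : set (torus L)) (d : nat) (V : 'I_d -> set X),
    [/\ U y, p @^-1` U = \bigcup_i V i, trivIset setT V &
        forall i, open_homeo (V i) U p /\
          V i `&` ramification_locus = set0].

Definition ramified_covering : Prop :=
  [/\ holomorphic_to_torus,
      forall y, p @^-1` [set y] !=set0 /\ finite_set (p @^-1` [set y]) &
      exists B : set (torus L),
        [/\ thin B, interior (p @^-1` B) = set0 &
            forall y, ~ B y -> evenly_covered y]].

(* On small sets the torus distance is the h-distance between lifts. *)
Definition local_isometry (h : {dot 'rV[C]_n for Num.conj})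
    (c : chart X 'rV[C]_n) (x : X) : Prop :=
  exists (W : set X) (F : X -> 'rV[C]_n),
    [/\ nbhs x W, forall y, W y -> p y = torus_proj L (F y) &
        forall y y', W y -> W y' ->
          h (F y - F y') (F y - F y') = \sum_i `|(c y - c y') 0 i| ^+ 2].

Definition flat_compatible (h : {dot 'rV[C]_n for Num.conj}) : Prop :=
  forall c x, flat_atlas c -> dom c x -> ~ ramification_locus x ->
    local_isometry h c x.

End Covering.

Definition ramified_covering_of_torus (X : flat_space R n) : Prop :=
  exists (L : lattice) (h : {dot 'rV[C]_n for Num.conj})
    (p : X -> torus L), ramified_covering p /\ flat_compatible p h.

End Torus.

(* Main.v *)
Require Import Defs.
From HB Require Import structures.
From mathcomp Require Import all_boot all_order all_algebra.
From mathcomp Require Import complex ring lra zify.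
From mathcomp Require Import all_classical all_reals all_analysis.

(** A product of ramified coverings is a ramified covering of the product torus:
its branch set is B1 x T2 union T1 x B2, its sheets are products of sheets, and
the sum of the two Hermitian products is compatible with the product metric.
This is [prod_covering] and [prod_flat].

For the converse let p cover a torus by C1 x C2. Choose a point (x0, y0) where
p is unramified and neither coordinate is a vertex, and look at the slice
q = p(., y0) (the other factor is treated in the same way). Near x0 it is the
projection of a holomorphic map which is isometric for a Hermitian product h.
Such a map is affine ([isometry_affine]): in a flat coordinate c it reads
c e + b with h(e, e) = 1.

This shape propagates over the whole curve. Inside a chart it does so by unique
continuation of holomorphic functions ([identity_ball], obtained from Goursat's
theorem on rectangles and a Cauchy estimate). Between charts it does so because
two flat coordinates near a point which is not a vertex differ by a rotation
and a translation ([developing_compare]): triangles which meet there share an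
edge. At a vertex the flat coordinate is a power c ^ alpha of a complex chart.
By connectedness ([unit_form_all]) q is everywhere a c^alpha e + b modulo the
lattice L, with |a| = 1.

So q runs along the complex line b + C e, and q = tau e + b for a function tau
with values in C modulo the group G of those g with g e in L. The powers are
open maps, and the curve is compact; hence tau reaches every point of C
([reached_all]) and G is cocompact ([cocompact]). The group G is also discrete,
as L is, so it is a lattice of C: shortest vectors provide a basis
([rank2_basis]). Therefore tau is a map from the curve onto the one-dimensional
torus C / G. It is a local isometry off the vertices, and its fibres are
finite since those of p are; compactness of the curve makes it evenly covered
off the finitely many images of vertices ([cover_of_tau]). *)

Set Implicit Arguments.
Unset Strict Implicit.
Unset Printing Implicit Defensive.
Import Order.TTheory GRing.Theory Num.Theory.
Import numFieldNormedType.Exports.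
Local Open Scope classical_set_scope.
Local Open Scope ring_scope.
Local Open Scope complex_scope.
Local Notation Re := complex.Re.
Local Notation Im := complex.Im.

(** * The modulus as a real number *)

Section ComplexPlane.
Variable R : realType.
Notation C := (Cplx R).
Implicit Types (z w : C) (x y : R).

(** The modulus on [C] is valued in [C], where only real elements are comparable;
estimates are carried out in [R]. *)
Definition nrm (z : C) : R := Re `|z|.

Lemma nrmE z : (nrm z)%:C = `|z|.
Proof. by rewrite /nrm RRe_real ?normr_real. Qed.

Lemma nrm_sqrt z : nrm z = Num.sqrt ((Re z)^+2 + (Im z)^+2).
Proof. by rewrite /nrm normc_def. Qed.

Lemma nrm_ge0 z : 0 <= nrm z.
Proof. by rewrite nrm_sqrt sqrtr_ge0. Qed.

Lemma nrmM z w : nrm (z * w) = nrm z * nrm w.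
Proof. by apply: complexI; rewrite rmorphM /= !nrmE normrM. Qed.

Lemma nrmD z w : nrm (z + w) <= nrm z + nrm w.
Proof. by rewrite -lecR rmorphD /= !nrmE ler_normD. Qed.

Lemma nrmN z : nrm (- z) = nrm z.
Proof. by apply: complexI; rewrite !nrmE normrN. Qed.

Lemma nrmC z w : nrm (z - w) = nrm (w - z).
Proof. by rewrite -opprB nrmN. Qed.

Lemma nrmB z w : nrm (z - w) <= nrm z + nrm w.
Proof. by rewrite -[nrm w]nrmN nrmD. Qed.

Lemma nrm_tri z w u : nrm (z - w) <= nrm (z - u) + nrm (u - w).
Proof. by rewrite -[z - w](subrKA u) nrmD. Qed.

Lemma nrm0 : nrm 0 = 0.
Proof. by apply: complexI; rewrite nrmE normr0. Qed.

Lemma nrm1 : nrm 1 = 1.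
Proof. by apply: complexI; rewrite nrmE normr1. Qed.

Lemma nrmV z : nrm z^-1 = (nrm z)^-1.
Proof. by apply: complexI; rewrite nrmE normfV -nrmE -fmorphV. Qed.

Lemma nrmX z n : nrm (z ^+ n) = nrm z ^+ n.
Proof. by elim: n => [|n ih]; rewrite ?expr0 ?nrm1// !exprS nrmM ih. Qed.

Lemma nrm_eq0 z : (nrm z == 0) = (z == 0).
Proof. by rewrite -(inj_eq (@complexI R)) nrmE normr_eq0. Qed.

Lemma nrm_gt0 z : (0 < nrm z) = (z != 0).
Proof. by rewrite lt_def nrm_ge0 andbT nrm_eq0. Qed.

Lemma nrmR x : nrm x%:C = `|x|.
Proof. by rewrite nrm_sqrt /= expr0n addr0 sqrtr_sqr. Qed.

Lemma nrmi : nrm 'i = 1.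
Proof. by rewrite nrm_sqrt /= expr0n add0r expr1n sqrtr1. Qed.

Lemma Re_nrm z : `|Re z| <= nrm z.
Proof.
rewrite nrm_sqrt -sqrtr_sqr ler_wsqrtr// lerDl sqr_ge0 //.
Qed.

Lemma Im_nrm z : `|Im z| <= nrm z.
Proof. by rewrite nrm_sqrt -sqrtr_sqr ler_wsqrtr// lerDr sqr_ge0. Qed.

Lemma nrm_ReIm z : nrm z <= `|Re z| + `|Im z|.
Proof.
rewrite {1}(complexE z) (le_trans (nrmD _ _))// nrmM nrmi mul1r !nrmR//.
Qed.

Lemma nbhs_nrmP z (P : set C) : nbhs z P <->
  exists r : R, 0 < r /\ forall w, nrm (w - z) < r -> P w.
Proof.
split.
  move=> /nbhs_ballP [e /= e0 H].
  move: (e0); rewrite ltcE /= => /andP[/eqP ie re].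
  exists (Re e); split => // w hw; apply: H.
  rewrite /ball /= -normrN opprB -nrmE (_ : e = (Re e)%:C) ?ltcR//.
  by apply/eqP; rewrite eq_complex /= ie !eqxx.
move=> [r [r0 H]]; apply/nbhs_ballP; exists r%:C; first by rewrite /= ltcR.
by move=> w; rewrite /ball /= -normrN opprB -nrmE ltcR => /H.
Qed.

Lemma nbhs_nrm_ball z (r : R) : 0 < r -> nbhs z [set w | nrm (w - z) < r].
Proof. by move=> r0; apply/nbhs_nrmP; exists r. Qed.

Lemma continuousC (f : C -> C) z : {for z, continuous f} <->
  forall e : R, 0 < e -> exists2 d : R, 0 < d &
    forall w, nrm (w - z) < d -> nrm (f w - f z) < e.
Proof.
split.
  move=> fc e e0; have := fc _ (nbhs_nrm_ball (f z) e0).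
  by move=> /nbhs_nrmP [d [d0 H]]; exists d.
move=> H A /nbhs_nrmP [e [e0 HA]]; have [d d0 hd] := H e e0.
by apply/nbhs_nrmP; exists d; split => // w /hd; exact: HA.
Qed.

(** First-order approximation with real error bounds, the form in which
differentiability enters integral estimates. *)
Lemma differentiableC (f : C -> C) z : differentiable f z ->
  exists l : C, forall e : R, 0 < e -> exists2 d : R, 0 < d &
    forall w, nrm (w - z) < d -> nrm (f w - f z - l * (w - z)) <= e * nrm (w - z).
Proof.
move=> df; exists ('d f z 1) => e e0.
have /eqaddoP H := diff_locally df.
have e0' : 0 < e%:C by rewrite ltcR.
have := H _ e0' => /nbhs_nrmP [d [d0 hd]]; exists d => // w hw.
have := hd (w - z); rewrite subr0 => /(_ hw) /=.
rewrite -!nrmE -rmorphM /= lecR.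
rewrite (_ : (_ - _) (w - z) = f (w - z + z) - (f z + 'd f z (w - z)))//.
rewrite subrK opprD addrA (_ : 'd f z (w - z) = 'd f z 1 * (w - z))//.
by rewrite -[X in 'd f z X]mulr1 [X in 'd f z X]/((w - z) *: (1 : C)) linearZ mulrC.
Qed.

End ComplexPlane.

(** * Integrals over real intervals *)

Section Integral.
Variable R : realType.
Notation C := (Cplx R).
Notation mu := (@lebesgue_measure R).
Implicit Types (z w : C) (x y a b : R).

Definition cseg a b (g : R -> C) :=
  forall t, a <= t <= b -> {for t, continuous g}.

Lemma Re_continuous : continuous (fun z : C => Re z).
Proof.
move=> z A /nbhs_ballP [e /= e0 HA].
rewrite nbhs_simpl /=; apply/nbhs_nrmP; exists e; split => // w hw.
apply: HA; rewrite /ball /= distrC (le_lt_trans _ hw)//.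
by rewrite (_ : _ - _ = Re (w - z)) ?Re_nrm//; case: w z {hw} => [? ?] [? ?].
Qed.

Lemma Im_continuous : continuous (fun z : C => Im z).
Proof.
move=> z A /nbhs_ballP [e /= e0 HA].
rewrite nbhs_simpl /=; apply/nbhs_nrmP; exists e; split => // w hw.
apply: HA; rewrite /ball /= distrC (le_lt_trans _ hw)//.
by rewrite (_ : _ - _ = Im (w - z)) ?Im_nrm//; case: w z {hw} => [? ?] [? ?].
Qed.

Lemma cseg_Re a b g : cseg a b g -> {within `[a, b], continuous (fun t => Re (g t))}.
Proof.
move=> h; apply: continuous_in_subspaceT => t /set_mem /=.
rewrite in_itv /= => /h gt.
by apply: continuous_comp => //; exact: Re_continuous.
Qed.

Lemma cseg_Im a b g : cseg a b g -> {within `[a, b], continuous (fun t => Im (g t))}.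
Proof.
move=> h; apply: continuous_in_subspaceT => t /set_mem /=.
rewrite in_itv /= => /h gt.
by apply: continuous_comp => //; exact: Im_continuous.
Qed.

Lemma itv_integrable a b (f : R -> R) : {within `[a, b], continuous f} ->
  mu.-integrable `[a, b] (EFin \o f).
Proof.
by move=> h; apply: continuous_compact_integrable => //; exact: segment_compact.
Qed.

Definition rint a b (f : R -> R) := \int[mu]_(x in `[a, b]) f x.

Lemma rint_cst a b k : a <= b -> rint a b (fun=> k) = (b - a) * k.
Proof.
move=> ab; rewrite /rint Rintegral_cst//= lebesgue_measure_itv /= lte_fin.
case: ltgtP ab => //= [ab _|-> _]; first by rewrite mulrC.
by rewrite subrr mul0r mulr0.
Qed.

Lemma rint_split a b c (f : R -> R) : a <= b <= c ->
  {within `[a, c], continuous f} -> rint a c f = rint a b f + rint b c f.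
Proof.
move=> /andP[ab bc] fc; have fi := itv_integrable fc.
have := @Rintegral_itvB R f (BLeft a) (BRight c) b fi.
rewrite !bnd_simp => /(_ ab bc) h.
rewrite /rint; have [<- |bc'] := eqVneq b c.
  by rewrite set_itv1 Rintegral_set1 addr0.
rewrite -[X in _ + X](Rintegral_itv_obnd_cbnd (r := b)); first by rewrite -h subrKC.
by apply: integrableS fi => //; apply: subset_itvr; rewrite bnd_simp.
Qed.

Lemma rintD a b (f g : R -> R) : {within `[a, b], continuous f} ->
  {within `[a, b], continuous g} ->
  rint a b (fun t => f t + g t) = rint a b f + rint a b g.
Proof. by move=> fc gc; rewrite /rint RintegralD//; exact: itv_integrable. Qed.

Lemma rintZ a b k (f : R -> R) : {within `[a, b], continuous f} ->
  rint a b (fun t => k * f t) = k * rint a b f.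
Proof. by move=> fc; rewrite /rint RintegralZl//; exact: itv_integrable. Qed.

Definition cint a b (g : R -> C) : C :=
  (rint a b (fun t => Re (g t))) +i* (rint a b (fun t => Im (g t))).

Lemma eq_cint a b g h : (forall t, a <= t <= b -> g t = h t) ->
  cint a b g = cint a b h.
Proof.
move=> gh; rewrite /cint /rint; congr (_ +i* _); apply: eq_Rintegral => t;
by rewrite inE /= in_itv /= => /gh ->.
Qed.

Lemma cint_cst a b k : a <= b -> cint a b (fun=> k) = (b - a)%:C * k.
Proof. by move=> ab; rewrite /cint !rint_cst//; case: k => x y; simpc. Qed.

Lemma cint_split a b c g : a <= b <= c -> cseg a c g ->
  cint a c g = cint a b g + cint b c g.
Proof.
move=> abc gc; rewrite /cint.
by rewrite (rint_split abc (cseg_Re gc)) (rint_split abc (cseg_Im gc)).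
Qed.

Lemma cintD a b g h : cseg a b g -> cseg a b h ->
  cint a b (fun t => g t + h t) = cint a b g + cint a b h.
Proof.
move=> gc hc; rewrite /cint -[RHS]/(_ +i* _) -!rintD.
- by congr (_ +i* _); apply: eq_Rintegral => t _ /=; case: (g t) (h t) => [? ?] [? ?].
- exact: cseg_Im.
- exact: cseg_Im.
- exact: cseg_Re.
- exact: cseg_Re.
Qed.

Lemma cintZ a b k g : cseg a b g ->
  cint a b (fun t => k * g t) = k * cint a b g.
Proof.
move=> gc; rewrite /cint.
have ReC k' : {within `[a, b], continuous (fun t => k' * Re (g t))}.
  by move=> t; apply: cvgM; [exact: cvg_cst|exact: cseg_Re].
have ImC k' : {within `[a, b], continuous (fun t => k' * Im (g t))}.
  by move=> t; apply: cvgM; [exact: cvg_cst|exact: cseg_Im].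
case: k => x y; simpc.
rewrite -!(rintZ _ (cseg_Re gc)) -mulNr -!(rintZ _ (cseg_Im gc)) -!rintD//.
by congr (_ +i* _); apply: eq_Rintegral => t _ /=; case: (g t) => p q; simpc.
Qed.

Lemma rint_bound a b (f : R -> R) M : a <= b -> {within `[a, b], continuous f} ->
  (forall t, a <= t <= b -> `|f t| <= M) -> `|rint a b f| <= (b - a) * M.
Proof.
move=> ab fc fM; rewrite -(rint_cst _ ab) (le_trans (le_normr_Rintegral _ (itv_integrable fc)))//.
apply: le_Rintegral => //=.
- have := itv_integrable fc; exact: integrable_norm.
- by apply: itv_integrable => x; exact: cvg_cst.
Qed.

Lemma rint_lbound a b (f : R -> R) m : a <= b -> {within `[a, b], continuous f} ->
  (forall t, a <= t <= b -> m <= f t) -> (b - a) * m <= rint a b f.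
Proof.
move=> ab fc fM; rewrite -(rint_cst _ ab).
apply: le_Rintegral => //=.
- by apply: itv_integrable => x; exact: cvg_cst.
- exact: itv_integrable.
Qed.

(** The factor 2 comes from bounding the real and imaginary parts separately. *)
Lemma cint_bound a b g (M : R) : a <= b -> cseg a b g ->
  (forall t, a <= t <= b -> nrm (g t) <= M) -> nrm (cint a b g) <= 2 * (b - a) * M.
Proof.
move=> ab gc gM; rewrite (le_trans (nrm_ReIm _))//=.
have h1 : `|rint a b (fun t => Re (g t))| <= (b - a) * M.
  by apply: rint_bound (cseg_Re gc) _ => // t /gM; apply: le_trans (Re_nrm _).
have h2 : `|rint a b (fun t => Im (g t))| <= (b - a) * M.
  by apply: rint_bound (cseg_Im gc) _ => // t /gM; apply: le_trans (Im_nrm _).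
by rewrite -mulrA mulr_natl mulr2n lerD.
Qed.

End Integral.

(** * Boundary integrals of rectangles *)

Section Contour.
Variable R : realType.
Notation C := (Cplx R).
Implicit Types (z w : C) (x y a b : R) (f : C -> C).

Definition rect x1 x2 y1 y2 : set C :=
  [set z | x1 <= Re z <= x2 /\ y1 <= Im z <= y2].

(** Integral over the boundary of a rectangle. Opposite sides are paired under one
integral sign, so that the integrands are constant when [f] is affine. *)
Definition contour f x1 x2 y1 y2 : C :=
  cint x1 x2 (fun x => f (x +i* y1) - f (x +i* y2)) +
  'i * cint y1 y2 (fun y => f (x2 +i* y) - f (x1 +i* y)).

Definition cont_on (A : set C) f := forall z, A z -> {for z, continuous f}.

Lemma continuous_hor y : continuous (fun x : R => (x +i* y : C)).
Proof.
move=> x A /nbhs_nrmP [e [e0 HA]]; apply/nbhs_ballP; exists e => // t ht.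
apply: HA; move: ht; rewrite /ball /= distrC.
by rewrite (_ : (t +i* y : C) - (x +i* y) = (t - x)%:C) ?nrmR//; apply/eqP; rewrite eq_complex /= subrr !eqxx.
Qed.

Lemma continuous_ver x : continuous (fun y : R => (x +i* y : C)).
Proof.
move=> y A /nbhs_nrmP [e [e0 HA]]; apply/nbhs_ballP; exists e => // t ht.
apply: HA; move: ht; rewrite /ball /= distrC.
by rewrite (_ : (x +i* t : C) - (x +i* y) = 'i * (t - y)%:C) ?nrmM ?nrmi ?mul1r ?nrmR//; simpc.
Qed.

Lemma cseg_hor f x1 x2 y1 y2 y : cont_on (rect x1 x2 y1 y2) f -> y1 <= y <= y2 ->
  cseg x1 x2 (fun x => f (x +i* y)).
Proof.
by move=> fc hy x hx; apply: (continuous_comp (@continuous_hor y x)); exact: fc.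
Qed.

Lemma cseg_ver f x1 x2 y1 y2 x : cont_on (rect x1 x2 y1 y2) f -> x1 <= x <= x2 ->
  cseg y1 y2 (fun y => f (x +i* y)).
Proof.
by move=> fc hx y hy; apply: (continuous_comp (@continuous_ver x y)); exact: fc.
Qed.

Lemma csegB a b (g h : R -> C) : cseg a b g -> cseg a b h ->
  cseg a b (fun t => g t - h t).
Proof. by move=> gc hc t ht; apply: cvgB; [exact: gc|exact: hc]. Qed.

Lemma cintB a b (g h : R -> C) : cseg a b g -> cseg a b h ->
  cint a b (fun t => g t - h t) = cint a b g - cint a b h.
Proof.
move=> gc hc; have hN : cseg a b (fun t => -1 * h t).
  by move=> t ht; apply: (cvgM (cvg_cst _)); exact: hc.
have -> : cint a b g - cint a b h = cint a b g + cint a b (fun t => -1 * h t).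
  by rewrite (cintZ _ hc) mulN1r.
rewrite -cintD//.
by apply: eq_cint => t _; rewrite mulN1r.
Qed.

Lemma rectE x1 x2 y1 y2 x y : x1 <= x <= x2 -> y1 <= y <= y2 -> rect x1 x2 y1 y2 (x +i* y).
Proof. by split. Qed.

Lemma contour_splitx f x1 m x2 y1 y2 : x1 <= m <= x2 -> y1 <= y2 ->
  cont_on (rect x1 x2 y1 y2) f ->
  contour f x1 x2 y1 y2 = contour f x1 m y1 y2 + contour f m x2 y1 y2.
Proof.
move=> hm hy fc; case/andP: (hm) => m1 m2; rewrite /contour.
rewrite (cint_split hm); last first.
  by apply: csegB; apply: cseg_hor fc _; rewrite lexx ?hx ?hy.
rewrite !(cintB (a := y1)); try by apply: cseg_ver fc _; rewrite ?lexx ?m1 ?m2 ?(le_trans m1 m2).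
ring.
Qed.

Lemma contour_splity f x1 x2 y1 m y2 : x1 <= x2 -> y1 <= m <= y2 ->
  cont_on (rect x1 x2 y1 y2) f ->
  contour f x1 x2 y1 y2 = contour f x1 x2 y1 m + contour f x1 x2 m y2.
Proof.
move=> hx hm fc; case/andP: (hm) => m1 m2; rewrite /contour.
rewrite (cint_split hm); last first.
  by apply: csegB; apply: cseg_ver fc _; rewrite lexx ?hx ?hy.
rewrite !(cintB (a := x1)); try by apply: cseg_hor fc _; rewrite ?lexx ?m1 ?m2 ?(le_trans m1 m2).
ring.
Qed.

(** The contour integral depends only on the restriction of [f] to this set, which
matters for functions with a singularity inside the rectangle. *)
Definition frame x1 x2 y1 y2 : set C := rect x1 x2 y1 y2 `&`
  [set z | [|| Re z == x1, Re z == x2, Im z == y1 | Im z == y2]].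

Lemma cseg_frame f x1 x2 y1 y2 : x1 <= x2 -> y1 <= y2 ->
  cont_on (frame x1 x2 y1 y2) f ->
  cseg x1 x2 (fun x => f (x +i* y1) - f (x +i* y2)) /\
  cseg y1 y2 (fun y => f (x2 +i* y) - f (x1 +i* y)).
Proof.
move=> hx hy fc; split; apply: csegB => t ht.
- apply: (continuous_comp (@continuous_hor y1 t)); apply: fc.
  by split; rewrite /= ?eqxx ?orbT//; apply: rectE; rewrite ?lexx ?hx ?hy.
- apply: (continuous_comp (@continuous_hor y2 t)); apply: fc.
  by split; rewrite /= ?eqxx ?orbT//; apply: rectE; rewrite ?lexx ?hx ?hy.
- apply: (continuous_comp (@continuous_ver x2 t)); apply: fc.
  by split; rewrite /= ?eqxx ?orbT//; apply: rectE; rewrite ?lexx ?hx ?hy.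
- apply: (continuous_comp (@continuous_ver x1 t)); apply: fc.
  by split; rewrite /= ?eqxx ?orbT//; apply: rectE; rewrite ?lexx ?hx ?hy.
Qed.

Lemma eq_contour f g x1 x2 y1 y2 : x1 <= x2 -> y1 <= y2 ->
  (forall z, frame x1 x2 y1 y2 z -> f z = g z) ->
  contour f x1 x2 y1 y2 = contour g x1 x2 y1 y2.
Proof.
move=> hx hy fg; rewrite /contour; congr (_ + _ * _); apply: eq_cint => t ht;
by rewrite !fg//; split; rewrite /= ?eqxx ?orbT//; apply: rectE; rewrite ?lexx ?hx ?hy.
Qed.

Lemma contourZ f k x1 x2 y1 y2 : x1 <= x2 -> y1 <= y2 ->
  cont_on (frame x1 x2 y1 y2) f ->
  contour (fun z => k * f z) x1 x2 y1 y2 = k * contour f x1 x2 y1 y2.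
Proof.
move=> hx hy fc; have [h1 h2] := cseg_frame hx hy fc.
rewrite /contour [RHS]mulrDr [k * ('i * _)]mulrCA -(cintZ k h1) -(cintZ k h2).
by congr (_ + _ * _); apply: eq_cint => t _; rewrite mulrBr.
Qed.

Lemma contourB f g x1 x2 y1 y2 : x1 <= x2 -> y1 <= y2 ->
  cont_on (frame x1 x2 y1 y2) f -> cont_on (frame x1 x2 y1 y2) g ->
  contour (fun z => f z - g z) x1 x2 y1 y2 = contour f x1 x2 y1 y2 - contour g x1 x2 y1 y2.
Proof.
move=> hx hy fc gc; have [h1 h2] := cseg_frame hx hy fc.
have [h1' h2'] := cseg_frame hx hy gc.
have E (a b c d : C) : a + 'i * b - (c + 'i * d) = (a - c) + 'i * (b - d) by ring.
rewrite /contour [RHS]E -(cintB h1 h1') -(cintB h2 h2').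
by congr (_ + _ * _); apply: eq_cint => t _; ring.
Qed.

Lemma contour_affine (k l : C) x1 x2 y1 y2 : x1 <= x2 -> y1 <= y2 ->
  contour (fun z => k + l * z) x1 x2 y1 y2 = 0.
Proof.
move=> hx hy; rewrite /contour.
rewrite (@eq_cint _ _ _ _ (fun=> l * ('i * (y1 - y2)%:C))); last first.
  by move=> t _; case: k => ? ?; case: l => p q; apply/eqP; rewrite eq_complex /=; apply/andP; split; apply/eqP; ring.
rewrite (@eq_cint _ y1 _ _ (fun=> l * (x2 - x1)%:C)); last first.
  by move=> t _; case: k => ? ?; case: l => p q; apply/eqP; rewrite eq_complex /=; apply/andP; split; apply/eqP; ring.
rewrite !cint_cst// !rmorphB /=; ring.
Qed.

Lemma contour_bound f M x1 x2 y1 y2 : x1 <= x2 -> y1 <= y2 ->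
  cont_on (frame x1 x2 y1 y2) f ->
  (forall z, frame x1 x2 y1 y2 z -> nrm (f z) <= M) ->
  nrm (contour f x1 x2 y1 y2) <= 4 * M * ((x2 - x1) + (y2 - y1)).
Proof.
move=> hx hy fc fM; have [h1 h2] := cseg_frame hx hy fc.
have b1 : nrm (cint x1 x2 (fun x => f (x +i* y1) - f (x +i* y2))) <= 2 * (x2 - x1) * (2 * M).
  apply: cint_bound => // t ht.
  rewrite (le_trans (nrmB _ _))// mulr_natl mulr2n lerD//; apply: fM;
    by split; rewrite /= ?eqxx ?orbT//; apply: rectE; rewrite ?lexx ?hx ?hy.
have b2 : nrm (cint y1 y2 (fun y => f (x2 +i* y) - f (x1 +i* y))) <= 2 * (y2 - y1) * (2 * M).
  apply: cint_bound => // t ht.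
  rewrite (le_trans (nrmB _ _))// mulr_natl mulr2n lerD//; apply: fM;
    by split; rewrite /= ?eqxx ?orbT//; apply: rectE; rewrite ?lexx ?hx ?hy.
rewrite (le_trans (nrmD _ _))// nrmM nrmi mul1r.
rewrite (le_trans (lerD b1 b2))//; lra.
Qed.

Lemma cont_frame f x1 x2 y1 y2 : cont_on (rect x1 x2 y1 y2) f ->
  cont_on (frame x1 x2 y1 y2) f.
Proof. by move=> fc z [/fc]. Qed.

End Contour.

(** * Goursat's theorem *)

Section Goursat.
Variable R : realType.
Notation C := (Cplx R).
Implicit Types (z w : C) (x y a b : R) (f : C -> C).

Lemma affine_continuous (k l : C) : continuous (fun u : C => k + l * u).
Proof.
by move=> u; apply: continuousD; [exact: cst_continuous|exact: mulrl_continuous].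
Qed.

Lemma nested_pt (a b : nat -> R) : (forall n, a n <= a n.+1) ->
  (forall n, b n.+1 <= b n) -> (forall n, a n <= b n) ->
  exists x, forall n, a n <= x <= b n.
Proof.
move=> ha hb hab.
have am : {homo a : m n / (m <= n)%N >-> m <= n} by apply/nondecreasing_seqP.
have bm : {homo b : m n / (m <= n)%N >-> n <= m} by apply/nonincreasing_seqP.
have h n m : a n <= b m.
  have [nm|mn] := leqP n m; first exact: le_trans (am _ _ nm) _.
  exact: le_trans (hab n) (bm _ _ (ltnW mn)).
exists (sup (range a)) => n; apply/andP; split.
  apply: ub_le_sup; last by exists n.
  by exists (b 0) => _ [k _ <-].
by apply: ge_sup; [exists (a 0); exists 0 | move=> _ [k _ <-]].
Qed.

Lemma pow2_gt (e s : R) : 0 < e -> exists n, s / 2 ^+ n < e.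
Proof.
move=> e0; have hn := archi_boundP (normr_ge0 (s / e)).
set n := Num.bound _ in hn; exists n.
have p0 : 0 < 2 ^+ n :> R by rewrite exprn_gt0.
rewrite ltr_pdivrMr// mulrC -ltr_pdivrMr//.
rewrite (le_lt_trans (ler_norm _))// (lt_trans hn)// -natrX ltr_nat.
exact: ltn_expl.
Qed.

(** The boundary integrals of the four quarters add up to the whole one, so one of
them carries at least a quarter of it. *)
Lemma contour_bisect f x1 x2 y1 y2 : x1 <= x2 -> y1 <= y2 ->
  cont_on (rect x1 x2 y1 y2) f ->
  exists q : R * R * (R * R),
    [/\ x1 <= q.1.1, q.1.2 <= x2, y1 <= q.2.1 & q.2.2 <= y2] /\
    [/\ q.1.2 - q.1.1 = (x2 - x1) / 2, q.2.2 - q.2.1 = (y2 - y1) / 2 &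
      nrm (contour f x1 x2 y1 y2) <= 4 * nrm (contour f q.1.1 q.1.2 q.2.1 q.2.2)].
Proof.
move=> hx hy fc; set mx := (x1 + x2) / 2; set my := (y1 + y2) / 2.
have hmx : x1 <= mx <= x2 by apply/andP; rewrite /mx; split; lra.
have hmy : y1 <= my <= y2 by apply/andP; rewrite /my; split; lra.
have [mx1 mx2] := andP hmx; have [my1 my2] := andP hmy.
have fcl : cont_on (rect x1 mx y1 y2) f.
  by move=> z [/andP[? ?] ?]; apply: fc; split => //; apply/andP; split => //; lra.
have fcr : cont_on (rect mx x2 y1 y2) f.
  by move=> z [/andP[? ?] ?]; apply: fc; split => //; apply/andP; split => //; lra.
have E : contour f x1 x2 y1 y2 = contour f x1 mx y1 my + contour f x1 mx my y2 +
    (contour f mx x2 y1 my + contour f mx x2 my y2).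
  by rewrite (contour_splitx hmx hy fc) (contour_splity mx1 hmy fcl) (contour_splity mx2 hmy fcr).
set N := nrm _; pose P q := N <= 4 * nrm (contour f q.1.1 q.1.2 q.2.1 q.2.2).
have D1 : mx - x1 = (x2 - x1) / 2 by rewrite /mx; lra.
have D2 : x2 - mx = (x2 - x1) / 2 by rewrite /mx; lra.
have D3 : my - y1 = (y2 - y1) / 2 by rewrite /my; lra.
have D4 : y2 - my = (y2 - y1) / 2 by rewrite /my; lra.
have [h|h1] := boolP (P ((x1, mx), (y1, my))); first by exists ((x1, mx), (y1, my)).
have [h|h2] := boolP (P ((x1, mx), (my, y2))); first by exists ((x1, mx), (my, y2)).
have [h|h3] := boolP (P ((mx, x2), (y1, my))); first by exists ((mx, x2), (y1, my)).
have [h|h4] := boolP (P ((mx, x2), (my, y2))); first by exists ((mx, x2), (my, y2)).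
exfalso; move: h1 h2 h3 h4; rewrite /P -!ltNge /=.
have : N <= nrm (contour f x1 mx y1 my) + nrm (contour f x1 mx my y2) +
    (nrm (contour f mx x2 y1 my) + nrm (contour f mx x2 my y2)).
  by rewrite /N E; apply: (le_trans (nrmD _ _)); apply: lerD; apply: nrmD.
lra.
Qed.

(** Repeated bisection leads to a point where [f] is affine up to an error that is
small with respect to the diameter of the rectangle. Affine functions integrate
to zero, so the integral over the n-th rectangle is o(4^-n); but the choice of
the quarters keeps it above 4^-n times the initial one. *)
Theorem goursat f x1 x2 y1 y2 : x1 <= x2 -> y1 <= y2 ->
  (forall z, rect x1 x2 y1 y2 z -> differentiable f z) ->
  contour f x1 x2 y1 y2 = 0.
Proof.
move=> hx hy df.
have fc : cont_on (rect x1 x2 y1 y2) f.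
  by move=> z /df; exact: differentiable_continuous.
pose Q := (R * R * (R * R))%type.
pose sub (q q' : Q) := [/\ q.1.1 <= q'.1.1, q'.1.2 <= q.1.2, q.2.1 <= q'.2.1 & q'.2.2 <= q.2.2].
pose q0 : Q := ((x1, x2), (y1, y2)).
pose good (q : Q) := [/\ q.1.1 <= q.1.2, q.2.1 <= q.2.2 & sub q0 q].
pose N (q : Q) := nrm (contour f q.1.1 q.1.2 q.2.1 q.2.2).
pose step (q q' : Q) := good q -> [/\ sub q q', q'.1.2 - q'.1.1 = (q.1.2 - q.1.1) / 2,
  q'.2.2 - q'.2.1 = (q.2.2 - q.2.1) / 2 & N q <= 4 * N q'].
have /choice [next hnext] : forall q, exists q', step q q'.
  move=> q; have [gq|ngq] := pselect (good q); last by exists q => /ngq.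
  have [qx qy [s1 s2 s3 s4]] := gq.
  have fq : cont_on (rect q.1.1 q.1.2 q.2.1 q.2.2) f.
    move=> z [/andP[h1 h2] /andP[h3 h4]]; apply: fc; move: s1 s2 s3 s4; rewrite /q0 /= => s1 s2 s3 s4.
    by split; apply/andP; split; lra.
  by have [q' [? [? ? ?]]] := contour_bisect qx qy fq; exists q'.
pose s n := iter n next q0.
have gs n : good (s n).
  elim: n => [|n gn]; first by split.
  have [[a1 a2 a3 a4] b1 b2 _] := hnext _ gn; have [g1 g2 [g3 g4 g5 g6]] := gn.
  by rewrite /s iterS -/(s n); split; [lra|lra|split; lra].
have hs n := hnext _ (gs n).
have wx n : (s n).1.2 - (s n).1.1 = (x2 - x1) / 2 ^+ n.
  elim: n => [|n ih]; first by rewrite expr0 divr1.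
  by have [_ -> _ _] := hs n; rewrite ih exprS invfM mulrA mulrAC.
have wy n : (s n).2.2 - (s n).2.1 = (y2 - y1) / 2 ^+ n.
  elim: n => [|n ih]; first by rewrite expr0 divr1.
  by have [_ _ -> _] := hs n; rewrite ih exprS invfM mulrA mulrAC.
have NN n : N q0 <= 4 ^+ n * N (s n).
  elim: n => [|n ih]; first by rewrite expr0 mul1r.
  rewrite (le_trans ih)// exprSr -mulrA ler_wpM2l ?exprn_ge0//.
  by have [_ _ _] := hs n.
have [x hxn] : exists x, forall n, (s n).1.1 <= x <= (s n).1.2.
  by apply: nested_pt => n; [have [[]] := hs n|have [[]] := hs n|have [] := gs n].
have [y hyn] : exists y, forall n, (s n).2.1 <= y <= (s n).2.2.
  by apply: nested_pt => n; [have [[]] := hs n|have [[]] := hs n|have [] := gs n].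
pose z : C := x +i* y.
apply/eqP; rewrite -nrm_eq0 eq_le nrm_ge0 andbT leNgt; apply/negP => eta0.
set eta := nrm _ in eta0.
have dz : differentiable f z by apply: df; split; [exact: (hxn 0)|exact: (hyn 0)].
have [l hl] := differentiableC dz.
pose S := (x2 - x1) + (y2 - y1).
have S0 : 0 <= S by rewrite /S; lra.
(* A ratio [e] of error to distance bounds the last integral by 4 e S^2 4^-n; this
value makes the bound smaller than eta 4^-n. *)
pose e := eta / (8 * (S ^+ 2 + 1)).
have S1 : 0 < 8 * (S ^+ 2 + 1) by have := sqr_ge0 S; lra.
have e0 : 0 < e by rewrite divr_gt0.
have [d d0 hd] := hl e e0.
have [n hn] := pow2_gt S d0.
have p2 : 0 < 2 ^+ n :> R by rewrite exprn_gt0.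
have [gx gy [g1 g2 g3 g4]] := gs n; rewrite /q0 /= in g1 g2 g3 g4.
set q := s n in gx gy g1 g2 g3 g4.
have fq : cont_on (rect q.1.1 q.1.2 q.2.1 q.2.2) f.
  move=> u [/andP[? ?] /andP[? ?]]; apply: fc; split; apply/andP; split; lra.
pose A u : C := (f z - l * z) + l * u.
have Ac : cont_on (rect q.1.1 q.1.2 q.2.1 q.2.2) A.
  by move=> u _; exact: affine_continuous.
have Eq : contour f q.1.1 q.1.2 q.2.1 q.2.2 =
    contour (fun u => f u - A u) q.1.1 q.1.2 q.2.1 q.2.2.
  rewrite contourB//; [|exact: cont_frame|exact: cont_frame].
  by rewrite contour_affine// subr0.
have : N q <= 4 * (e * (S / 2 ^+ n)) * ((q.1.2 - q.1.1) + (q.2.2 - q.2.1)).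
  rewrite /N Eq; apply: contour_bound => //.
    by move=> u [uq _]; apply: continuousB; [exact: fq|exact: Ac].
  move=> u [[/andP[u1 u2] /andP[u3 u4]] _].
  have hu : nrm (u - z) <= S / 2 ^+ n.
    rewrite (le_trans (nrm_ReIm _))// /S mulrDl -(wx n) -(wy n) -/q.
    have /andP[? ?] := hxn n; have /andP[? ?] := hyn n.
    have -> : Re (u - z) = Re u - x by rewrite /z; case: (u).
    have -> : Im (u - z) = Im u - y by rewrite /z; case: (u).
    by rewrite lerD// ler_norml; apply/andP; split; rewrite -/q in u1 u2 u3 u4 *; lra.
  have -> : f u - A u = f u - f z - l * (u - z) by rewrite /A; ring.
  by rewrite (le_trans (hd _ (le_lt_trans hu hn)))// ler_wpM2l// ltW.
rewrite (wx n) (wy n) -mulrDl -/S => hN.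
have := NN n; rewrite -/q -[N q0]/eta => he.
have p4 : 4 ^+ n = 2 ^+ n * 2 ^+ n :> R by rewrite -exprMn; congr (_ ^+ _); ring.
have {he} : eta <= 4 ^+ n * (4 * (e * (S / 2 ^+ n)) * (S / 2 ^+ n)).
  by rewrite (le_trans he)// ler_wpM2l// p4 mulr_ge0// ltW.
have -> : 4 ^+ n * (4 * (e * (S / 2 ^+ n)) * (S / 2 ^+ n)) = 4 * e * S ^+ 2.
  by rewrite p4; field; rewrite gt_eqF.
have he : eta = e * (8 * (S ^+ 2 + 1)) by rewrite /e mulfVK// gt_eqF.
have := sqr_ge0 S; rewrite {1}he; nra.
Qed.

End Goursat.

Section ContourHole.
Variable R : realType.
Notation C := (Cplx R).
Implicit Types (z w : C) (x y : R) (f k : C -> C).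

Lemma rect_sub x1 x2 y1 y2 u1 u2 v1 v2 z : x1 <= u1 -> u2 <= x2 -> y1 <= v1 -> v2 <= y2 ->
  rect u1 u2 v1 v2 z -> rect x1 x2 y1 y2 z.
Proof.
by move=> ? ? ? ? [/andP[? ?] /andP[? ?]]; split; apply/andP; split; lra.
Qed.

(** One point of mere continuity is harmless: a small square around it leaves four
rectangles to which [goursat] applies, and the integral over the square is
bounded by its perimeter. Difference quotients have such a point. *)
Lemma contour_hole k (a : C) x1 x2 y1 y2 : x1 < Re a < x2 -> y1 < Im a < y2 ->
  cont_on (rect x1 x2 y1 y2) k ->
  (forall z, rect x1 x2 y1 y2 z -> z != a -> differentiable k z) ->
  contour k x1 x2 y1 y2 = 0.
Proof.
move=> /andP[a1 a2] /andP[b1 b2] kc dk.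
pose B := nrm (k a) + 1.
have ka : {for a, continuous k} by apply: kc; split; apply/andP; split; exact: ltW.
have [d d0 hd] := (continuousC k a).1 ka 1 ltr01.
have Bk z : nrm (z - a) < d -> nrm (k z) <= B.
  move=> /hd h; rewrite -[k z](subrK (k a)) (le_trans (nrmD _ _))// addrC lerD2l; exact: ltW.
have B0 : 0 < B by rewrite ltr_wpDl ?nrm_ge0.
apply/eqP; rewrite -nrm_eq0 eq_le nrm_ge0 andbT leNgt; apply/negP => e0.
set e := nrm _ in e0.
(* The half side [t] keeps the square inside the rectangle and inside the disc
where |k| <= B, with a perimeter too short for an integral of modulus [e]. *)
pose t := Num.min (Num.min (Num.min (Re a - x1) (x2 - Re a)) (Num.min (Im a - y1) (y2 - Im a)))
   (Num.min (d / 3) (e / (32 * B))).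
have t0 : 0 < t.
  rewrite /t !lt_min; apply/andP; split; apply/andP; split; rewrite ?divr_gt0 ?mulr_gt0//;
  by apply/andP; split; lra.
have : t <= t by [].
rewrite {2}/t !le_min => /andP[/andP[/andP[t1 t2] /andP[t3 t4]] /andP[t5 t6]].
have [p pE] : exists p, p = Re a - t by exists (Re a - t).
have [q qE] : exists q, q = Re a + t by exists (Re a + t).
have [r rE] : exists r, r = Im a - t by exists (Im a - t).
have [s sE] : exists s, s = Im a + t by exists (Im a + t).
have hp : x1 <= p <= x2 by apply/andP; split; lra.
have hq : p <= q <= x2 by apply/andP; split; lra.
have hr : y1 <= r <= y2 by apply/andP; split; lra.
have hs : r <= s <= y2 by apply/andP; split; lra.
have [[p1 p2] [q1 q2]] := (andP hp, andP hq).
have [[r1 r2] [s1 s2]] := (andP hr, andP hs).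
have sub u1 u2 v1 v2 : x1 <= u1 -> u2 <= x2 -> y1 <= v1 -> v2 <= y2 ->
    cont_on (rect u1 u2 v1 v2) k.
  by move=> h1 h2 h3 h4 z hz; apply: kc; apply: rect_sub hz.
have zero u1 u2 v1 v2 : x1 <= u1 -> u1 <= u2 -> u2 <= x2 -> y1 <= v1 -> v1 <= v2 -> v2 <= y2 ->
    ~ rect u1 u2 v1 v2 a -> contour k u1 u2 v1 v2 = 0.
  move=> h1 h2 h3 h4 h5 h6 h; apply: (goursat h2 h5) => z hz; apply: dk.
    exact: (rect_sub h1 h3 h4 h6 hz).
  by apply/eqP => za; rewrite za in hz.
have p3 : p < Re a by lra.
have q3 : Re a < q by lra.
have r3 : r < Im a by lra.
have s3 : Im a < s by lra.
have hy : y1 <= y2 by lra.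
have px2 : p <= q by lra.
have Z1 : contour k x1 p y1 y2 = 0.
  by apply: zero => //; try lra; move=> [/andP[_ h] _]; lra.
have Z2 : contour k q x2 y1 y2 = 0.
  by apply: zero => //; try lra; move=> [/andP[h _] _]; lra.
have Z3 : contour k p q y1 r = 0.
  by apply: zero => //; try lra; move=> [_ /andP[_ h]]; lra.
have Z4 : contour k p q s y2 = 0.
  by apply: zero => //; try lra; move=> [_ /andP[h _]]; lra.
have E : contour k x1 x2 y1 y2 = contour k p q r s.
  rewrite (contour_splitx hp hy kc) Z1 add0r.
  rewrite (contour_splitx hq hy); last by apply: sub; lra.
  rewrite Z2 addr0 (contour_splity px2 hr); last by apply: sub; lra.
  rewrite Z3 add0r (contour_splity px2 hs); last by apply: sub; lra.
  by rewrite Z4 addr0.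
have eE : e = nrm (contour k p q r s) by exact: (congr1 (@nrm R) E).
have : e <= 4 * B * ((q - p) + (s - r)).
  rewrite eE; apply: (contour_bound px2 s1); first by apply: cont_frame; apply: sub; lra.
  move=> z [[/andP[z1 z2] /andP[z3 z4]] _]; apply: Bk.
  rewrite (le_lt_trans (nrm_ReIm _))//.
  have -> : Re (z - a) = Re z - Re a by case: (z) (a) => [? ?] [? ?].
  have -> : Im (z - a) = Im z - Im a by case: (z) (a) => [? ?] [? ?].
  have h1 : `|Re z - Re a| <= t by rewrite ler_norml; apply/andP; split; lra.
  have h2 : `|Im z - Im a| <= t by rewrite ler_norml; apply/andP; split; lra.
  by rewrite (le_lt_trans (lerD h1 h2))//; lra.
move: t6; rewrite ler_pdivlMr ?mulr_gt0// => t6.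
have : 0 < t * B by rewrite mulr_gt0.
rewrite (_ : 4 * B * _ = 16 * (t * B)); last by rewrite pE qE rE sE; ring.
by rewrite mulrCA in t6; lra.
Qed.

End ContourHole.

(** * The Cauchy estimate *)

Section CauchyKernel.
Variable R : realType.
Notation C := (Cplx R).
Implicit Types (z w : C) (x y : R) (f k : C -> C).

Lemma nrm_continuous : continuous (@nrm R).
Proof.
move=> z A /nbhs_ballP [e /= e0 HA].
rewrite nbhs_simpl /=; apply/nbhs_nrmP; exists e; split => // w hw.
apply: HA; rewrite /ball /= distrC (le_lt_trans _ hw)//.
have h1 := nrmD (w - z) z; have h2 := nrmD (z - w) w; rewrite !subrK in h1 h2.
by rewrite (nrmC z w) in h2; rewrite ler_norml; apply/andP; split; lra.
Qed.

Lemma seg_bound a b (g : R -> C) : a <= b -> cseg a b g ->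
  exists M, forall t, a <= t <= b -> nrm (g t) <= M.
Proof.
move=> ab gc; have [|c _ hc] := @EVT_max R (fun t => nrm (g t)) a b ab; last first.
  by exists (nrm (g c)) => t ht; apply: hc; rewrite in_itv.
apply: continuous_in_subspaceT => t /set_mem /=; rewrite in_itv /= => /gc gt.
by apply: continuous_comp => //; exact: nrm_continuous.
Qed.

Lemma frame_bound f x1 x2 y1 y2 : x1 <= x2 -> y1 <= y2 ->
  cont_on (rect x1 x2 y1 y2) f ->
  exists M, forall z, frame x1 x2 y1 y2 z -> nrm (f z) <= M.
Proof.
move=> hx hy fc.
have [M1 h1] : exists M, forall t, x1 <= t <= x2 -> nrm (f (t +i* y1)) <= M.
  by apply: seg_bound => //; apply: cseg_hor fc _; rewrite lexx hy.
have [M2 h2] : exists M, forall t, x1 <= t <= x2 -> nrm (f (t +i* y2)) <= M.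
  by apply: seg_bound => //; apply: cseg_hor fc _; rewrite lexx hy.
have [M3 h3] : exists M, forall t, y1 <= t <= y2 -> nrm (f (x1 +i* t)) <= M.
  by apply: seg_bound => //; apply: cseg_ver fc _; rewrite lexx hx.
have [M4 h4] : exists M, forall t, y1 <= t <= y2 -> nrm (f (x2 +i* t)) <= M.
  by apply: seg_bound => //; apply: cseg_ver fc _; rewrite lexx hx.
exists (Num.max (Num.max M1 M2) (Num.max M3 M4)) => -[x y] [[/= r1 r2]] h; rewrite !le_max.
case/or4P: h => /eqP e; rewrite e in r1 r2 *.
- by rewrite h3 ?orbT.
- by rewrite h4 ?orbT.
- by rewrite h1.
- by rewrite h2 ?orbT.
Qed.

Lemma differentiable_id (z : C) : differentiable (fun w : C => w) z.
Proof. exact: ex_diff. Qed.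

Lemma differentiable_subC (a z : C) : differentiable (fun w : C => w - a) z.
Proof. apply: differentiableB; [exact: differentiable_id|exact: differentiable_cst]. Qed.

Lemma differentiable_invB (a z : C) : z != a -> differentiable (fun w : C => (w - a)^-1) z.
Proof.
move=> za; apply: (@differentiableV _ _ (fun w : C => w - a)); first exact: differentiable_subC.
by rewrite subr_eq0.
Qed.

Lemma ReV z : Re z^-1 = Re z / (nrm z) ^+ 2.
Proof. by case: z => x y; rewrite nrm_sqrt /= sqr_sqrtr// addr_ge0 ?sqr_ge0. Qed.

Lemma ImV z : Im z^-1 = - Im z / (nrm z) ^+ 2.
Proof. by case: z => x y; rewrite nrm_sqrt /= mulNr sqr_sqrtr// addr_ge0 ?sqr_ge0. Qed.

(** The imaginary part is a sum of two integrals with nonnegative integrands, one of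
which is bounded below by a positive constant. *)
Lemma cauchy_kernel (a : C) x1 x2 y1 y2 : x1 < Re a < x2 -> y1 < Im a < y2 ->
  contour (fun z => (z - a)^-1) x1 x2 y1 y2 != 0.
Proof.
move=> /andP[a1 a2] /andP[b1 b2].
have hx : x1 <= x2 by lra. have hy : y1 <= y2 by lra.
set f := fun z => _.
have fc : cont_on (frame x1 x2 y1 y2) f.
  move=> z [_ hz]; apply: differentiable_continuous; apply: differentiable_invB.
  by apply/eqP => za; case/or4P: hz => /eqP; rewrite za; lra.
have [c1 c2] := cseg_frame hx hy fc.
pose D := (x2 - x1) + (y2 - y1); have D0 : 0 < D by rewrite /D; lra.
apply/eqP => /(congr1 (fun z : C => Im z)); rewrite /contour.
set A := cint _ _ _; set B := cint _ _ _ => E.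
have {}E : Im A + Re B = 0 by rewrite -[RHS]E; case: (A) (B) => [? ?] [? ?] /=; ring.
have hA : (x2 - x1) * 0 <= Im A.
  apply: rint_lbound => //; first exact: (cseg_Im c1).
  move=> t ht; rewrite (_ : Im (f _ - f _) = Im (f (t +i* y1)) - Im (f (t +i* y2))); last by case: (f _) (f _) => [? ?] [? ?].
  rewrite /f !ImV.
  have -> : Im (t +i* y1 - a) = y1 - Im a by case: (a).
  have -> : Im (t +i* y2 - a) = y2 - Im a by case: (a).
  have h1 : 0 <= - (y1 - Im a) / nrm (t +i* y1 - a) ^+ 2.
    by rewrite divr_ge0 ?sqr_ge0//; lra.
  have h2 : 0 <= (y2 - Im a) / nrm (t +i* y2 - a) ^+ 2.
    by rewrite divr_ge0 ?sqr_ge0//; lra.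
  rewrite mulNr in h1 *; rewrite mulNr; lra.
have hB : (y2 - y1) * ((x2 - Re a) / D ^+ 2) <= Re B.
  apply: rint_lbound => //; first exact: (cseg_Re c2).
  move=> t ht; rewrite (_ : Re (f _ - f _) = Re (f (x2 +i* t)) - Re (f (x1 +i* t))); last by case: (f _) (f _) => [? ?] [? ?].
  rewrite /f !ReV.
  have R2 : Re (x2 +i* t - a) = x2 - Re a by case: (a).
  have R1 : Re (x1 +i* t - a) = x1 - Re a by case: (a).
  have I2 : Im (x2 +i* t - a) = t - Im a by case: (a).
  have h1 : 0 <= - (x1 - Re a) / nrm (x1 +i* t - a) ^+ 2.
    by rewrite divr_ge0 ?sqr_ge0//; lra.
  rewrite R1 R2.
  have h2 : (x2 - Re a) / D ^+ 2 <= (x2 - Re a) / nrm (x2 +i* t - a) ^+ 2.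
    rewrite ler_pM2l ?subr_gt0// lef_pV2 ?posrE ?exprn_gt0//; last first.
      by rewrite nrm_gt0 subr_eq0; apply/eqP => ea; rewrite -ea /= in a2; lra.
    rewrite lerXn2r ?nnegrE ?nrm_ge0 ?(ltW D0)// (le_trans (nrm_ReIm _))// R2 I2 /D.
    by case/andP: ht => t1 t2; rewrite lerD// ler_norml; apply/andP; split; lra.
  rewrite mulNr in h1; lra.
have : 0 < (y2 - y1) * ((x2 - Re a) / D ^+ 2) by rewrite mulr_gt0 ?divr_gt0 ?exprn_gt0//; lra.
lra.
Qed.

End CauchyKernel.

Section DiffNear.
Variables (K : numFieldType) (V W : normedModType K).

(** Used to replace functions defined by cases, with a removable singularity, by a
formula valid near the point. *)
Lemma near_eq_differentiable (f g : V -> W) (x : V) : (\near x, f x = g x) ->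
  differentiable f x -> differentiable g x /\ 'd g x = 'd f x :> (V -> W).
Proof.
move=> fg df.
have gE : g \o shift x = cst (g x) + 'd f x +o_ 0 id.
  apply/eqaddoP => e e0; have /eqaddoP/(_ e e0) := diff_locally df.
  have : \forall h \near (0 : V), f (h + x) = g (h + x).
    by move: fg; rewrite (near_shift 0 x)/=; apply: filterS => h; rewrite /= subr0.
  move=> h1; apply: filterS2 h1 => h h1.
  suff -> : (g \o shift x - (cst (g x) + 'd f x)) h = (f \o shift x - (cst (f x) + 'd f x)) h by [].
  rewrite -[LHS]/(g (h + x) - (g x + 'd f x h)) -[RHS]/(f (h + x) - (f x + 'd f x h)).
  by rewrite h1 (nbhs_singleton fg).
have dE := diff_unique (diff_continuous df) gE.
split=> //; apply/diff_locallyP; split; first by rewrite dE; exact: diff_continuous.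
by rewrite dE.
Qed.

End DiffNear.

Section CauchyEstimate.
Variable R : realType.
Notation C := (Cplx R).
Implicit Types (z w : C) (x y : R) (f k : C -> C).

Definition square (z : C) (r : R) := rect (Re z - r) (Re z + r) (Im z - r) (Im z + r).

Lemma frame_far (z0 : C) r z : 0 < r ->
  frame (Re z0 - r) (Re z0 + r) (Im z0 - r) (Im z0 + r) z -> r <= nrm (z - z0).
Proof.
move=> r0 [_].
have hR := Re_nrm (z - z0); have hI := Im_nrm (z - z0).
have eR : Re (z - z0) = Re z - Re z0 by case: (z) (z0) => [? ?] [? ?].
have eI : Im (z - z0) = Im z - Im z0 by case: (z) (z0) => [? ?] [? ?].
have h1 := le_trans (ler_norm _) hR; have h2 := le_trans (ler_norm _) hI.
have h3 : - Re (z - z0) <= nrm (z - z0) by rewrite (le_trans (ler_norm _))// normrN.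
have h4 : - Im (z - z0) <= nrm (z - z0) by rewrite (le_trans (ler_norm _))// normrN.
by rewrite eR eI in h1 h2 h3 h4; case/or4P => /eqP; lra.
Qed.

(** The difference quotient of [f] at [a], completed by the derivative, integrates to
zero; so f(a) times the integral of 1/(z - a) is the integral of f(z)/(z - a).
The constant [K] is independent of [f], which allows a sequence of functions. *)
Lemma cauchy_estimate z0 r a : 0 < r -> nrm (a - z0) < r ->
  exists2 K, 0 <= K & forall f M, 0 <= M ->
   (forall z, square z0 r z -> differentiable f z) ->
   (forall z, frame (Re z0 - r) (Re z0 + r) (Im z0 - r) (Im z0 + r) z -> nrm (f z) <= M) ->
   nrm (f a) <= K * M.
Proof.
move=> r0 ar.
have ha : (Re z0 - r < Re a < Re z0 + r) /\ (Im z0 - r < Im a < Im z0 + r).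
  have h1 := le_lt_trans (Re_nrm (a - z0)) ar.
  have h2 := le_lt_trans (Im_nrm (a - z0)) ar.
  rewrite (_ : Re (a - z0) = Re a - Re z0) in h1; last by case: (a) (z0) => [? ?] [? ?].
  rewrite (_ : Im (a - z0) = Im a - Im z0) in h2; last by case: (a) (z0) => [? ?] [? ?].
  by move: h1 h2; rewrite !ltr_norml => /andP[? ?] /andP[? ?]; split; apply/andP; split; lra.
have [[hax hay] hx hy] : [/\ (Re z0 - r < Re a < Re z0 + r) /\ (Im z0 - r < Im a < Im z0 + r),
  Re z0 - r <= Re z0 + r & Im z0 - r <= Im z0 + r] by split => //; lra.
rewrite /square; set x1 := Re z0 - r in hax hx *; set x2 := Re z0 + r in hax hx *.
set y1 := Im z0 - r in hay hy *; set y2 := Im z0 + r in hay hy *.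
have W : (x2 - x1) + (y2 - y1) = 4 * r by rewrite /x1 /x2 /y1 /y2; ring.
pose kap := nrm (contour (fun z => (z - a)^-1) x1 x2 y1 y2).
have kap0 : 0 < kap by rewrite nrm_gt0; apply: cauchy_kernel.
pose d := r - nrm (a - z0); have d0 : 0 < d by rewrite subr_gt0.
exists (16 * r / (d * kap)).
  by rewrite divr_ge0// ?mulr_ge0// ltW.
move=> f M M0 df fM.
have far z : frame x1 x2 y1 y2 z -> d <= nrm (z - a).
  move=> /(frame_far r0); have := nrm_tri z z0 a; rewrite /d (nrmC a); lra.
have inva z : frame x1 x2 y1 y2 z -> z - a != 0.
  by move=> /far h; rewrite -nrm_gt0 (lt_le_trans d0).
have fc z : rect x1 x2 y1 y2 z -> {for z, continuous f}.
  by move=> /df; exact: differentiable_continuous.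
have hasq : rect x1 x2 y1 y2 a.
  by case/andP: hax => [? ?]; case/andP: hay => [? ?]; split; apply/andP; split; exact: ltW.
have [l hl] := differentiableC (df a hasq).
pose k z := if z == a then l else (z - a)^-1 * (f z - f a).
have dk z : rect x1 x2 y1 y2 z -> z != a -> differentiable k z.
  move=> hz za.
  have Hn : \forall w \near z, (fun w => (w - a)^-1 * (f w - f a)) w = k w.
    apply/nbhs_nrmP; exists (nrm (z - a)); rewrite nrm_gt0 subr_eq0; split => // w hw.
    rewrite /k; case: eqP => // wa; move: hw; rewrite wa nrmC ltxx //.
  have Hd : differentiable (fun w => (w - a)^-1 * (f w - f a)) z.
    apply: differentiableM; first exact: differentiable_invB.
    by apply: differentiableB; [exact: df|exact: differentiable_cst].
  by have [] := near_eq_differentiable Hn Hd.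
have kc : cont_on (rect x1 x2 y1 y2) k.
  move=> z hz; have [->|za] := eqVneq z a; last exact/differentiable_continuous/dk.
  apply/continuousC => e e0; have e2 : 0 < e / 2 by rewrite divr_gt0.
  have [dd dd0 hd] := hl _ e2; exists dd => // w hw; rewrite /k eqxx.
  have [_|wa] := eqVneq w a; first by rewrite subrr nrm0.
  have wa0 : 0 < nrm (w - a) by rewrite nrm_gt0 subr_eq0.
  have E : (w - a)^-1 * (f w - f a) - l = (w - a)^-1 * (f w - f a - l * (w - a)).
    by rewrite [RHS]mulrBr [l * _]mulrC mulKf// subr_eq0.
  rewrite E nrmM nrmV mulrC ltr_pdivrMr//.
  by rewrite (le_lt_trans (hd _ hw))// ltr_pM2r//; lra.
have k0 := contour_hole hax hay kc dk.
pose F z := (z - a)^-1 * f z; pose G z := f a * (z - a)^-1.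
have gc : cont_on (frame x1 x2 y1 y2) (fun z => (z - a)^-1).
  by move=> z hz; apply/differentiable_continuous/differentiable_invB; rewrite -subr_eq0 inva.
have Fc : cont_on (frame x1 x2 y1 y2) F.
  by move=> z hz; apply: continuousM; [exact: gc|apply: fc; case: hz].
have Gc : cont_on (frame x1 x2 y1 y2) G.
  by move=> z hz; apply: continuousM; [exact: cst_continuous|exact: gc].
have E : contour F x1 x2 y1 y2 = f a * contour (fun z => (z - a)^-1) x1 x2 y1 y2.
  apply/eqP; rewrite -subr_eq0 -contourZ// -contourB//; apply/eqP; rewrite -[RHS]k0.
  apply: eq_contour => // z hz; have := inva z hz; rewrite subr_eq0 => za.
  by rewrite /k (negbTE za) mulrBr /F [f a * _]mulrC.
have : nrm (contour F x1 x2 y1 y2) <= 4 * (M / d) * ((x2 - x1) + (y2 - y1)).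
  apply: contour_bound => // z hz; rewrite /F nrmM nrmV mulrC.
  rewrite ler_pM ?nrm_ge0 ?invr_ge0 ?nrm_ge0 ?fM// lef_pV2 ?posrE ?far//.
  by rewrite (lt_le_trans d0)// far.
rewrite E nrmM -/kap W -ler_pdivlMr// => /le_trans; apply.
rewrite le_eqVlt; apply/orP; left; apply/eqP; field.
by rewrite !gt_eqF.
Qed.

End CauchyEstimate.

(** * Unique continuation *)

Section UniqueContinuation.
Variable R : realType.
Notation C := (Cplx R).
Implicit Types (z w : C) (x y : R) (f : C -> C).

Lemma differentiable_pow (g : C -> C) n z : differentiable g z ->
  differentiable (fun w => g w ^+ n) z.
Proof.
move=> dg; elim: n => [|n ih].
  by rewrite (_ : (fun _ => _) = cst 1)//; exact: differentiable_cst.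
rewrite (_ : (fun _ => _) = (fun w => g w * g w ^+ n)); last first.
  by apply/funext => w; rewrite exprS.
exact: differentiableM.
Qed.

Lemma geometric_small (q B e : R) : 0 <= q < 1 -> 0 < e -> exists n, B * q ^+ n < e.
Proof.
move=> /andP[q0 q1] e0.
have /cvgrPdist_lt/(_ e e0) : geometric B q @ \oo --> 0.
  by apply: cvg_geometric; rewrite ger0_norm.
move=> [N _ /(_ N (leqnn _))] /=; rewrite sub0r normrN => h.
by exists N; rewrite (le_lt_trans (ler_norm _)).
Qed.

(** Since [f] vanishes near [z0], the functions f(z)/(z - z0)^n are differentiable on
the whole square, and they are at most M/r^n on its boundary. The Cauchy estimate
yields |f(a)| <= K M (|a - z0|/r)^n for every [n]. *)
Lemma identity_square z0 r f a : 0 < r ->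
  (forall z, square z0 r z -> differentiable f z) ->
  (\forall z \near z0, f z = 0) -> nrm (a - z0) < r -> f a = 0.
Proof.
move=> r0 df f0 ar; have [->|az] := eqVneq a z0; first exact: nbhs_singleton f0.
have rho0 : 0 < nrm (a - z0) by rewrite nrm_gt0 subr_eq0.
have [K K0 HK] := cauchy_estimate r0 ar.
have fc : cont_on (square z0 r) f.
  by move=> z /df; exact: differentiable_continuous.
have [M' hM'] : exists M, forall z,
    frame (Re z0 - r) (Re z0 + r) (Im z0 - r) (Im z0 + r) z -> nrm (f z) <= M.
  by apply: frame_bound fc; lra.
pose M := Num.max M' 0; have M0 : 0 <= M by rewrite le_max lexx orbT.
have hM z : frame (Re z0 - r) (Re z0 + r) (Im z0 - r) (Im z0 + r) z -> nrm (f z) <= M.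
  by move=> /hM' h; rewrite le_max h.
apply/eqP; rewrite -nrm_eq0 eq_le nrm_ge0 andbT leNgt; apply/negP => e0.
have q01 : 0 <= nrm (a - z0) / r < 1.
  by rewrite divr_ge0 ?nrm_ge0 ?ltW//= ltr_pdivrMr// mul1r.
have [n] := geometric_small (K * M) q01 e0; apply/negP; rewrite -leNgt.
pose F z := f z * ((z - z0)^-1) ^+ n.
have FM : nrm (F a) <= K * (M * r^-1 ^+ n).
  apply: HK; first by rewrite mulr_ge0// exprn_ge0// invr_ge0 ltW.
    move=> z hz; have [->|zz] := eqVneq z z0; last first.
      apply: differentiableM; first exact: df.
      by apply: differentiable_pow; exact: differentiable_invB.
    have Hn : \forall w \near z0, (fun=> 0 : C) w = F w.
      by apply: filterS f0 => w fw; rewrite /F fw mul0r.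
    by have [] := near_eq_differentiable Hn (differentiable_cst _ _).
  move=> z hz; rewrite /F nrmM nrmX nrmV ler_pM ?nrm_ge0 ?hM//.
    by rewrite exprn_ge0// invr_ge0 nrm_ge0.
  have far := frame_far r0 hz.
  by rewrite lerXn2r ?nnegrE ?invr_ge0 ?nrm_ge0 ?(ltW r0)// lef_pV2 ?posrE// (lt_le_trans r0).
move: FM; rewrite /F nrmM nrmX nrmV mulrA.
rewrite -ler_pdivlMr ?exprn_gt0 ?invr_gt0// => /le_trans; apply.
by rewrite exprMn -!exprVn invrK mulrA mulrAC.
Qed.

(** Squares of a fixed size, smaller than the distance from the segment between [z1]
and [a] to the boundary of the disc, are chained along this segment. *)
Theorem identity_ball z0 r f z1 a :
  (forall z, nrm (z - z0) < r -> differentiable f z) ->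
  nrm (z1 - z0) < r -> (\forall z \near z1, f z = 0) ->
  nrm (a - z0) < r -> f a = 0.
Proof.
move=> df h1 f1 ha.
pose m := Num.max (nrm (z1 - z0)) (nrm (a - z0)).
have mr : m < r by rewrite gt_max h1.
pose s := (r - m) / 3; have s0 : 0 < s by rewrite divr_gt0// subr_gt0.
have [N hN] := pow2_gt (nrm (a - z1)) s0.
pose n := (2 ^ N)%N; have n0 : (0 : R) < n%:R by rewrite ltr0n expn_gt0.
have {}hN : nrm (a - z1) / n%:R < s by rewrite /n natrX.
pose p (k : nat) : C := z1 + (k%:R / n%:R : R)%:C * (a - z1).
have pE k : p k.+1 - p k = (n%:R^-1 : R)%:C * (a - z1).
  rewrite /p -natr1 mulrDl mul1r rmorphD /=; ring.
have pm k : (k <= n)%N -> nrm (p k - z0) <= m.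
  move=> kn; set t : R := k%:R / n%:R.
  have t0 : 0 <= t by rewrite divr_ge0// ler0n.
  have t1 : t <= 1 by rewrite ler_pdivrMr// mul1r ler_nat.
  have -> : p k - z0 = (1 - t)%:C * (z1 - z0) + t%:C * (a - z0).
    by rewrite /p -/t rmorphB /=; ring.
  have hm1 : nrm (z1 - z0) <= m by rewrite le_max lexx.
  have hm2 : nrm (a - z0) <= m by rewrite le_max lexx orbT.
  rewrite (le_trans (nrmD _ _))// !nrmM !nrmR (ger0_norm t0) ger0_norm; last by lra.
  have -> : m = (1 - t) * m + t * m by ring.
  by apply: lerD; rewrite ler_wpM2l//; lra.
suff : \forall z \near p n, f z = 0.
  move=> /nbhs_singleton; rewrite /p divff ?gt_eqF// mul1r.
  by rewrite addrC subrK.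
have : (n <= n)%N by [].
elim: {-2}n => [_|k ih kn]; first by rewrite /p mul0r mul0r addr0.
have {ih}fk := ih (ltnW kn).
have dk z : square (p k) s z -> differentiable f z.
  move=> [/andP[a1 a2] /andP[b1 b2]]; apply: df.
  have := pm k (ltnW kn); have := nrm_tri z z0 (p k); have := nrm_ReIm (z - p k).
  rewrite (_ : Re (z - p k) = Re z - Re (p k)); last by case: (z) (p k) => [? ?] [? ?].
  rewrite (_ : Im (z - p k) = Im z - Im (p k)); last by case: (z) (p k) => [? ?] [? ?].
  have : `|Re z - Re (p k)| <= s by rewrite ler_norml; apply/andP; split; lra.
  have : `|Im z - Im (p k)| <= s by rewrite ler_norml; apply/andP; split; lra.
  have : 3 * s = r - m by rewrite /s mulrC mulfVK.
  lra.
have step : nrm (p k.+1 - p k) < s.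
  by rewrite pE nrmM nrmR ger0_norm ?invr_ge0 ?ler0n// mulrC.
apply/nbhs_nrmP; exists (s - nrm (p k.+1 - p k)); rewrite subr_gt0; split => // w hw.
apply: (identity_square s0 dk fk).
have := nrm_tri w (p k) (p k.+1); lra.
Qed.

End UniqueContinuation.

(** * Lattices and tori *)

Section RowSpace.
Variables (R : realType) (n : nat).
Notation C := (Cplx R).
Implicit Types (u v w : 'rV[C]_n).

Definition near_row (r : R) u v := forall i, nrm (v 0 i - u 0 i) < r.

Lemma nbhs_row u (P : set 'rV[C]_n) : nbhs u P <->
  exists r : R, 0 < r /\ forall v, near_row r u v -> P v.
Proof.
split.
  move=> /nbhs_ballP [e /= e0 H].
  move: (e0); rewrite ltcE /= => /andP[/eqP ie re].
  have eE : e = (Re e)%:C by apply/eqP; rewrite eq_complex /= ie !eqxx.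
  exists (Re e); split => // v hv; apply: H; split => // i j.
  by rewrite (ord1 i) /ball /= -normrN opprB -nrmE eE ltcR.
move=> [r [r0 H]]; apply/nbhs_ballP; exists r%:C; first by rewrite /= ltcR.
move=> v [_ hv]; apply: H => j; have := hv 0 j.
by rewrite /ball /= -normrN opprB -nrmE ltcR.
Qed.

Lemma near_row_nbhs u (r : R) : 0 < r -> nbhs u [set v | near_row r u v].
Proof. by move=> r0; apply/nbhs_row; exists r. Qed.

Lemma row_continuous (T : topologicalType) (F : T -> 'rV[C]_n) (x : T) :
  (forall i, {for x, continuous (fun y => F y 0 i)}) -> {for x, continuous F}.
Proof.
move=> Fc A /nbhs_row [r [r0 H]]; rewrite nbhs_simpl /=.
have : \forall y \near x, forall i, nrm (F y 0 i - F x 0 i) < r.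
  by apply: filter_forall => i; have := Fc i _ (nbhs_nrm_ball (F x 0 i) r0).
by apply: filterS => y hy; apply: H => i.
Qed.

Lemma near_row_shift u v w (r : R) : near_row r u v -> near_row r (u + w) (v + w).
Proof. by move=> h i; rewrite !mxE opprD addrACA subrr addr0. Qed.

End RowSpace.

Section Lattice.
Variables (R : realType) (n : nat) (L : lattice R n).
Notation C := (Cplx R).
Implicit Types (u v w : 'rV[C]_n).

(** [C^n] as a real space, in which a lattice basis is an invertible square matrix. *)
Definition real_coords (v : 'rV[C]_n) : 'rV[R]_(n + n) :=
  row_mx (\row_j Re (v 0 j)) (\row_j Im (v 0 j)).

Definition basis_mx : 'M[R]_(n + n) := \matrix_(i, j) real_coords (lat_basis L i) 0 j.

Lemma ReD (z w : C) : Re (z + w) = Re z + Re w. Proof. by case: z w => [? ?] [? ?]. Qed.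
Lemma ImD (z w : C) : Im (z + w) = Im z + Im w. Proof. by case: z w => [? ?] [? ?]. Qed.
Lemma ReN (z : C) : Re (- z) = - Re z. Proof. by case: z. Qed.
Lemma ImN (z : C) : Im (- z) = - Im z. Proof. by case: z. Qed.

Lemma Re_sum (I : finType) (F : I -> C) : Re (\sum_i F i) = \sum_i Re (F i).
Proof. by apply: (big_morph _ ReD). Qed.
Lemma Im_sum (I : finType) (F : I -> C) : Im (\sum_i F i) = \sum_i Im (F i).
Proof. by apply: (big_morph _ ImD). Qed.

Lemma ReZ (k : R) (z : C) : Re (k%:C * z) = k * Re z.
Proof. by case: z => a b /=; rewrite mul0r subr0. Qed.
Lemma ImZ (k : R) (z : C) : Im (k%:C * z) = k * Im z.
Proof. by case: z => a b /=; rewrite mul0r addr0. Qed.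

Lemma real_coords_comb (l : 'rV[R]_(n + n)) :
  l *m basis_mx = real_coords (\sum_i (l 0 i)%:C *: lat_basis L i).
Proof.
apply/rowP => j; rewrite [LHS]mxE /real_coords -(splitK j).
case: (fintype.split j) => k /=.
  rewrite [RHS]row_mxEl [RHS]mxE summxE Re_sum; apply: eq_bigr => i _.
  by rewrite [basis_mx _ _]mxE /real_coords row_mxEl !mxE ReZ.
rewrite [RHS]row_mxEr [RHS]mxE summxE Im_sum; apply: eq_bigr => i _.
by rewrite [basis_mx _ _]mxE /real_coords row_mxEr !mxE ImZ.
Qed.

Lemma real_coords_eq0 v : real_coords v = 0 -> v = 0.
Proof.
move=> h; apply/rowP => j; apply/eqP; rewrite mxE eq_complex; apply/andP; split; apply/eqP.
  by move/rowP: h => /(_ (lshift n j)); rewrite row_mxEl !mxE.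
by move/rowP: h => /(_ (rshift n j)); rewrite row_mxEr !mxE.
Qed.

Lemma basis_mx_unit : basis_mx \in unitmx.
Proof.
rewrite -row_free_unit -kermx_eq0; apply/rowV0P => l /sub_kermxP.
rewrite real_coords_comb => /real_coords_eq0 /lat_free h.
by apply/rowP => i; rewrite h mxE.
Qed.

Lemma real_coords_bound v (B : R) : (forall i, nrm (v 0 i) <= B) ->
  forall j, `|real_coords v 0 j| <= B.
Proof.
move=> hv j; rewrite /real_coords -(splitK j); case: (fintype.split j) => k /=.
  by rewrite row_mxEl mxE (le_trans (Re_nrm _)).
by rewrite row_mxEr mxE (le_trans (Im_nrm _)).
Qed.

(** The constant is read off the inverse matrix. The lemma reduces discreteness and
finiteness properties of a lattice to those of bounded integers. *)
Lemma coef_bound : exists2 K : R, 0 < K & forall (l : 'I_(n + n) -> R) (B : R),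
  (forall i, nrm ((\sum_i (l i)%:C *: lat_basis L i) 0 i) <= B) ->
  forall i, `|l i| <= K * B.
Proof.
pose M := invmx basis_mx; pose K := \sum_k \sum_i `|M k i| + 1.
have K0 : 0 < K by rewrite ltr_wpDl// sumr_ge0// => k _; rewrite sumr_ge0.
exists K => // l B hB i.
have [Bneg|B0] := ltP B 0.
  by have := real_coords_bound hB i => h; have := le_lt_trans h Bneg; rewrite normr_lt0.
pose lv : 'rV[R]_(n + n) := \row_i l i.
have lE : lv = real_coords (\sum_i (l i)%:C *: lat_basis L i) *m M.
  rewrite -[LHS](mulmxK basis_mx_unit) real_coords_comb; congr (real_coords _ *m _).
  by apply: eq_bigr => k _; rewrite mxE.
have -> : l i = lv 0 i by rewrite mxE.
rewrite lE mxE (le_trans (ler_norm_sum _ _ _))//.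
have : \sum_k `|M k i| <= K.
  apply: (@le_trans _ _ (\sum_k \sum_i `|M k i|)); last by rewrite lerDl.
  by apply: ler_sum => k _; rewrite (bigD1 i)//= lerDl sumr_ge0.
move=> /(ler_wpM2r B0); apply: le_trans; rewrite mulr_suml; apply: ler_sum => k _.
by rewrite normrM mulrC ler_wpM2l//; exact: real_coords_bound.
Qed.

Lemma in_latticeE v : in_lattice L v <->
  exists m : 'I_(n + n) -> int, v = \sum_i ((m i)%:~R : R)%:C *: lat_basis L i.
Proof.
have E (m : 'I_(n + n) -> int) :
    \sum_i lat_basis L i *~ m i = \sum_i ((m i)%:~R : R)%:C *: lat_basis L i.
  by apply: eq_bigr => i _; rewrite rmorph_int scaler_int.
by split => -[m ->]; exists m; rewrite E.
Qed.

Lemma in_lattice0 : in_lattice L 0.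
Proof. by exists (fun=> 0); rewrite big1. Qed.

Lemma in_latticeN v : in_lattice L v -> in_lattice L (- v).
Proof.
move=> [m ->]; exists (fun i => - m i); rewrite -sumrN.
by apply: eq_bigr => i _; rewrite mulrNz.
Qed.

Lemma in_latticeD v w : in_lattice L v -> in_lattice L w -> in_lattice L (v + w).
Proof.
move=> [m ->] [k ->]; exists (fun i => m i + k i); rewrite -big_split.
by apply: eq_bigr => i _; rewrite mulrzDr.
Qed.

Lemma in_latticeB v w : in_lattice L v -> in_lattice L w -> in_lattice L (v - w).
Proof. by move=> hv hw; apply: in_latticeD => //; exact: in_latticeN. Qed.

Lemma lattice_discrete : exists2 r : R, 0 < r &
  forall v, in_lattice L v -> near_row r 0 v -> v = 0.
Proof.
have [K K0 hK] := coef_bound.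
exists (K^-1 / 2); first by rewrite divr_gt0 ?invr_gt0.
move=> v /in_latticeE [m ->] hv.
have {}hv i : nrm ((\sum_i ((m i)%:~R : R)%:C *: lat_basis L i) 0 i) <= K^-1 / 2.
  by have := hv i; rewrite mxE subr0 => /ltW.
apply: big1 => i _; have := hK _ _ hv i.
rewrite mulrA divff ?gt_eqF// mul1r => h.
suff -> : m i = 0 by rewrite scale0r.
have : `|(m i)%:~R| < (1 : R) by rewrite (le_lt_trans h)//; lra.
by rewrite -intr_norm -[1]/(1%:~R) ltr_int; lia.
Qed.

(** Two lattice points near [d] are near each other, hence equal by discreteness: at
most one lattice point has to be avoided. *)
Lemma lattice_closed d : ~ in_lattice L d -> exists2 r : R, 0 < r &
  forall w, in_lattice L w -> ~ near_row r d w.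
Proof.
move=> dL; have [e e0 he] := lattice_discrete.
have [[w0 [w0L hw0]]|no] := pselect (exists w0, in_lattice L w0 /\ near_row (e / 2) d w0); last first.
  exists (e / 2); first by rewrite divr_gt0.
  by move=> w wL hw; apply: no; exists w.
have [i hi] : exists i, d 0 i != w0 0 i.
  apply/existsP; rewrite -negb_forall; apply/negP => /forallP h; apply: dL.
  by rewrite (_ : d = w0)//; apply/rowP => i; exact/eqP.
exists (Num.min (e / 2) (nrm (d 0 i - w0 0 i))).
  by rewrite lt_min divr_gt0//= nrm_gt0 subr_eq0.
move=> w wL hw.
suff ww : w - w0 = 0.
  have := hw i; move/eqP: ww; rewrite subr_eq0 => /eqP ->.
  by rewrite nrmC lt_min ltxx andbF.
apply: he; first exact: in_latticeB.
move=> j; rewrite !mxE subr0.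
have := hw j; rewrite lt_min => /andP[h1 _]; have := hw0 j; rewrite nrmC => h2.
by have := nrm_tri (w 0 j) (w0 0 j) (d 0 j); lra.
Qed.

Lemma torus_projP u v : torus_proj L u = torus_proj L v <-> in_lattice L (u - v).
Proof.
split => [/eqmodP /asboolP //|h]; apply/eqmodP; exact/asboolP.
Qed.

Lemma torus_proj_continuous : continuous (torus_proj L).
Proof. exact: pi_continuous. Qed.

Lemma torus_openE (U : set (torus L)) : open U = open (torus_proj L @^-1` U).
Proof. by []. Qed.

Lemma torus_proj_surj (y : torus L) : exists u, y = torus_proj L u.
Proof. by exists (repr y); rewrite /torus_proj reprK. Qed.

(** The preimage of the image is a union of translates. *)
Lemma torus_proj_open A : open A -> open (torus_proj L @` A).
Proof.
move=> oA; rewrite torus_openE openE => u [a Aa /esym/torus_projP ua].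
have /nbhs_row [r [r0 H]] : nbhs a A by exact: open_nbhs_nbhs.
rewrite /interior; apply/nbhs_row; exists r; split => // v hv.
exists (v + (a - u)).
  by apply: H; have := near_row_shift (a - u) hv; rewrite addrC subrK.
apply/torus_projP; rewrite addrC addKr -opprB; exact: in_latticeN.
Qed.

(** Points [u] and [v] with different images have [u - v] off the lattice, which is
closed; the difference stays off the lattice when both points move a little. *)
Lemma torus_hausdorff : hausdorff_space (torus L).
Proof.
rewrite open_hausdorff => y y' yy.
have [u yE] := torus_proj_surj y; have [v y'E] := torus_proj_surj y'.
have uvL : ~ in_lattice L (u - v).
  by move=> /torus_projP h; move/eqP: yy; rewrite yE y'E.
have [r r0 hr] := lattice_closed uvL.
have r2 : 0 < r / 2 by rewrite divr_gt0.
have oi w : open (interior [set x | near_row (r / 2) w x]) by exact: open_interior.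
exists (torus_proj L @` interior [set x | near_row (r / 2) u x],
        torus_proj L @` interior [set x | near_row (r / 2) v x]) => /=.
  rewrite !inE; split; [exists u => //|exists v => //]; exact: near_row_nbhs.
split; [exact: torus_proj_open|exact: torus_proj_open|].
apply/eqP; rewrite -subset0 => t [[a /interior_subset ha <-] [b /interior_subset hb /torus_projP ba]].
apply: (hr (a - b)); first by rewrite -opprB; exact: in_latticeN.
move=> i; rewrite !mxE.
have := ha i; have := hb i => h1 h2.
rewrite (_ : a 0 i - b 0 i - (u 0 i - v 0 i) = (a 0 i - u 0 i) - (b 0 i - v 0 i)); last by ring.
rewrite (le_lt_trans (nrmB _ _))//; lra.
Qed.

(** [F - G] is continuous and takes values in a discrete set near [x]. *)
Lemma lift_unique (T : topologicalType) (F G : T -> 'rV[C]_n) (x : T) :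
  {for x, continuous F} -> {for x, continuous G} ->
  (\forall y \near x, torus_proj L (F y) = torus_proj L (G y)) ->
  \forall y \near x, F y - G y = F x - G x.
Proof.
move=> Fc Gc FG; have [r r0 hr] := lattice_discrete.
have r2 : 0 < r / 2 by rewrite divr_gt0.
have := Fc _ (near_row_nbhs (F x) r2); have := Gc _ (near_row_nbhs (G x) r2).
rewrite !nbhs_simpl /= => h1 h2; have FGx := nbhs_singleton FG.
near=> y; apply/eqP; rewrite -subr_eq0; apply/eqP; apply: hr.
  by apply: in_latticeB; apply/torus_projP => //; near: y.
have a1 : near_row (r / 2) (G x) (G y) by near: y.
have a2 : near_row (r / 2) (F x) (F y) by near: y.
move=> i; have := a1 i; have := a2 i; rewrite !mxE subr0 => b1 b2.
rewrite (_ : _ - _ = (F y 0 i - F x 0 i) - (G y 0 i - G x 0 i)); last by ring.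
rewrite (le_lt_trans (nrmB _ _))//; lra.
Unshelve. all: by end_near. Qed.

End Lattice.

(** * Triangles of a flat curve *)

Lemma continuous_sum (T : topologicalType) (K : numFieldType) (V : normedModType K)
    (I : finType) (F : I -> T -> V) (x : T) :
  (forall i, {for x, continuous (F i)}) ->
  {for x, continuous (fun t => \sum_i F i t)}.
Proof.
move=> Fc; elim: (index_enum I) => [|i s ih].
  by rewrite (_ : (fun _ => _) = cst 0); [exact: cst_continuous|apply/funext => t; rewrite big_nil].
rewrite (_ : (fun _ => _) = F i + (fun t => \sum_(j <- s) F j t)); first exact: continuousD.
by apply/funext => t; rewrite big_cons.
Qed.

Section Triangles.
Variables (R : realType) (S : PK0curve R).
Notation C := (Cplx R).
Implicit Types (f g : tri S) (x y : S) (u v w : C).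

Definition bary f (l : 'rV[R]_3) : C := \sum_i (l 0 i)%:C * corner f i.

Definition simplex : set 'rV[R]_3 :=
  [set l | (forall i, 0 <= l 0 i) /\ \sum_i l 0 i = 1].

Lemma triangleE f : triangle f = bary f @` simplex.
Proof.
apply/seteqP; split => u.
  move=> [l [l0 _ l1 ->]]; exists (\row_i l i).
    split=> [i|]; first by rewrite mxE.
    by rewrite -[RHS]l1; apply: eq_bigr => i _; rewrite mxE.
  by apply: eq_bigr => i _; rewrite mxE.
by move=> [l [l0 l1] <-]; exists (fun i => l 0 i); split => // i [].
Qed.

Lemma simplex_compact : compact simplex.
Proof.
apply: bounded_closed_compact.
  exists 1; split; first exact: num_real.
  move=> M M1 l [l0 l1] /=; rewrite (le_trans _ (ltW M1))// /Num.norm /= mx_normrE.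
  apply: bigmax_le => // -[i j] _ /=; rewrite (ord1 i) ger0_norm//.
  by rewrite -l1 (bigD1 j)//= lerDl sumr_ge0.
have -> : simplex = \bigcap_(i in [set: 'I_3]) [set l : 'rV[R]_3 | 0 <= l 0 i] `&`
    (fun l : 'rV[R]_3 => \sum_i l 0 i) @^-1` [set 1].
  apply/seteqP; split => l [l0 l1]; split => //= i; first by move=> _; exact: l0.
  exact: l0.
apply: closedI.
  apply: closed_bigI => i _.
  apply: (@preimage_closed _ _ (fun l : 'rV[R]_3 => l 0 i) [set x | 0 <= x]).
  - by move=> l _; exact: coord_continuous.
  - exact: closed_ge.
apply: preimage_closed; last exact: closed_eq.
by move=> l _; apply: continuous_sum => i; exact: coord_continuous.
Qed.

Lemma bary_continuous f : continuous (bary f).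
Proof.
move=> l; apply: continuous_sum => i.
apply: continuousM; last exact: cst_continuous.
apply: (@continuous_comp _ _ _ (fun l : 'rV[R]_3 => l 0 i) (fun x : R => x%:C : C)); first exact: coord_continuous.
move=> A /nbhs_nrmP [e [e0 HA]]; apply/nbhs_ballP; exists e => // t ht.
apply: HA; move: ht; rewrite /ball /= distrC.
by rewrite -rmorphB nrmR.
Qed.

Lemma triangle_compact f : compact (triangle f).
Proof.
rewrite triangleE; apply: continuous_compact; last exact: simplex_compact.
exact/continuous_subspaceT/bary_continuous.
Qed.

Lemma param_image_closed f (K : set C) : K `<=` triangle f -> compact K ->
  closed (param f @` K).
Proof.
move=> Kf Kc; apply: compact_closed; first exact: PK0_hausdorff.
apply: continuous_compact => //.
have [/(_ f)[fc _] _ _] := PK0_simplicial S.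
exact: continuous_subspaceW fc.
Qed.

Lemma param_inj f u v : triangle f u -> triangle f v -> param f u = param f v -> u = v.
Proof.
have [/(_ f)[_ fi] _ _] := PK0_simplicial S.
by move=> hu hv; apply: fi; rewrite inE.
Qed.

Lemma param_far f x : ~ (param f @` triangle f) x ->
  \forall y \near x, ~ (param f @` triangle f) y.
Proof.
move=> hx; have cl : closed (param f @` triangle f) by apply: param_image_closed => //; exact: triangle_compact.
by have := open_nbhs_nbhs (conj (closed_openC cl) hx).
Qed.

(** [param f] is a homeomorphism onto a closed set, the triangle being compact, so
a property valid near [u] in the plane holds near [param f u] as far as the
points covered by [f] are concerned. *)
Lemma param_near f u (P : C -> Prop) : triangle f u ->
  (\forall u' \near u, P u') ->
  \forall y \near param f u, forall u', triangle f u' -> y = param f u' -> P u'.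
Proof.
move=> hu /nbhs_interior hP.
pose K := triangle f `&` ~` interior (P : set C).
have Kc : compact K.
  apply: compact_closedI; first exact: triangle_compact.
  exact/open_closedC/open_interior.
have cl : closed (param f @` K) by apply: param_image_closed Kc => ? [].
have nx : ~ (param f @` K) (param f u).
  move=> [v [vf nv] /(param_inj vf hu) vu]; apply: nv; rewrite vu; exact: nbhs_singleton hP.
have := open_nbhs_nbhs (conj (closed_openC cl) nx).
apply: filterS => y ny u' hu' yE; apply: contrapT => nP; apply: ny.
by exists u' => //; split => // /interior_subset.
Qed.

Lemma vertices_finite : finite_set (vertices (S := S)).
Proof.
have -> : vertices (S := S) = (fun p : tri S * 'I_3 => param p.1 (corner p.1 p.2)) @` setT.
  apply/seteqP; split => x; first by move=> [f [i ->]]; exists (f, i).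
  by move=> [[f i] _ <-]; exists f, i.
exact/finite_image/finite_finset.
Qed.

End Triangles.

(** * Comparison of developing maps *)

Section Developing.
Variables (R : realType) (S : PK0curve R).
Notation C := (Cplx R).
Implicit Types (f g : tri S) (x y : S) (u v w : C).

(** On a single triangle both developing maps are rotations of the flat coordinate,
hence of each other. *)
Lemma developing_face (U U' : set S) (D D' : S -> C) f u :
  developing U D -> developing U' D' -> triangle f u -> U (param f u) -> U' (param f u) ->
  exists a k : C, [/\ `|a| = 1, `|k| = 1 & \forall u' \near u, triangle f u' ->
    D (param f u') - D (param f u) = a * (u' - u) /\
    D' (param f u') - D' (param f u) = k * (D (param f u') - D (param f u))].
Proof.
move=> dD dD' hu Uu U'u.
have [a [b [a1 hab]]] := dD f u hu Uu.
have [a' [b' [a1' hab']]] := dD' f u hu U'u.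
have a0 : a != 0 by rewrite -normr_eq0 a1 oner_eq0.
exists a, (a' / a); split => //; first by rewrite normrM normfV a1 a1' invr1 mulr1.
have e1 := nbhs_singleton hab hu; have e2 := nbhs_singleton hab' hu.
near=> u' => hu'.
have -> : D (param f u') = a * u' + b by move: hu'; near: u'.
have -> : D' (param f u') = a' * u' + b' by move: hu'; near: u'.
rewrite e1 e2.
have E (p q : C) : p * u' + q - (p * u + q) = p * (u' - u) by ring.
by rewrite !E; split => //; rewrite mulrA divfK.
Unshelve. all: by end_near. Qed.

Lemma face_triangle f (I : set 'I_3) u : face f I u -> triangle f u.
Proof. by move=> [l [l0 lI l1 uE]]; exists l; split => // i []. Qed.

(** The triangles meet in a common face. A point of this face which is not a vertex has
two positive barycentric coordinates, and shifting weight between the two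
corners moves it within the face. *)
Lemma shared_edge f g u w (e : R) : f <> g -> triangle f u -> triangle g w ->
  param f u = param g w -> ~ vertices (param f u) -> 0 < e ->
  exists u' w', [/\ triangle f u', triangle g w', param f u' = param g w', u' != u & nrm (u' - u) < e].
Proof.
move=> fg hu hw uw nv e0.
have [_ _ /(_ f g fg) [I [J [nI nJ IJ1 IJ2]]]] := PK0_simplicial S.
have : (param f @` face f I) (param f u).
  by rewrite -IJ1; split; [exists u|exists w].
move=> [u0 hu0 /(param_inj (face_triangle hu0) hu) u0u].
rewrite {}u0u {u0} in hu0.
have [l [l0 lI l1 uE]] := hu0.
have [i li] : exists i, 0 < l i.
  apply: contrapT => no; suff : \sum_i l i = 0 by rewrite l1 => /eqP; rewrite oner_eq0.
  apply: big1 => i _; apply/eqP; rewrite eq_le l0 andbT leNgt; apply/negP => li; apply: no.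
  by exists i.
have [j ji lj] : exists2 j, j != i & 0 < l j.
  apply: contrapT => no; apply: nv; exists f, i; congr (param f _).
  have l0' j : j != i -> l j = 0.
    move=> ji; apply/eqP; rewrite eq_le l0 andbT leNgt; apply/negP => lj; apply: no.
    by exists j.
  have li1 : l i = 1 by rewrite -l1 (bigD1 i)//= big1 ?addr0// => j; exact: l0'.
  rewrite uE (bigD1 i)//= big1 ?addr0 ?li1 ?mul1r// => j /l0' ->.
  by rewrite mul0r.
have Ii : I i by apply: contrapT => /lI e1; rewrite e1 ltxx in li.
have Ij : I j by apply: contrapT => /lI e1; rewrite e1 ltxx in lj.
pose d := corner f i - corner f j.
pose t := Num.min (l j) (e / (2 * (nrm d + 1))).
have d1 : 0 < nrm d + 1 by rewrite ltr_wpDl ?nrm_ge0.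
have t0 : 0 < t by rewrite lt_min lj divr_gt0// mulr_gt0.
have tl : t <= l j by rewrite ge_min lexx.
pose u' := u + t%:C * d.
have hu' : face f I u'.
  exists (fun k => l k + (if k == i then t else 0) - (if k == j then t else 0)); split.
  - move=> k; have := l0 k; case: eqP => [->|_]; case: eqP => [->|_]; rewrite ?addr0 ?subr0//; move: (l0 i) (l0 j); lra.
  - move=> k nk; rewrite (lI _ nk); case: eqP => [ki|_]; first by rewrite ki in nk.
    by case: eqP => [kj|_]; [rewrite kj in nk|rewrite addr0 subr0].
  - rewrite sumrB big_split /= l1.
    rewrite -!big_mkcond /= !big_pred1_eq; ring.
  rewrite /u' uE.
  under [RHS]eq_bigr => k _.
    rewrite rmorphB rmorphD /= mulrBl mulrDl.
    over.
  rewrite sumrB big_split /= -addrA; congr (_ + _).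
  rewrite (bigD1 i)//= eqxx big1 ?addr0; last by move=> k /negbTE ->; rewrite mul0r.
  rewrite (bigD1 j)//= eqxx big1 ?addr0; last by move=> k /negbTE ->; rewrite mul0r.
  by rewrite /d mulrBr.
have : (param g @` triangle g) (param f u').
  have : (param f @` face f I) (param f u') by exists u'.
  by rewrite -IJ1 => -[].
move=> [w' hw' w'E]; exists u', w'; split => //; first exact: face_triangle hu'.
  rewrite /u' -subr_eq0 addrC addKr mulf_neq0//.
    by rewrite -nrm_eq0 nrmR normr_eq0 gt_eqF.
  apply/eqP => d0.
  have := @PK0_nondegenerate _ S f (fun k => (if k == i then 1 else 0) - (if k == j then 1 else 0)).
  move=> /(_ _ _ i); rewrite eqxx eq_sym (negbTE ji) subr0 => h.
  suff : (1 : R) = 0 by move/eqP; rewrite oner_eq0.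
  apply: h.
    by rewrite sumrB -!big_mkcond /= !big_pred1_eq subrr.
  under eq_bigr => k _ do rewrite rmorphB /= mulrBl.
  rewrite sumrB.
  rewrite (bigD1 i)//= eqxx big1 ?addr0; last by move=> k /negbTE ->; rewrite mul0r.
  rewrite (bigD1 j)//= eqxx big1 ?addr0; last by move=> k /negbTE ->; rewrite mul0r.
  by rewrite -mulrBr -/d d0 mulr0.
rewrite /u' addrC addKr nrmM nrmR ger0_norm ?ltW//.
have t1 : t * (2 * (nrm d + 1)) <= e by rewrite -ler_pdivlMr ?mulr_gt0// ge_min lexx orbT.
have : t * nrm d <= t * (nrm d + 1) by rewrite ler_pM2l// lerDl.
by move: t1; rewrite mulrCA; lra.
Qed.

(** Each triangle through [x] has its own factor [k]. Any two of these triangles have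
common points near [x], as [x] is not a vertex, and [D] separates them from [x];
so the factors agree. *)
Lemma developing_compare (U U' : set S) (D D' : S -> C) x :
  ~ vertices x -> developing U D -> developing U' D' -> U x -> U' x ->
  exists k : C, `|k| = 1 /\ \forall y \near x, D' y - D' x = k * (D y - D x).
Proof.
move=> nx dD dD' Ux U'x.
pose good f (k : C) := `|k| = 1 /\ \forall y \near x, forall u', triangle f u' ->
  y = param f u' -> D' y - D' x = k * (D y - D x).
have loc f u : triangle f u -> param f u = x -> exists a k : C, [/\ `|a| = 1, good f k &
  \forall u' \near u, triangle f u' -> D (param f u') - D x = a * (u' - u)].
  move=> hu ux; rewrite -ux in Ux U'x.
  have [a [k [a1 k1 hk]]] := developing_face dD dD' hu Ux U'x.
  exists a, k; split => //; last first.
    by rewrite -ux; apply: filterS hk => u' h /h [].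
  split => //; rewrite -ux.
  apply: filterS (param_near hu hk) => y hy u' hu' yE.
  by have [] := hy u' hu' yE hu'; rewrite yE.
have [_ /(_ x)[f0 [u0 hu0 u0x]] _] := PK0_simplicial S.
have [a0 [k0 [a01 g0 h0]]] := loc f0 u0 hu0 u0x.
have k01 := g0.1.
exists k0; split => //.
have all f : \forall y \near x, forall u', triangle f u' -> y = param f u' -> D' y - D' x = k0 * (D y - D x).
  have [[u hu ux]|nf] := pselect ((param f @` triangle f) x); last first.
    by apply: filterS (param_far nf) => y ny u' hu' yE; case: ny; exists u'.
  have [ff0|ff0] := pselect (f0 = f); first by rewrite -ff0; exact: g0.2.
  have [a [k [a1 gk hk]]] := loc f u hu ux.
  suff -> : k0 = k by exact: gk.2.
  have fc : {within triangle f0, continuous (param f0)}.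
    by have [/(_ f0)[]] := PK0_simplicial S.
  have := fc; rewrite subspace_continuousP => /(_ u0 hu0) fcu.
  pose PQ y := (forall u', triangle f0 u' -> y = param f0 u' -> D' y - D' x = k0 * (D y - D x)) /\
    (forall u', triangle f u' -> y = param f u' -> D' y - D' x = k * (D y - D x)).
  have hPQ : nbhs x PQ by apply: filterS2 g0.2 gk.2 => y.
  have {}hPQ := eq_ind_r (fun z => nbhs z _) hPQ u0x.
  have := fcu _ hPQ; rewrite nbhs_simpl /= /within /= => nPQ.
  have /nbhs_nrmP [e [e0 he]] : \forall u' \near u0,
      (triangle f0 u' -> D (param f0 u') - D x = a0 * (u' - u0)) /\
      (triangle f0 u' -> PQ (param f0 u')).
    by apply: filterS2 h0 nPQ => y.
  have nv : ~ vertices (param f0 u0) by rewrite u0x.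
  have [u' [w' [hu' hw' uw' nu' nue]]] :=
    shared_edge ff0 hu0 hu (etrans u0x (esym ux)) nv e0.
  have [/(_ hu') e1 /(_ hu') [e2 e3]] := he u' nue.
  have e4 := e2 u' hu' erefl; have {e3}e3 := e3 w' hw' uw'.
  have nz : D (param f0 u') - D x != 0.
    by rewrite e1 mulf_neq0 ?subr_eq0// -normr_eq0 a01 oner_eq0.
  by apply: (mulIf nz); rewrite -e4 -e3.
have : \forall y \near x, forall f, forall u', triangle f u' -> y = param f u' ->
    D' y - D' x = k0 * (D y - D x).
  by apply: filter_forall => f; exact: all.
apply: filterS => y hy.
have [_ /(_ y)[f [u' hu' u'y]] _] := PK0_simplicial S.
by apply: (hy f u').
Qed.

End Developing.

(** * Affine maps from a flat curve to a torus *)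

Lemma nbhs_setI (T : topologicalType) (x : T) (A B : set T) :
  nbhs x A -> nbhs x B -> nbhs x (A `&` B).
Proof. exact: filterI. Qed.

Section Charts.
Variables (R : realType) (T E : topologicalType).
Variable c : chart T E.
Hypothesis cc : is_chart c.

Lemma chart_open : open (dom c).
Proof. by have [B []] := cc. Qed.

Lemma chart_inj x y : dom c x -> dom c y -> c x = c y -> x = y.
Proof.
have [B [_ _ [_ ci _] _ _]] := cc.
by move=> hx hy; apply: ci; rewrite inE.
Qed.

Lemma chart_cont x : dom c x -> {for x, continuous c}.
Proof. by have [B [_ _ _ h _]] := cc; exact: h. Qed.

Lemma chart_nbhs x (N : set T) : dom c x -> nbhs x N ->
  \forall w \near c x, exists y, [/\ N y, dom c y & c y = w].
Proof.
move=> hx hN; have [B [oA _ _ _ ho]] := cc.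
pose W := interior N `&` dom c.
have oW : open W by apply: openI => //; exact: open_interior.
have oc : open (c @` W) by apply: ho => // y [].
have : nbhs (c x) (c @` W).
  by apply: open_nbhs_nbhs; split => //; exists x.
by apply: filterS => w [y [/interior_subset Ny hy] <-]; exists y.
Qed.

End Charts.

(** The hypothesis makes both [P] and its complement open. *)
Lemma connected_spread (T : topologicalType) (P : set T) x0 :
  connected [set: T] -> P x0 ->
  (forall x, exists N : set T, [/\ open N, N x & forall z, N z -> P z -> N `<=` P]) ->
  forall x, P x.
Proof.
move=> Tc Px0 HP x.
suff -> : P = [set: T] by [].
apply: Tc.
- by exists x0.
- exists P; last by rewrite setTI.
  rewrite openE => z Pz; have [N [oN Nz /(_ z Nz Pz) NP]] := HP z.
  by rewrite /interior; apply: filterS NP _; exact: open_nbhs_nbhs.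
- exists P; last by rewrite setTI.
  rewrite -[P]setCK; apply: open_closedC; rewrite openE => z nPz.
  have [N [oN Nz NP]] := HP z; rewrite /interior.
  have : nbhs z N by exact: open_nbhs_nbhs.
  by apply: filterS => y Ny Py; apply: nPz; exact: (NP y Ny Py).
Qed.

Section Propagation.
Variables (R : realType) (S : PK0curve R).
Notation C := (Cplx R).
Implicit Types (x y z : S) (c : chart S C).

(** A complex chart together with the exponent that makes it a flat coordinate: 1 for
a flat chart, the integer alpha of the cone angle for a cone chart. *)
Definition pow_chart c (alpha : nat) : Prop :=
  (flat_chart c /\ alpha = 1%N) \/ (exists2 x, vertices x & cone_chart x alpha c).

Lemma pow_chartP c alpha : pow_chart c alpha ->
  [/\ (0 < alpha)%N, is_chart c & developing (dom c) (fun y => c y ^+ alpha)].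
Proof.
move=> [[[cc dc] ->]|[x vx [a0 cc _ _ dc]]]; last by split.
by split => //; rewrite (_ : (fun y => _) = c)//; apply/funext => y; rewrite expr1.
Qed.

Lemma pow_chart_exists x : exists c alpha, pow_chart c alpha /\ dom c x.
Proof.
have [vx|nx] := pselect (vertices x).
  have [alpha [c hc]] := PK0_cone vx; exists c, alpha; split; last by case: hc.
  by right; exists x.
by have [c fc cx] := PK0_flat nx; exists c, 1%N; split => //; left.
Qed.

Lemma no_isolated x (N : set S) : nbhs x N -> exists2 z, N z & z <> x.
Proof.
move=> hN; have [c [alpha [hc cx]]] := pow_chart_exists x.
have [_ cc _] := pow_chartP hc.
have /nbhs_nrmP [r [r0 hr]] := chart_nbhs cc cx hN.
have r2 : 0 < r / 2 by rewrite divr_gt0.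
have [|z [Nz cz zE]] := hr (c x + (r / 2)%:C).
  by rewrite addrC addKr nrmR ger0_norm ?ltW//; lra.
exists z => // zx; move: zE; rewrite zx => /eqP.
rewrite -subr_eq0 opprD addrA subrr sub0r oppr_eq0 -nrm_eq0 nrmR.
by rewrite normr_eq0 gt_eqF.
Qed.

Lemma vertex_isolated x : \forall z \near x, z <> x -> ~ vertices z.
Proof.
pose V := vertices (S := S) `\` [set x].
have cV : closed V.
  apply: (accessible_finite_set_closed.1 (hausdorff_accessible (@PK0_hausdorff _ S))).
  exact: finite_setD (vertices_finite S).
have : nbhs x (~` V).
  by apply: open_nbhs_nbhs; split; [exact: closed_openC|move=> -[_]; apply].
by apply: filterS => z nV zx vz; apply: nV.
Qed.

Variables (n : nat) (L : lattice R n) (q : S -> torus L) (e : 'rV[C]_n).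

(** Holomorphy of a map to a torus whose dimension may exceed that of the curve. *)
Definition liftable : Prop := forall c alpha x, pow_chart c alpha -> dom c x ->
  exists G : C -> 'rV[C]_n, (\forall w \near c x, differentiable G w) /\
    \forall y \near x, q y = torus_proj L (G (c y)).

(** In the flat coordinate, [q] is affine near [x], in the direction [e]. *)
Definition has_form c alpha (a : C) (b : 'rV[C]_n) x :=
  \forall y \near x, q y = torus_proj L ((a * c y ^+ alpha) *: e + b).

Hypothesis qlift : liftable.

Lemma pow_row_continuous (a : C) alpha (b : 'rV[C]_n) :
  continuous (fun w : C => (a * w ^+ alpha) *: e + b).
Proof.
move=> w; apply: row_continuous => i.
rewrite (_ : (fun _ => _) = (fun w : C => (a * w ^+ alpha) * e 0 i + b 0 i)); last first.
  by apply/funext => w'; rewrite !mxE.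
apply: differentiable_continuous; apply: differentiableD; last exact: differentiable_cst.
apply: differentiableM; last exact: differentiable_cst.
apply: differentiableM; first exact: differentiable_cst.
exact/differentiable_pow/differentiable_id.
Qed.

(** A disc of the chart on which [q] has a single holomorphic lift, and whose only
possible vertex is its centre. If the affine form holds near one of its points,
the lift agrees there with an affine function of w^alpha up to a constant of the
lattice, and [identity_ball] extends the agreement to the disc. *)
Lemma chart_disc c alpha x : pow_chart c alpha -> dom c x ->
  exists N : set S, [/\ open N, N x, N `<=` dom c,
    forall z, N z -> z <> x -> ~ vertices z &
    forall z a b, N z -> has_form c alpha a b z ->
      exists b', forall y, N y -> has_form c alpha a b' y].
Proof.
move=> hc cx; have [a0 cc _] := pow_chartP hc; have [G [dG qG]] := qlift hc cx.
have /nbhs_nrmP [r1 [r10 h1]] := dG.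
have := chart_nbhs cc cx (nbhs_setI qG (vertex_isolated x)) => /nbhs_nrmP [r2 [r20 h2]].
pose r := Num.min r1 r2; have r0 : 0 < r by rewrite lt_min r10.
pose N : set S := dom c `&` c @^-1` [set w | nrm (w - c x) < r].
have oN : open N.
  rewrite openE => y [cy hy]; rewrite /interior.
  have oc := open_nbhs_nbhs (conj (chart_open cc) cy).
  apply: filterI => //.
  have := chart_cont cc cy; apply; apply/nbhs_nrmP.
  exists (r - nrm (c y - c x)); rewrite subr_gt0; split => // w hw.
  by have := nrm_tri w (c x) (c y); rewrite /= ; lra.
have Nq y : N y -> q y = torus_proj L (G (c y)) /\ (y <> x -> ~ vertices y).
  move=> [cy]; rewrite /= lt_min => /andP[_ hy].
  have [y' [[qy' vy'] cy' yy']] := h2 _ hy.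
  by rewrite -(chart_inj cc cy' cy yy').
have Gd w : nrm (w - c x) < r -> differentiable G w.
  by rewrite lt_min => /andP[hw _]; exact: h1.
have Nx : N x by split => //; rewrite /= subrr nrm0.
exists N; split => // [y []//|z Nz zx|z a b Nz hz]; first by have [_] := Nq z Nz; apply.
have [cz hcz] := Nz.
have GP : \forall w \near c z, torus_proj L (G w) = torus_proj L ((a * w ^+ alpha) *: e + b).
  have hN : nbhs z N by exact: open_nbhs_nbhs.
  apply: filterS (chart_nbhs cc cz (nbhs_setI hN hz)) => w [y [[Ny hy] cy <-]].
  by rewrite -hy (Nq y Ny).1.
have Gc : {for c z, continuous G} by exact/differentiable_continuous/Gd.
have [k hk] : exists k, \forall w \near c z, G w - ((a * w ^+ alpha) *: e + b) = k.
  by eexists; exact: lift_unique Gc (@pow_row_continuous a alpha b (c z)) GP.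
have GE w : nrm (w - c x) < r -> G w = (a * w ^+ alpha) *: e + (b + k).
  move=> hw; apply/rowP => i.
  pose u w := G w 0 i - ((a * w ^+ alpha) * e 0 i + (b + k) 0 i).
  suff : u w = 0 by rewrite /u => /eqP; rewrite subr_eq0 => /eqP ->; rewrite !mxE.
  apply: (@identity_ball _ (c x) r u (c z) w _ hcz _ hw).
    move=> w' hw'; apply: differentiableB.
      apply: (differentiable_comp (g := fun N : 'rV[C]_n => N 0 i)); first exact: Gd.
      exact: differentiable_coord.
    apply: differentiableD; last exact: differentiable_cst.
    apply: differentiableM; last exact: differentiable_cst.
    apply: differentiableM; first exact: differentiable_cst.
    exact/differentiable_pow/differentiable_id.
  apply: filterS hk => w' /rowP /(_ i); rewrite /u !mxE => h.
  rewrite [b 0 i + _]addrC addrA -h; ring.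
exists (b + k) => y Ny; rewrite /has_form.
have : nbhs y N by exact: open_nbhs_nbhs.
by apply: filterS => y' Ny'; rewrite (Nq y' Ny').1 GE//; case: Ny'.
Qed.

(** All the charts at [x] are considered, so that the property can be obtained in one
chart and used in another. The slope has modulus 1 because flat coordinates are
isometric. *)
Definition unit_form x := forall c alpha, pow_chart c alpha -> dom c x ->
  exists a b, `|a| = 1 /\ has_form c alpha a b x.

(** Away from the vertices flat coordinates differ by rotations and translations, so
one chart decides for all. *)
Lemma form_change c alpha a b x : pow_chart c alpha -> dom c x -> ~ vertices x ->
  `|a| = 1 -> has_form c alpha a b x -> unit_form x.
Proof.
move=> hc cx nx a1 hx c' alpha' hc' c'x.
have [_ _ dc] := pow_chartP hc; have [_ _ dc'] := pow_chartP hc'.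
have [k [k1 hk]] := developing_compare nx dc' dc c'x cx.
exists (a * k), ((a * c x ^+ alpha - a * k * c' x ^+ alpha') *: e + b).
split; first by rewrite normrM a1 k1 mulr1.
apply: filterS2 hk hx => y hk ->; congr (torus_proj L _).
rewrite addrA -scalerDl; congr (_ *: _ + _).
by rewrite -[c y ^+ alpha](subrK (c x ^+ alpha)) hk; ring.
Qed.

(** Charts at a vertex cannot be compared directly by [form_change]. But a chart at
the vertex contains nearby points which are not vertices, where the form is known
in every chart, and [chart_disc] brings it back to the vertex. *)
Lemma unit_form_step x : exists N : set S, [/\ open N, N x &
  forall z, N z -> unit_form z -> N `<=` unit_form].
Proof.
have [c [alpha [hc cx]]] := pow_chart_exists x.
have [N [oN Nx Nc Nv NH]] := chart_disc hc cx.
exists N; split => // z Nz uz.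
have [a [b [a1 hab]]] := uz c alpha hc (Nc z Nz).
have [b' hb'] := NH z a b Nz hab.
have nonv y : N y -> ~ vertices y -> unit_form y.
  by move=> Ny nvy; apply: form_change (hc) (Nc y Ny) nvy a1 (hb' y Ny).
move=> y Ny; have [vy|] := pselect (vertices y); last exact: nonv.
have yx : y = x by apply: contrapT => /(Nv y Ny).
rewrite {}yx {y vy Ny} => c' alpha' hc' c'x.
have [N' [oN' N'x N'c N'v N'H]] := chart_disc hc' c'x.
have [z' [Nz' N'z'] z'x] := no_isolated (open_nbhs_nbhs (conj (openI oN oN') (conj Nx N'x))).
have uz' := nonv z' Nz' (Nv z' Nz' z'x).
have [a' [b'' [a'1 h']]] := uz' c' alpha' hc' (N'c z' N'z').
have [b3 hb3] := N'H z' a' b'' N'z' h'.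
by exists a', b3; split => //; exact: hb3.
Qed.

Lemma unit_form_all x0 : unit_form x0 -> forall x, unit_form x.
Proof. by move=> h; apply: (connected_spread (@PK0_connected _ S) h); exact: unit_form_step. Qed.

End Propagation.

(** * Values of the affine coordinate modulo periods *)

Section PowerMap.
Variable R : realType.
Notation C := (Cplx R).

(** The product of the distances from [w0] to the roots of [X^n - z] is [|w0^n - z|], so
that one of these roots is near [w0]. *)
Lemma pow_surj_near (w0 : C) n (r : R) : (0 < n)%N -> 0 < r ->
  exists2 d : R, 0 < d & forall z, nrm (z - w0 ^+ n) < d ->
    exists2 w, nrm (w - w0) < r & w ^+ n = z.
Proof.
move=> n0 r0; exists (r ^+ n); first by rewrite exprn_gt0.
move=> z hz; pose p : {poly C} := 'X^n - z%:P.
have szp : size p = n.+1 by rewrite size_XnsubC.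
have mp : lead_coef p = 1 by apply/eqP; rewrite -monicE monicXnsubC.
have [s sE] := closed_field_poly_normal p.
rewrite mp scale1r in sE.
have hs : forall w, w \in s -> w ^+ n = z.
  move=> w ws; have : root p w by rewrite sE root_prod_XsubC.
  by rewrite /root /p !hornerE subr_eq0 => /eqP.
apply: contrapT => no.
have far w : w \in s -> r <= nrm (w0 - w).
  move=> ws; rewrite leNgt nrmC; apply/negP => wr; apply: no; exists w => //; exact: hs.
have ss : size s = n.
  by apply: succn_inj; rewrite -szp sE size_prod_XsubC.
have : r ^+ n <= nrm (w0 ^+ n - z).
  have -> : w0 ^+ n - z = p.[w0] by rewrite /p !hornerE.
  rewrite sE horner_prod -ss.
  elim: s far {sE hs no ss} => [|w s ih] far; first by rewrite big_nil nrm1.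
  rewrite big_cons nrmM hornerXsubC exprS ler_pM//.
  - exact: ltW.
  - by rewrite exprn_ge0// ltW.
  - by apply: far; rewrite inE eqxx.
  - by apply: ih => u us; apply: far; rewrite inE us orbT.
by rewrite nrmC; lra.
Qed.

Lemma pow_continuous n : continuous (fun w : C => w ^+ n).
Proof.
move=> w; apply: differentiable_continuous.
exact/differentiable_pow/differentiable_id.
Qed.

End PowerMap.

Section Leaf.
Variables (R : realType) (S : PK0curve R).
Notation C := (Cplx R).
Implicit Types (x y z : S) (c : chart S C).

Variables (G : set C) (tau : S -> C).
Hypothesis GD : forall u v, G u -> G v -> G (u + v).
Hypothesis GN : forall u, G u -> G (- u).
Hypothesis tau_local : forall c alpha x, pow_chart c alpha -> dom c x ->
  exists a : C, `|a| = 1 /\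
    \forall y \near x, G (tau y - (tau x + a * (c y ^+ alpha - c x ^+ alpha))).

Definition reached : set C := [set t | exists x, G (t - tau x)].

Lemma nrm_unit (a : C) : `|a| = 1 -> nrm a = 1.
Proof. by move=> a1; apply: complexI; rewrite nrmE a1. Qed.

Lemma tau_near x (r : R) : 0 < r ->
  \forall y \near x, exists2 g, G g & nrm (tau y - (tau x + g)) < r.
Proof.
move=> r0; have [c [alpha [hc cx]]] := pow_chart_exists x.
have [a0 cc _] := pow_chartP hc.
have [a [a1 ha]] := tau_local hc cx.
have cpow : {for x, continuous (fun y => c y ^+ alpha)}.
  apply: (@continuous_comp _ _ _ (c : S -> C) (fun w : C => w ^+ alpha)).
    exact: (chart_cont cc cx).
  exact: pow_continuous.
have := cpow _ (nbhs_nrm_ball (c x ^+ alpha) r0); rewrite nbhs_simpl /= => hr.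
apply: filterS2 ha hr => y Gy yr; eexists; first exact: Gy.
rewrite (_ : _ - _ = a * (c y ^+ alpha - c x ^+ alpha)); last by ring.
by rewrite nrmM (nrm_unit a1) mul1r.
Qed.

(** Openness of w |-> w^alpha, transported by the charts. *)
Lemma tau_open x (N : set S) : nbhs x N ->
  exists2 d : R, 0 < d & forall t, nrm (t - tau x) < d -> exists2 y, N y & G (t - tau y).
Proof.
move=> hN; have [c [alpha [hc cx]]] := pow_chart_exists x.
have [al0 cc _] := pow_chartP hc.
have [a [a1 ha]] := tau_local hc cx.
have a0 : a != 0 by rewrite -normr_eq0 a1 oner_eq0.
have /nbhs_nrmP [r [r0 hr]] := chart_nbhs cc cx (nbhs_setI hN ha).
have [d d0 hd] := pow_surj_near (c x) al0 r0.
exists d => // t ht.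
have [|w wr wE] := hd (c x ^+ alpha + a^-1 * (t - tau x)).
  by rewrite addrC addKr nrmM nrmV (nrm_unit a1) invr1 mul1r.
have [y [[Ny hy] cy yw]] := hr w wr.
exists y => //; rewrite -opprB; apply: GN.
rewrite yw wE in hy; rewrite (_ : _ - _ = tau y - (tau x + a * (c x ^+ alpha + a^-1 * (t - tau x) - c x ^+ alpha)))//.
congr (_ - _); rewrite [c x ^+ alpha + _]addrC addrK mulVKf//; ring.
Qed.

(** Compactness of the curve makes the radius of [tau_open] uniform. *)
Lemma reached_uniform : exists2 r : R, 0 < r &
  forall t u, reached t -> nrm (u - t) < r -> reached u.
Proof.
have /compact_near_coveringP H := @PK0_compact _ S.
have := H nat \oo (fun k x => forall u, nrm (u - tau x) < k.+1%:R^-1 -> reached u) _.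
case=> [x _|N _ /(_ N (leqnn _)) hN]; last first.
  exists N.+1%:R^-1; first by rewrite invr_gt0.
  move=> t u [x Gx] ut.
  have [//|y Gy] := hN x I (u - (t - tau x)).
    by rewrite (_ : _ - _ - _ = u - t)//; ring.
  by exists y; rewrite (_ : _ - _ = u - (t - tau x) - tau y + (t - tau x)); [exact: GD|ring].
have [d d0 hd] := tau_open (@filterT _ (nbhs x) _).
have d2 : 0 < d / 2 by rewrite divr_gt0.
have tx := tau_near x d2.
exists ([set y | exists2 g, G g & nrm (tau y - (tau x + g)) < d / 2],
        [set k | k.+1%:R^-1 < d / 2]).
  by split => //=; exact: near_infty_natSinv_lt (PosNum d2).
move=> [y k] [/= [g Gg yg] kd] u uy.
have [|z _ Gz] := hd (u - g).
  rewrite (_ : _ - _ - _ = (u - tau y) + (tau y - (tau x + g))); last by ring.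
  by rewrite (le_lt_trans (nrmD _ _))//; have {uy kd} := lt_trans uy kd; move: yg; lra.
by exists z; rewrite (_ : _ - _ = u - g - tau z + g); [exact: GD|ring].
Qed.

(** A nonempty set closed under moves of length less than [r] contains everything. *)
Lemma reached_all t : reached t.
Proof.
have [x0 _] := PK0_nonempty S.
have [r r0 hr] := reached_uniform.
have G0 : G 0.
  have [c [alpha [hc cx]]] := pow_chart_exists x0.
  have [a [_ /nbhs_singleton]] := tau_local hc cx.
  by move=> Ga; have := GD Ga (GN Ga); rewrite subrr.
have R0 : reached (tau x0) by exists x0; rewrite subrr.
have [n hn] := pow2_gt (nrm (t - tau x0)) r0.
pose N := (2 ^ n)%N; have N0 : (0 : R) < N%:R by rewrite ltr0n expn_gt0.
pose p (k : nat) : C := tau x0 + (k%:R / N%:R : R)%:C * (t - tau x0).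
have pE k : p k.+1 - p k = (N%:R^-1 : R)%:C * (t - tau x0).
  rewrite /p -natr1 mulrDl mul1r rmorphD /=; ring.
have : forall k, reached (p k).
  elim=> [|k ih]; first by rewrite /p mul0r mul0r addr0.
  apply: hr ih _; rewrite pE nrmM nrmR ger0_norm ?invr_ge0 ?ler0n//.
  by rewrite mulrC /N natrX.
by move=> /(_ N); rewrite /p divff ?gt_eqF// mul1r addrC subrK.
Qed.

(** On a compact curve [tau] is bounded modulo [G], and it reaches every value. *)
Lemma cocompact : exists M : R, forall t, exists2 g, G g & nrm (t - g) <= M.
Proof.
have /compact_near_coveringP H := @PK0_compact _ S.
have := H nat \oo (fun k x => exists2 g, G g & nrm (tau x - g) <= k%:R) _.
case=> [x _|N _ /(_ N (leqnn _)) hN]; last first.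
  exists N%:R => t; have [x Gx] := reached_all t.
  have [g Gg hg] := hN x I; exists (t - tau x + g); first exact: GD.
  by rewrite (_ : _ - _ = tau x - g)//; ring.
exists ([set y | exists2 g, G g & nrm (tau y - (tau x + g)) < 1],
        [set k | nrm (tau x) + 1 <= k%:R]).
  split; first exact: tau_near.
  exact: nbhs_infty_ger.
move=> [y k] [/= [g Gg yg] kd]; exists g => //.
rewrite (_ : _ - _ = (tau y - (tau x + g)) + tau x); last by ring.
by rewrite (le_trans (nrmD _ _))//; lra.
Qed.

End Leaf.

(** * Discrete cocompact subgroups of the plane *)

Section RankTwo.
Variable R : realType.
Notation C := (Cplx R).
Variable G : set C.
Hypothesis G0 : G 0.
Hypothesis GD : forall u v, G u -> G v -> G (u + v).
Hypothesis GN : forall u, G u -> G (- u).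
Hypothesis Gfin : forall B : R, finite_set [set g | G g /\ nrm g <= B].
Hypothesis Gco : exists M : R, forall t, exists2 g, G g & nrm (t - g) <= M.

Lemma shortest (A : set C) g0 : A `<=` G -> A g0 ->
  exists2 g, A g & forall u, A u -> nrm g <= nrm u.
Proof.
move=> AG Ag0.
have : finite_set [set g | A g /\ nrm g <= nrm g0].
  by apply: sub_finite_set (Gfin (nrm g0)) => g [/AG].
move=> /finite_seqP [s sE].
have memE u : (u \in s) <-> A u /\ nrm u <= nrm g0.
  have h : (A u /\ nrm u <= nrm g0) = [set` s] u by rewrite -sE.
  by split => hu; [rewrite h|rewrite h in hu].
have g0s : g0 \in s by apply/memE.
have [g gs hg] : exists2 g, g \in s & forall u, u \in s -> nrm g <= nrm u.
  elim: s {sE memE} g0 {Ag0} g0s => [//|a s ih] g0 _.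
  have [s0|[b bs]] : s = [::] \/ exists b, b \in s.
    by case: s {ih} => [|b s]; [left|right; exists b; rewrite inE eqxx].
    by exists a; rewrite ?inE ?eqxx// s0 => u; rewrite inE => /eqP ->.
  have [g gs hg] := ih b bs.
  have [ag|ga] := leP (nrm a) (nrm g).
    exists a; rewrite ?inE ?eqxx// => u; rewrite inE => /orP[/eqP -> //|/hg].
    exact: le_trans.
  exists g; rewrite ?inE ?gs ?orbT// => u; rewrite inE => /orP[/eqP ->|/hg//].
  exact: ltW.
have [Ag gg0] := (memE g).1 gs.
exists g => // u Au; have [u0|u0] := leP (nrm u) (nrm g0).
  by apply: hg; apply/memE.
exact: le_trans gg0 (ltW u0).
Qed.

Lemma subgroup_mulz u (m : int) : G u -> G (u *~ m).
Proof.
move=> Gu; have Gn n : G (u *+ n) by elim: n => [|n ih]; rewrite ?mulr0n// mulrS; exact: GD.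
case: m => n; first exact: Gn.
by rewrite NegzE mulrNz; apply: GN; exact: Gn.
Qed.

Lemma nearest_int (s : R) : exists m : int, `|s - m%:~R| <= 1 / 2.
Proof.
exists (Num.floor (s + 1 / 2)).
have :=  floor_itv (s + 1 / 2) => /andP[h1 h2].
by rewrite ler_norml; apply/andP; rewrite intrD in h2; split; lra.
Qed.

(** Let [g1] be a shortest nonzero element and [g2] a shortest element off the real line
of [g1]; cocompactness provides such elements. Minimality gives |w| >= 1 and
|Re w| <= 1/2 for w = g2/g1. Modulo [g1] and [g2] an element of [G] becomes
(s + t w) g1 with |s|, |t| <= 1/2, which is shorter than [g2], and shorter than
[g1] when t = 0: it vanishes by minimality. *)
Lemma rank2_basis : exists g1 g2 : C, [/\ G g1, G g2,
  forall a b : R, a%:C * g1 + b%:C * g2 = 0 -> a = 0 /\ b = 0 &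
  forall g, G g -> exists m k : int, g = g1 *~ m + g2 *~ k].
Proof.
have [M hM] := Gco.
have [a Ga a0] : exists2 a, G a & a != 0.
  have [g Gg hg] := hM (`|M| + 1)%:C; exists g => //.
  apply/eqP => g0; move: hg; rewrite g0 subr0 nrmR ger0_norm.
    by have := ler_norm M; lra.
  by have := normr_ge0 M; lra.
have [g1 [Gg1 g10] min1] := @shortest [set g | G g /\ g != 0] a (fun _ => @proj1 _ _) (conj Ga a0).
have n1 : 0 < nrm g1 by rewrite nrm_gt0.
pose A2 := [set g | G g /\ Im (g / g1) != 0].
have [b A2b] : exists b, A2 b.
  pose s := (`|M| + 1) / nrm g1.
  have [g Gg hg] := hM ('i * s%:C * g1); exists g; split => //.
  apply/eqP => ig; move: hg.
  have -> : 'i * s%:C * g1 - g = ('i * s%:C - g / g1) * g1 by rewrite mulrBl divfK.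
  rewrite nrmM => hg.
  have h2 : s <= nrm ('i * s%:C - g / g1).
    rewrite (le_trans _ (Im_nrm _))//.
    rewrite (_ : Im _ = s) ?ler_norm//.
    by move: ig; case: (g / g1) => p r /= ->; rewrite subr0; ring.
  have h3 : s * nrm g1 <= M by rewrite (le_trans _ hg)// ler_pM2r.
  by move: h3; rewrite /s divfK ?gt_eqF//; have := ler_norm M; lra.
have [g2 [Gg2 ig2] min2] := @shortest A2 b (fun _ => @proj1 _ _) A2b.
have [w wE] : exists w, w = g2 / g1 by exists (g2 / g1).
have g2E : g2 = w * g1 by rewrite wE divfK.
have iw : Im w != 0 by rewrite wE.
have coord (u : C) : exists s t : R, u = (s%:C + t%:C * w).
  exists (Re u - Im u / Im w * Re w), (Im u / Im w).
  apply/eqP; rewrite eq_complex; apply/andP; split; apply/eqP; move: iw; case: (w) (u) => [p r] [p' r'] /= r0; field; exact: r0.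
have nrm2 (z : C) : nrm z ^+ 2 = Re z ^+ 2 + Im z ^+ 2.
  by rewrite nrm_sqrt sqr_sqrtr// addr_ge0 ?sqr_ge0.
have W1 : 1 <= Re w ^+ 2 + Im w ^+ 2.
  rewrite -nrm2 exprn_ege1// wE nrmM nrmV ler_pdivlMr// mul1r.
  apply: min1; split => //; apply/eqP => g20; move: ig2; rewrite g20 mul0r eqxx//.
have WR (u : R) : `|u| = 1 -> Re w ^+ 2 <= (Re w + u) ^+ 2.
  move=> u1.
  have : nrm w ^+ 2 <= nrm (w + u%:C) ^+ 2.
    rewrite lerXn2r ?nnegrE ?nrm_ge0//.
    have -> : w + u%:C = (g2 + u%:C * g1) / g1 by rewrite mulrDl mulfK// wE.
    rewrite wE !nrmM ler_pM2r ?nrmV ?invr_gt0//; apply: min2; split.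
      apply: GD => //; move: u1; case: (ger0P u) => _ => [->|uE]; first by rewrite mul1r.
      by rewrite (_ : u = -1) ?rmorphN ?mulN1r; [exact: GN|lra].
    by rewrite mulrDl mulfK// -wE ImD /= addr0.
  rewrite !nrm2 ReD ImD /= addr0; lra.
have WR1 := WR 1 (normr1 _); have WR2 := WR (-1) (normrN1 _).
have small (s t : R) : `|s| <= 1 / 2 -> `|t| <= 1 / 2 -> G ((s%:C + t%:C * w) * g1) -> s = 0 /\ t = 0.
  rewrite !ler_norml => /andP[s1 s2] /andP[t1 t2] Gst.
  have ReE : Re (s%:C + t%:C * w) = s + t * Re w by rewrite ReD ReZ.
  have ImE : Im (s%:C + t%:C * w) = t * Im w by rewrite ImD ImZ /= add0r.
  have t0 : t = 0.
    apply: contrapT => /eqP t0.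
    have : nrm g2 <= nrm ((s%:C + t%:C * w) * g1).
      by apply: min2; split => //; rewrite mulfK// ImE mulf_neq0.
    rewrite g2E !nrmM ler_pM2r// => h.
    have : nrm w ^+ 2 <= nrm (s%:C + t%:C * w) ^+ 2 by rewrite lerXn2r ?nnegrE ?nrm_ge0.
    rewrite !nrm2 ReE ImE.
    have : -(1/2) <= Re w by nra.
    have : Re w <= 1 / 2 by nra.
    have ss : s ^+ 2 <= 1 / 4 by nra.
    have tt : t ^+ 2 <= 1 / 4 by nra.
    set p := Re w; set r := Im w => p1 p2.
    have st : 2 * s * t * p <= 1 / 4.
      have h1 : `|s * t| <= 1 / 4.
        by rewrite ler_norml; apply/andP; split; nra.
      have h2 : `|p| <= 1 / 2 by rewrite ler_norml; apply/andP; split; lra.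
      have := ler_norm (s * t * p); rewrite normrM => h3.
      have := ler_pM (normr_ge0 (s * t)) (normr_ge0 p) h1 h2; lra.
    have tp : t ^+ 2 * (p ^+ 2 + r ^+ 2) <= 1 / 4 * (p ^+ 2 + r ^+ 2).
      by apply: ler_wpM2r => //; rewrite addr_ge0 ?sqr_ge0.
    have W1' : 1 <= p ^+ 2 + r ^+ 2 by [].
    rewrite (_ : (s + t * p) ^+ 2 + (t * r) ^+ 2 = s ^+ 2 + 2 * s * t * p + t ^+ 2 * (p ^+ 2 + r ^+ 2)); last by ring.
    lra.
  split => //; apply: contrapT => /eqP s0.
  move: Gst; rewrite t0 mul0r addr0 => Gst.
  have : nrm g1 <= nrm (s%:C * g1).
    apply: min1; split => //; rewrite mulf_neq0// -nrm_eq0 nrmR normr_eq0//.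
  rewrite nrmM nrmR.
  have : `|s| <= 1 / 2 by rewrite ler_norml; apply/andP; split; lra.
  move=> /(ler_wpM2r (nrm_ge0 g1)); lra.
exists g1, g2; split => //.
  move=> s t; rewrite g2E mulrA -mulrDl => /eqP; rewrite mulf_eq0 (negbTE g10) orbF => /eqP E.
  have t0 : t = 0.
    have := congr1 (fun z : C => Im z) E; rewrite ImD ImZ /= add0r => /eqP.
    by rewrite mulf_eq0 (negbTE iw) orbF => /eqP.
  by move: E; rewrite t0 mul0r addr0 => /complexI.
move=> g Gg; have [s [t stE]] := coord (g / g1).
have [m hm] := nearest_int s; have [k hk] := nearest_int t.
exists m, k.
have gE : g = (s%:C + t%:C * w) * g1 by rewrite -stE divfK.
have mE (u : C) (j : int) : u *~ j = (j%:~R : R)%:C * u by rewrite rmorph_int mulrzl.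
have dE : g - (g1 *~ m + g2 *~ k) = ((s - m%:~R)%:C + (t - k%:~R)%:C * w) * g1.
  rewrite gE !mE g2E !rmorphB /=; ring.
have [|/eqP s0 /eqP t0] := small _ _ hm hk.
  rewrite -dE; apply: GD => //; apply: GN; apply: GD; exact: subgroup_mulz.
apply/eqP; rewrite -subr_eq0 dE (eqP s0) (eqP t0) mul0r addr0 mul0r//.
Qed.

Lemma rank2_lattice : exists L : lattice R 1, forall v, in_lattice L v <-> G (v 0 0).
Proof.
have [g1 [g2 [Gg1 Gg2 ind gen]]] := rank2_basis.
pose bas (i : 'I_(1 + 1)) : 'rV[C]_1 := const_mx (if i == lshift 1 0 then g1 else g2).
have sumE (V : nmodType) (F : 'I_(1 + 1) -> V) : \sum_i F i = F (lshift 1 0) + F (rshift 1 0).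
  by rewrite big_split_ord /= !big_ord1.
have free (l : 'I_(1 + 1) -> R) : \sum_i (l i)%:C *: bas i = 0 -> forall i, l i = 0.
  rewrite sumE => /rowP /(_ 0); rewrite !mxE /= => /ind [l0 l1] i.
  by rewrite -(splitK i); case: (fintype.split i) => j; rewrite (ord1 j).
have mE (u : C) (j : int) : (j%:~R : R)%:C * u = u *~ j by rewrite rmorph_int mulrzl.
exists (Lattice free) => v; rewrite in_latticeE; split.
  move=> [m ->]; rewrite sumE !mxE /= !mE.
  by apply: GD; exact: subgroup_mulz.
move=> /gen [m [k vE]].
exists (fun i => if i == lshift 1 0 then m else k).
apply/rowP => i; rewrite (ord1 i) vE sumE !mxE /=.
by rewrite !mE.
Qed.

End RankTwo.

(** * Hermitian products and Jacobians *)

Section Dot.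
Variables (R : realType).
Notation C := (Cplx R).

(** Conjugate linearity on the right follows from the symmetry. *)
Lemma dot_of_form (V : lmodType C) (op : V -> V -> C) :
  (forall v a u u', op (a *: u + u') v = a * op u v + op u' v) ->
  (forall u v, op u v = Num.conj (op v u)) ->
  (forall u, u != 0 -> 0 < op u u) ->
  exists h : {dot V for Num.conj}, forall u v, h u v = op u v.
Proof.
move=> opl opC op0.
have bil : bilinear_for (GRing.Scale.Law.clone _ _ *%R _) (GRing.Scale.Law.clone _ _ (Num.conj \; *%R) _) op.
  split=> [v a u u'|v a u u'] /=; first exact: opl.
  by rewrite opC opl rmorphD rmorphM /= -!opC.
have herm : forall u v, op u v = (-1) ^+ false * Num.conj (op v u).
  by move=> u v; rewrite expr0 mul1r -opC.
pose B := bilinear_isBilinear.Build C V V C _ _ op bil.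
pose H := isHermitianSesquilinear.Build C V false Num.conj op herm.
pose P := isDotProduct.Build C V op op0.
pose h : {dot V for Num.conj} := HB.pack op B H P.
by exists h.
Qed.

Section DotTheory.
Variables (V : lmodType C) (h : {dot V for Num.conj}).

Lemma dotC u v : h u v = Num.conj (h v u).
Proof. by have := @hermC _ _ _ _ h u v; rewrite expr0 mul1r. Qed.

Lemma dotDl u v w : h (u + v) w = h u w + h v w.
Proof. exact: linearDl. Qed.
Lemma dotBl u v w : h (u - v) w = h u w - h v w.
Proof. exact: linearBl. Qed.
Lemma dotZl a u v : h (a *: u) v = a * h u v.
Proof. exact: linearZl_LR. Qed.
Lemma dotZr a u v : h u (a *: v) = Num.conj a * h u v.
Proof. exact: linearZr_LR. Qed.
Lemma dotBr u v w : h w (u - v) = h w u - h w v.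
Proof. exact: linearBr. Qed.
Lemma dot_gt0 u : u != 0 -> 0 < h u u.
Proof. by apply: neq0_dnorm_gt0. Qed.

End DotTheory.
End Dot.

Section Jacobian1.
Variables (R : realType).
Notation C := (Cplx R).

Lemma const_mx_continuous : continuous (fun z : C => const_mx z : 'rV[C]_1).
Proof.
move=> z; apply: row_continuous => i.
by rewrite (_ : (fun _ => _) = id); [exact: cvg_id|apply/funext => w; rewrite mxE].
Qed.

Lemma diff_const_mx (z : C) :
  differentiable (fun z : C => const_mx z : 'rV[C]_1) z /\
  'd (fun z : C => const_mx z : 'rV[C]_1) z = (fun z => const_mx z) :> (C -> 'rV[C]_1).
Proof.
pose d (z : C) : 'rV[C]_1 := const_mx z.
have lin : linear d by move=> a u v; apply/rowP => i; rewrite !mxE.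
pose fM := GRing.isLinear.Build C C 'rV[C]_1 _ _ lin.
pose f : {linear C -> 'rV[C]_1} := HB.pack d fM.
rewrite -/d -[d]/(f : C -> 'rV[C]_1).
have fc : continuous f by exact: const_mx_continuous.
by split; [exact: linear_differentiable|rewrite diff_lin].
Qed.

Lemma diff_coord (v : 'rV[C]_1) :
  'd (fun v : 'rV[C]_1 => v 0 0 : C) v = (fun v => v 0 0) :> ('rV[C]_1 -> C).
Proof.
have @f : {linear 'rV[C]_1 -> C}.
  by exists (fun N : 'rV[C]_1 => N 0 0); do 2![eexists]; do ?[constructor];
     rewrite ?mxE// => ? *; rewrite ?mxE//; move=> ?; rewrite !mxE.
rewrite (_ : (fun _ => _) = f) // diff_lin//; exact: coord_continuous.
Qed.

(** In dimension one the Jacobian determinant is the derivative. *)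
Lemma diff_lift1 (f : C -> C) (v : 'rV[C]_1) : differentiable f (v 0 0) ->
  differentiable (fun u : 'rV[C]_1 => const_mx (f (u 0 0)) : 'rV[C]_1) v /\
  \det ('J (fun u : 'rV[C]_1 => const_mx (f (u 0 0)) : 'rV[C]_1) v) = 'd f (v 0 0) 1.
Proof.
move=> df.
have d1 := differentiable_coord v 0 0.
have d2 : differentiable (f \o (fun u : 'rV[C]_1 => u 0 0)) v by exact: differentiable_comp.
have [d3 e3] := diff_const_mx (f (v 0 0)).
have E : (fun u : 'rV[C]_1 => const_mx (f (u 0 0)) : 'rV[C]_1) =
  (fun z : C => const_mx z : 'rV[C]_1) \o (f \o (fun u : 'rV[C]_1 => u 0 0)) by [].
rewrite E; split; first exact: differentiable_comp.
rewrite /jacobian det_mx11 mxE.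
by rewrite (diff_comp d2 d3) (diff_comp d1 df) /= e3 diff_coord !mxE /=.
Qed.

Lemma diff_pow (n : nat) (w : C) :
  'd (fun z : C => z ^+ n) w 1 = n%:R * w ^+ n.-1.
Proof.
rewrite -deriveE; last by exact/differentiable_pow/differentiable_id.
by rewrite exp_derive [_ *: 1]mulr1.
Qed.

End Jacobian1.

(** * Coverings of a one-dimensional torus *)

Lemma separate_points (T : topologicalType) d (x : 'I_d -> T) :
  hausdorff_space T -> injective x ->
  exists N : 'I_d -> set T, (forall i, nbhs (x i) (N i)) /\
    forall i j, i != j -> N i `&` N j = set0.
Proof.
move=> hT xi.
have /choice [D hD] : forall ij : 'I_d * 'I_d, exists AB : set T * set T,
    [/\ nbhs (x ij.1) AB.1, nbhs (x ij.2) AB.2 &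
        ij.1 != ij.2 -> AB.1 `&` AB.2 = set0].
  move=> [i j] /=; have [->|ij] := eqVneq i j.
    by exists (setT, setT); split => //; exact: filterT.
  have xij : x i != x j by apply: contra ij => /eqP/xi ->.
  move: hT; rewrite open_hausdorff => /(_ _ _ xij) [[A B] /= [/set_mem Ai /set_mem Bj] [oA oB /eqP AB0]].
  by exists (A, B); split => //; exact: open_nbhs_nbhs.
exists (fun i => \bigcap_(j in [set: 'I_d]) ((D (i, j)).1 `&` (D (j, i)).2)); split.
  move=> i; have : \forall y \near x i, forall j, (D (i, j)).1 y /\ (D (j, i)).2 y.
    apply: filter_forall => j; have [h1 _ _] := hD (i, j); have [_ h2 _] := hD (j, i).
    by apply: filterS2 h1 h2 => y.
  by apply: filterS => y hy j _; have [] := hy j.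
move=> i j ij; rewrite -subset0 => y [/(_ j I) [y1 _] /(_ i I) [_ y2]].
by have [_ _ /(_ ij) h] := hD (i, j); rewrite -h; split.
Qed.

Lemma diff_affine (R : realType) (g : Cplx R -> Cplx R) (k a w : Cplx R) :
  differentiable g w -> 'd (fun z => k + a * g z) w 1 = a * 'd g w 1.
Proof.
move=> dg.
have dag : differentiable (a *: g) w by exact: differentiableZ.
have dc : differentiable (cst k : Cplx R -> Cplx R) w by exact: differentiable_cst.
have d : differentiable (cst k + a *: g) w by exact: differentiableD.
have E3 : 'D_1 (cst k + a *: g) w = a * 'D_1 g w.
  rewrite deriveD; [|exact: diff_derivable|exact: diff_derivable].
  by rewrite derive_cst add0r deriveZ//; exact: diff_derivable.
have E1 : 'D_1 (cst k + a *: g) w = 'd (fun z => k + a * g z) w 1 by exact: deriveE d.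
have E2 : 'D_1 g w = 'd g w 1 by exact: deriveE dg.
exact: etrans (esym E1) (etrans E3 (congr1 (fun z => a * z) E2)).
Qed.

Lemma near_eq_jacobian (K : numFieldType) n m (f g : 'rV[K]_n -> 'rV[K]_m) (v : 'rV[K]_n) :
  (\forall u \near v, f u = g u) -> differentiable f v -> 'J g v = 'J f v.
Proof.
move=> fg df; have [_ dE] := near_eq_differentiable fg df.
apply/matrixP => i j; rewrite /jacobian [LHS]mxE [RHS]mxE.
exact: (congr1 (fun F : 'rV[K]_n -> 'rV[K]_m => F (delta_mx 0 i) 0 j) dE).
Qed.

Lemma lattice_isolated (R : realType) n (L : lattice R n) (b u : 'rV[Cplx R]_n) :
  \forall v \near u, in_lattice L (v - b) -> v = u.
Proof.
have [ubL|nubL] := pselect (in_lattice L (u - b)).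
  have [r r0 hr] := lattice_discrete L.
  apply: filterS (near_row_nbhs u r0) => v hv vbL.
  apply/eqP; rewrite -subr_eq0; apply/eqP; apply: hr.
    by have := in_latticeB vbL ubL; rewrite opprB addrA subrK.
  by move=> i; rewrite !mxE subr0; exact: hv.
have [r r0 hr] := lattice_closed nubL.
apply: filterS (near_row_nbhs u r0) => v hv vbL; exfalso; apply: (hr _ vbL).
exact: near_row_shift.
Qed.

Lemma finite_interior (R : realType) (S : PK0curve R) (N : set S) : finite_set N -> interior N = set0.
Proof.
move=> fN; rewrite -subset0 => x hx.
have hT := @PK0_hausdorff _ S.
have cN : closed (N `\` [set x]).
  apply: (accessible_finite_set_closed.1 (hausdorff_accessible hT)).
  exact: finite_setD fN.
have nx : nbhs x (~` (N `\` [set x])).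
  by apply: open_nbhs_nbhs; split; [exact: closed_openC|move=> [_]; apply].
have [z [Nz nz] zx] := no_isolated (nbhs_setI hx nx).
by apply: nz.
Qed.

Section TorusCover.
Variables (R : realType) (S : PK0curve R) (L : lattice R 1).
Notation C := (Cplx R).
Implicit Types (x y z : S) (c : chart S C).
Variable tau : S -> C.

Definition in_lattice1 (g : C) := in_lattice L (const_mx g).

Hypothesis tau_local : forall c alpha x, pow_chart c alpha -> dom c x ->
  exists a : C, `|a| = 1 /\
    \forall y \near x, in_lattice1 (tau y - (tau x + a * (c y ^+ alpha - c x ^+ alpha))).
Hypothesis tau_onto : forall t, exists x, in_lattice1 (t - tau x).
Hypothesis tau_fib : forall t, finite_set [set x | in_lattice1 (tau x - t)].

Let p (x : curve_space S) : torus L := torus_proj L (const_mx (tau x)).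

Lemma torus_proj_const (s t : C) : torus_proj L (const_mx s) = torus_proj L (const_mx t) <-> in_lattice1 (s - t).
Proof.
rewrite torus_projP /in_lattice1 (_ : const_mx s - const_mx t = const_mx (s - t))//.
by apply/rowP => i; rewrite !mxE.
Qed.

Lemma const_mxK (v : 'rV[C]_1) : const_mx (v 0 0) = v.
Proof. by apply/rowP => i; rewrite mxE (ord1 i). Qed.

Lemma curve_atlasP (c' : chart S 'rV[C]_1) : @hol_atlas _ _ (curve_space S) c' <->
  exists c alpha, pow_chart c alpha /\ c' = row_chart c.
Proof.
split.
  move=> [c [fc|[x [alpha [vx cx]]]] <-].
    by exists c, 1%N; split => //; left.
  by exists c, alpha; split => //; right; exists x.
move=> [c [alpha [[[fc _]|[x vx cx]] ->]]]; exists c => //; first by left.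
by right; exists x, alpha.
Qed.

Lemma cover_local c alpha x : pow_chart c alpha -> dom c x -> exists a : C, `|a| = 1 /\
  \forall y \near x, p y = torus_proj L (const_mx (tau x + a * (c y ^+ alpha - c x ^+ alpha))).
Proof.
move=> hc cx; have [a [a1 ha]] := tau_local hc cx; exists a; split => //.
by apply: filterS ha => y hy; apply/torus_proj_const.
Qed.

Lemma pow_chart_continuous c alpha x : pow_chart c alpha -> dom c x ->
  {for x, continuous (fun y => c y ^+ alpha)}.
Proof.
move=> /pow_chartP [_ cc _] cx.
apply: (@continuous_comp _ _ _ (c : S -> C) (fun w : C => w ^+ alpha)).
  exact: (chart_cont cc cx).
exact: pow_continuous.
Qed.

Lemma cover_continuous : continuous (p : S -> torus L).
Proof.
move=> x; have [c [alpha [hc cx]]] := pow_chart_exists x.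
have [a [_ ha]] := cover_local hc cx.
pose F y := torus_proj L (const_mx (tau x + a * (c y ^+ alpha - c x ^+ alpha))).
have Fc : {for x, continuous F}.
  apply: (@continuous_comp _ _ _ _ (torus_proj L)); last exact: torus_proj_continuous.
  apply: (@continuous_comp _ _ _ _ (fun z : C => const_mx z : 'rV[C]_1)); last exact: const_mx_continuous.
  have Hp := pow_chart_continuous hc cx.
  rewrite (_ : (fun _ => _) = (fun w : C => (tau x - a * c x ^+ alpha) + a * w) \o (fun y => c y ^+ alpha)).
    apply: (@continuous_comp _ _ _ (fun y => c y ^+ alpha)
      (fun w : C => (tau x - a * c x ^+ alpha) + a * w)); first exact: Hp.
    exact: affine_continuous.
  by apply/funext => y /=; ring.
move=> A; rewrite (nbhs_singleton ha) => /Fc; rewrite !nbhs_simpl /= => FA.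
have E y : p y = F y -> (F @^-1` A) y -> (p @^-1` A) y by move=> pF FAy; rewrite /preimage /= pF.
exact: filterS2 E ha FA.
Qed.

(** Expression of the covering in a chart of exponent [alpha] at a point of coordinate
[w0]. *)
Definition pow_lift (a t0 : C) alpha (w0 : C) (w : C) : C := t0 + a * (w ^+ alpha - w0 ^+ alpha).

Lemma pow_lift_diff a t0 alpha w0 w : differentiable (pow_lift a t0 alpha w0) w /\
  'd (pow_lift a t0 alpha w0) w 1 = a * (alpha%:R * w ^+ alpha.-1).
Proof.
have dp : differentiable (fun z : C => z ^+ alpha) w.
  exact/differentiable_pow/differentiable_id.
have d1 : differentiable (pow_lift a t0 alpha w0) w.
  apply: differentiableD; first exact: differentiable_cst.
  apply: differentiableM; first exact: differentiable_cst.
  by apply: differentiableB => //; exact: differentiable_cst.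
split => //.
rewrite (_ : pow_lift a t0 alpha w0 =
  fun z : C => (t0 - a * w0 ^+ alpha) + a * (z ^+ alpha)); last first.
  by apply/funext => z; rewrite /pow_lift; ring.
by rewrite (diff_affine _ _ dp) diff_pow.
Qed.

Lemma cover_holomorphic : holomorphic_to_torus p.
Proof.
move=> c' x /curve_atlasP [c [alpha [hc ->]]] cx.
have [a [a1 ha]] := cover_local hc cx.
exists (fun v : 'rV[C]_1 => const_mx (pow_lift a (tau x) alpha (c x) (v 0 0))); split.
  apply: filterE => v; have [h _] := diff_lift1 (pow_lift_diff a (tau x) alpha (c x) (v 0 0)).1.
  exact: h.
by apply: filterS ha => y ->; rewrite /pow_lift /= mxE.
Qed.

Lemma pow_chart_neq0 c alpha x : pow_chart c alpha -> dom c x -> ~ vertices x ->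
  c x ^+ alpha.-1 != 0.
Proof.
move=> [[_ ->] _ _|[x' vx' [a0 cc cx' c0 _]] cx nx]; first by rewrite expr0 oner_eq0.
apply: expf_neq0; apply/eqP => h; apply: nx.
by rewrite (chart_inj cc cx cx')// h c0.
Qed.

(** The derivative a alpha w^(alpha - 1) of [pow_lift] vanishes only at w = 0, the vertex
of a cone chart. Ramification is defined with an arbitrary lift, which differs
from this one by a constant. *)
Lemma nonvertex_unramified x : ~ vertices x -> ~ ramification_locus p x.
Proof.
move=> nx [c' [F [/curve_atlasP [c [alpha [hc ->]]] cx [Fd pF] J0]]].
have [al0 cc _] := pow_chartP hc.
have [a [a1 ha]] := cover_local hc cx.
pose K (v : 'rV[C]_1) : 'rV[C]_1 := const_mx (pow_lift a (tau x) alpha (c x) (v 0 0)).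
have Kd v : differentiable K v by have [] := diff_lift1 (pow_lift_diff a (tau x) alpha (c x) (v 0 0)).1.
have FK : \forall v \near (const_mx (c x) : 'rV[C]_1), torus_proj L (F v) = torus_proj L (K v).
  have := chart_nbhs cc cx (nbhs_setI pF ha) => /nbhs_nrmP [r [r0 hr]].
  apply/nbhs_row; exists r; split => // v /(_ 0); rewrite mxE => /hr [y [[py hy] cy yv]].
  have vE : v = const_mx (c y) by rewrite yv const_mxK.
  by rewrite [in LHS]vE -[RHS]/(torus_proj L (K v)) -py hy /K /pow_lift yv.
have := nbhs_singleton Fd => Fdx.
have := lift_unique (differentiable_continuous Fdx) (differentiable_continuous (Kd _)) FK.
set k := F _ - K _ => hk.
pose K' (v : 'rV[C]_1) : 'rV[C]_1 := const_mx (pow_lift a (tau x + k 0 0) alpha (c x) (v 0 0)).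
have FKd : \forall v \near (const_mx (c x) : 'rV[C]_1), K' v = F v.
  apply: filterS hk => v hv; rewrite -[F v](subrK (K v)) hv; apply/rowP => i.
  by rewrite !mxE (ord1 i) /pow_lift; ring.
have [K'd K'J] := diff_lift1 (pow_lift_diff a (tau x + k 0 0) alpha (c x) ((const_mx (c x) : 'rV[C]_1) 0 0)).1.
have JE := near_eq_jacobian FKd K'd.
have J1 : \det ('J F (const_mx (c x) : 'rV[C]_1)) = 0 by exact: J0.
have := etrans (esym K'J) (etrans (esym (congr1 determinant JE)) J1).
rewrite (pow_lift_diff _ _ _ _ _).2 mxE => /eqP; apply/negP.
apply: mulf_neq0; first by rewrite -normr_eq0 a1 oner_eq0.
apply: mulf_neq0; first by rewrite pnatr_eq0 -lt0n.
exact: pow_chart_neq0 hc cx nx.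
Qed.

Lemma cover_fiber (y : torus L) : p @^-1` [set y] !=set0 /\ finite_set (p @^-1` [set y]).
Proof.
have [u yE] := torus_proj_surj y.
have [x hx] := tau_onto (u 0 0); split.
  exists x; rewrite /preimage /= yE -(const_mxK u); apply/torus_proj_const.
  by rewrite -opprB /in_lattice1 (_ : const_mx _ = - const_mx (u 0 0 - tau x)); [exact: in_latticeN|apply/rowP => i; rewrite !mxE].
apply: sub_finite_set (tau_fib (u 0 0)) => z; rewrite /preimage /= yE -{1}(const_mxK u).
by move=> /torus_proj_const.
Qed.

Definition vertex_values : set (torus L) := p @` vertices (S := S).

Lemma cover_branch_finite : finite_set (p @^-1` vertex_values).
Proof.
have -> : p @^-1` vertex_values = \bigcup_(y in vertex_values) (p @^-1` [set y]).
  apply/seteqP; split=> [x hx|x [y hy e]]; first by exists (p x).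
  by rewrite /preimage /=; rewrite /preimage /= in e; rewrite e.
apply: bigcup_finite; first exact/finite_image/vertices_finite.
by move=> y _; have [] := cover_fiber y.
Qed.

(** A finite set is locally contained in a point [u], where v 0 0 - u 0 0 vanishes. *)
Lemma vertex_values_thin : thin vertex_values.
Proof.
split.
  apply: (accessible_finite_set_closed.1 (hausdorff_accessible (@torus_hausdorff _ _ L))).
  exact/finite_image/vertices_finite.
move=> u.
have iso : \forall v \near u, vertex_values (torus_proj L v) -> v = u.
  have : \forall v \near u, forall f (i : 'I_3),
      in_lattice L (v - const_mx (tau (param f (corner f i)))) -> v = u.
    apply: (@filter_forall _ _ _ _ (nbhs_filter u)) => f.
    by apply: (@filter_forall _ _ _ _ (nbhs_filter u)) => i; exact: lattice_isolated.
  move=> H; apply: filterS H => v hv [x [f [i xE]] /esym/torus_projP h].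
  by apply: (hv f i); rewrite -xE.
exists (interior [set v | vertex_values (torus_proj L v) -> v = u]).
exists (fun v => v 0 0 - u 0 0); split.
- exact: open_interior.
- exact: iso.
- move=> v _; apply: differentiableB; first exact: differentiable_coord.
  exact: differentiable_cst.
- rewrite -subset0 => v /nbhs_row [r [r0 hr]].
  have zero t : `|t| < r -> v 0 0 + t%:C - u 0 0 = 0.
    move=> tr; have [|_] := hr (const_mx (v 0 0 + t%:C)).
      by move=> i; rewrite mxE (ord1 i) addrC addKr nrmR.
    by rewrite /preimage /= mxE.
  have := zero 0; rewrite normr0 addr0 => /(_ r0) /eqP; rewrite subr_eq0 => /eqP e1.
  have := zero (r / 2); rewrite ger0_norm ?divr_ge0 ?ltW//.
  rewrite e1 addrC addKr => h.
  have : r / 2 = 0 by apply: complexI; apply: h; lra.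
  lra.
- by move=> v /interior_subset h /h ->; rewrite subrr.
Qed.

Lemma vertex_values_interior : interior (p @^-1` vertex_values) = set0.
Proof. exact: finite_interior cover_branch_finite. Qed.

(** Rotating and translating a flat chart turns it into a lift of [p] with a prescribed
value of the class of [tau x]. *)
Lemma local_section x (t0 : C) (N : set S) : ~ vertices x -> in_lattice1 (tau x - t0) -> nbhs x N ->
  exists phi : chart S C, [/\ is_chart phi, dom phi x, phi x = t0, dom phi `<=` N &
    forall y, dom phi y -> p y = torus_proj L (const_mx (phi y))].
Proof.
move=> nx Gx hN; have [c fc cx] := PK0_flat nx.
have hc : pow_chart c 1 by left.
have [_ cc _] := pow_chartP hc.
have [a [a1 ha]] := cover_local hc cx.
have a0 : a != 0 by rewrite -normr_eq0 a1 oner_eq0.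
pose O := interior (N `&` [set y | p y = torus_proj L (const_mx (tau x + a * (c y ^+ 1 - c x ^+ 1)))]) `&` dom c.
have oO : open O by apply: openI; [exact: open_interior|exact: chart_open cc].
pose phi y := t0 + a * (c y - c x).
have Ox : O x by split => //; exact: nbhs_setI.
exists (Chart O phi); split => //.
- have phiW W : W `<=` O -> open W -> open (phi @` W).
    move=> WO oW; rewrite openE => t [y Wy yt].
    have [_ cy] := WO y Wy.
    have /nbhs_nrmP [r [r0 hr]] := chart_nbhs cc cy (open_nbhs_nbhs (conj oW Wy)).
    apply/nbhs_nrmP; exists r; split => // s hs.
    have [|z [Wz cz zE]] := hr (c y + a^-1 * (s - t)).
      by rewrite addrC addKr nrmM nrmV (nrm_unit a1) invr1 mul1r.
    have E (u : C) : a * (c y + a^-1 * u - c x) = a * (c y - c x) + u.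
      by rewrite (_ : _ - c x = (c y - c x) + a^-1 * u); [rewrite mulrDr mulVKf|ring].
    by exists z => //; rewrite /phi zE E -yt /phi; ring.
  exists (phi @` O); split => //.
  + exact: phiW.
  + split; first by move=> y Oy; exists y.
      move=> y z /set_mem [_ cy] /set_mem [_ cz] /addrI /(mulfI a0) /addIr.
      exact: (chart_inj cc cy cz).
    by [].
  + move=> y [_ cy].
    apply: (@continuous_comp _ _ _ (c : S -> C) (fun w : C => t0 + a * (w - c x))).
      exact: (chart_cont cc cy).
    rewrite (_ : (fun w : C => _) = fun w : C => (t0 - a * c x) + a * w); last by apply/funext => w; ring.
    exact: affine_continuous.
- by rewrite /= /phi subrr mulr0 addr0.
- by move=> y [/interior_subset []].
move=> y [/interior_subset [_ /= ->] _]; apply/torus_proj_const.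
rewrite /phi !expr1 (_ : _ - _ = tau x - t0)//; ring.
Qed.

(** Each point of the fibre of [y] has a chart that lifts [p], and these charts can be
made disjoint. The complement of their domains is compact, so its image is closed
and misses [y]; over a small disc around [y] the preimage is made of one piece of
each chart. *)
Lemma cover_evenly (y : torus L) : ~ vertex_values y -> evenly_covered p y.
Proof.
move=> nby; have [u0 yE] := torus_proj_surj y.
pose t0 := u0 0 0; have {}yE : y = torus_proj L (const_mx t0) by rewrite const_mxK.
have [_ /finite_seqP [s0 s0E]] := cover_fiber y.
pose s := undup s0.
have sE x : (x \in s) <-> p x = y.
  have h : (p x = y) = [set` s0] x by rewrite -s0E.
  by rewrite mem_undup; split => hx; [rewrite h|rewrite h in hx].
pose d := size s; pose xs (i : 'I_d) : S := tnth (in_tuple s) i.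
have xs_inj : injective xs.
  move=> i j /eqP; rewrite /xs !(tnth_nth (xs i)) /= nth_uniq ?undup_uniq// => /eqP ij.
  exact: val_inj.
have xsy i : p (xs i) = y by apply/sE; exact: mem_tnth.
have xsP x : p x = y -> exists i, x = xs i.
  by move=> /sE /(@tnthP _ _ (in_tuple s)) [i ->]; exists i.
have xs_nv i : ~ vertices (xs i) by move=> vx; apply: nby; exists (xs i).
have xsG i : in_lattice1 (tau (xs i) - t0) by apply/torus_proj_const; rewrite -yE; exact: xsy.
have [N [Nn Nd]] := separate_points (@PK0_hausdorff _ S) xs_inj.
have [r r0 hr] := lattice_discrete L.
have r2 : 0 < r / 2 by rewrite divr_gt0.
have Ginj (a b : C) : nrm (a - t0) < r / 2 -> nrm (b - t0) < r / 2 ->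
    torus_proj L (const_mx a) = torus_proj L (const_mx b) -> a = b.
  move=> ha hb /torus_proj_const Gab; apply/eqP; rewrite -subr_eq0; apply/eqP.
  have /rowP/(_ 0) : const_mx (a - b) = 0 :> 'rV[C]_1.
    apply: hr => // i; rewrite !mxE subr0.
    rewrite (_ : a - b = (a - t0) - (b - t0)); last by ring.
    by rewrite (le_lt_trans (nrmB _ _))//; lra.
  by rewrite !mxE.
have near_nv i : \forall x \near xs i, ~ vertices x.
  apply: filterS (vertex_isolated (xs i)) => x hx.
  by have [->|/eqP] := eqVneq x (xs i); [exact: xs_nv|exact: hx].
have /choice [phi1 hphi1] : forall i, exists phi : chart S C, [/\ is_chart phi, dom phi (xs i), phi (xs i) = t0,
    dom phi `<=` N i `&` [set x | ~ vertices x] &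
    forall y, dom phi y -> p y = torus_proj L (const_mx (phi y))].
  by move=> i; exact: (local_section (xs_nv i) (xsG i) (nbhs_setI (Nn i) (near_nv i))).
pose O i := dom (phi1 i) `&` phi1 i @^-1` [set t | nrm (t - t0) < r / 2].
have oball (e : R) : open [set t : C | nrm (t - t0) < e].
  rewrite openE => t ht; apply/nbhs_nrmP; exists (e - nrm (t - t0)); rewrite subr_gt0; split => // w hw.
  by have := nrm_tri w t0 t; rewrite /=; lra.
have opre i (e : R) : open (dom (phi1 i) `&` phi1 i @^-1` [set t | nrm (t - t0) < e]).
  have [cc _ _ _ _] := hphi1 i; rewrite openE => x [cx hx]; apply: nbhs_setI.
    exact: (open_nbhs_nbhs (conj (chart_open cc) cx)).
  exact: (chart_cont cc cx (open_nbhs_nbhs (conj (oball e) hx))).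
have Oxs i : O i (xs i).
  by have [_ cx xt _ _] := hphi1 i; split => //; rewrite /preimage /= xt subrr nrm0.
pose K := ~` \bigcup_i O i.
have cK : compact K.
  rewrite -[K]setTI; apply: compact_closedI; first exact: PK0_compact.
  by apply: open_closedC; apply: bigcup_open => i _; exact: opre.
have cpK : closed (p @` K).
  apply: compact_closed; first exact: torus_hausdorff.
  apply: continuous_compact => //; apply: continuous_subspaceT.
  exact: cover_continuous.
have npK : ~ (p @` K) y.
  by move=> [x nx /xsP [i xi]]; apply: nx; exists i => //; rewrite xi.
have : \forall v \near (const_mx t0 : 'rV[C]_1), ~ (p @` K) (torus_proj L v).
  have nK : nbhs y (~` (p @` K)) by exact: (open_nbhs_nbhs (conj (closed_openC cpK) npK)).
  rewrite yE in nK; exact: (@torus_proj_continuous _ _ L _ _ nK).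
move=> /nbhs_row [r1 [r10 hr1]].
have : \forall t \near t0, forall i, exists x, [/\ O i x, dom (phi1 i) x & phi1 i x = t].
  apply: (@filter_forall _ _ _ _ (nbhs_filter (t0 : C))) => i; have [cc cx xt _ _] := hphi1 i; rewrite -xt.
  by apply: (chart_nbhs cc cx); exact: (open_nbhs_nbhs (conj (opre i _) (Oxs i))).
move=> /nbhs_nrmP [r3 [r30 hr3]].
pose rho := Num.min (Num.min (r / 2) r1) r3.
have rho0 : 0 < rho by rewrite !lt_min r2 r10.
have rho_r t : nrm (t - t0) < rho -> [/\ nrm (t - t0) < r / 2, nrm (t - t0) < r1 & nrm (t - t0) < r3].
  by rewrite !lt_min => /andP[/andP[]].
pose V i := dom (phi1 i) `&` phi1 i @^-1` [set t | nrm (t - t0) < rho].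
pose P A : set (torus L) := torus_proj L @` ((fun v : 'rV[C]_1 => v 0 0) @^-1` A).
have Popen (A : set C) : open A -> open (P A).
  move=> oA; apply: torus_proj_open; apply: open_comp => // v _.
  exact: coord_continuous.
pose U := P [set t | nrm (t - t0) < rho].
have inP (A : set C) t : A t -> P A (torus_proj L (const_mx t)).
  by move=> At; exists (const_mx t) => //; rewrite /preimage /= mxE.
exists U, d, V; split.
- by rewrite yE; apply: inP; rewrite /= subrr nrm0.
- apply/seteqP; split => x.
    move=> [v vt vx]; rewrite /preimage /= in vt.
    have [i _ [ci hi]] : (\bigcup_i O i) x.
      apply: contrapT => nx; apply: (hr1 v); last by exists x.
      by move=> i; rewrite mxE (ord1 i); have [] := rho_r _ vt.
    exists i => //; split => //; rewrite /preimage /=.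
    suff -> : phi1 i x = v 0 0 by [].
    apply: Ginj => //; first by have [] := rho_r _ vt.
    have [_ _ _ _ pphi] := hphi1 i.
    by rewrite -pphi// const_mxK -vx.
  move=> [i _ [ci hi]]; have [_ _ _ _ pphi] := hphi1 i.
  by rewrite /preimage /= pphi//; apply: inP.
- move=> i j _ _ [x [[ci _] [cj _]]]; apply: contrapT => /eqP ij.
  have [_ _ _ /(_ x ci)[Ni _] _] := hphi1 i; have [_ _ _ /(_ x cj)[Nj _] _] := hphi1 j.
  by have : (N i `&` N j) x by []; rewrite Nd.
move=> i; have [cc cx xt phiN pphi] := hphi1 i; split; last first.
  rewrite -subset0 => x [[ci _]]; apply: nonvertex_unramified => //.
  by have [] := phiN x ci.
split.
- exact: opre.
- exact/Popen/oball.
- split.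
  + by move=> x [ci hi]; rewrite pphi//; exact: inP.
  + move=> x z /set_mem [ci hi] /set_mem [cz hz]; rewrite !pphi// => e.
    apply: (chart_inj cc ci cz); apply: Ginj e; [by have [] := rho_r _ hi|by have [] := rho_r _ hz].
  + move=> _ [v vt <-]; have [_ _ vr3] := rho_r _ vt.
    have [x [_ ci xv]] := hr3 _ vr3 i.
    exists x; first by split => //; rewrite /preimage /= xv.
    by rewrite pphi// xv const_mxK.
- by move=> x _; exact: cover_continuous x.
- move=> W WV oW.
  have -> : p @` W = P (phi1 i @` W).
    apply/seteqP; split => z.
      move=> [x Wx <-]; have [ci _] := WV x Wx; rewrite pphi//.
      by apply: inP; exists x.
    move=> [v [x Wx xv] <-]; have [ci _] := WV x Wx.
    by exists x => //; rewrite pphi// xv const_mxK.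
  apply: Popen; have [B [_ _ _ _]] := cc; apply => // z /WV [cz1 _]; exact: cz1.
Qed.

Lemma cover_ramified : ramified_covering p.
Proof.
split.
- exact: cover_holomorphic.
- exact: cover_fiber.
exists vertex_values; split; [exact: vertex_values_thin|exact: vertex_values_interior|exact: cover_evenly].
Qed.

(** In a flat chart the lift is a c + b with |a| = 1, which settles the metric. *)
Theorem cover_of_tau : ramified_covering_of_torus (curve_space S).
Proof.
have [h hE] : exists h : {dot 'rV[C]_1 for Num.conj}, forall u v, h u v = u 0 0 * Num.conj (v 0 0).
  apply: dot_of_form.
  - by move=> v a u u'; rewrite !mxE mulrDl mulrA.
  - by move=> u v; rewrite rmorphM /= conjCK mulrC.
  - move=> u u0; rewrite -normCK exprn_gt0// normr_gt0; apply: contra u0 => /eqP e.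
    by apply/eqP/rowP => i; rewrite (ord1 i) e mxE.
exists L, h, p; split; first exact: cover_ramified.
move=> c' x [c fc <-] cx _.
have hc : pow_chart c 1 by left.
have [a [a1 ha]] := cover_local hc cx.
exists [set y | p y = torus_proj L (const_mx (tau x + a * (c y ^+ 1 - c x ^+ 1)))].
exists (fun y => const_mx (tau x + a * (c y ^+ 1 - c x ^+ 1))); split => //.
move=> y z _ _; rewrite hE big_ord1 !mxE /= !expr1.
rewrite (_ : _ - _ = a * (c y - c z)); last by ring.
by rewrite -normCK normrM a1 mul1r.
Qed.

End TorusCover.

(** * Maps along a complex line *)

Section Periods.
Variables (R : realType) (n : nat) (L : lattice R n).
Notation C := (Cplx R).
Variable e : 'rV[C]_n.
Hypothesis e0 : e != 0.

(** By [coef_bound] a bound on |g| leaves finitely many integer coordinates for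
[g *: e], which determines [g] as [e] is nonzero. *)
Lemma leaf_finite (B : R) : finite_set [set g : C | in_lattice L (g *: e) /\ nrm g <= B].
Proof.
have [i0 ei0] : exists i, e 0 i != 0.
  apply/existsP; rewrite -negb_forall; apply: contra e0 => /forallP h.
  by apply/eqP/rowP => i; rewrite mxE; apply/eqP; exact: h.
have [K K0 hK] := coef_bound L.
pose E := \sum_i nrm (e 0 i).
have E0 : 0 <= E by apply: sumr_ge0 => i _; exact: nrm_ge0.
have eE i : nrm (e 0 i) <= E.
  by rewrite /E (bigD1 i)//= lerDl sumr_ge0// => j _; exact: nrm_ge0.
pose M := Num.bound (K * (B * E)).
pose f (m : {ffun 'I_(n + n) -> 'I_(M + M).+1}) : C :=
  (\sum_i (((m i : nat)%:Z - M%:Z)%:~R : R)%:C *: lat_basis L i) 0 i0 / e 0 i0.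
apply: (@sub_finite_set _ _ (f @` [set: {ffun 'I_(n + n) -> 'I_(M + M).+1}])); last first.
  exact/finite_image/finite_finset.
move=> g [/in_latticeE [m mE] gB].
have mB i : `|(m i)%:~R : R| <= K * (B * E).
  apply: (hK (fun i => (m i)%:~R)) => j; rewrite -mE mxE nrmM ler_pM ?nrm_ge0//.
have mM i : (`|m i| <= M)%N.
  have hb : (`|m i|%N%:R : R) < M%:R.
    rewrite natr_absz intr_norm (le_lt_trans (mB i))// /M.
    by apply: archi_boundP; rewrite (le_trans _ (mB i)).
  by move: hb; rewrite ltr_nat; exact: ltnW.
exists [ffun i => inord (absz (m i + M%:Z))] => //.
rewrite /f.
have -> : \sum_i ((([ffun i => inord (absz (m i + M%:Z))] : {ffun 'I_(n + n) -> 'I_(M + M).+1}) i : nat)%:Z - M%:Z)%:~R%:C *: lat_basis L i = g *: e.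
  rewrite mE; apply: eq_bigr => i _; rewrite ffunE inordK; last by have := mM i; lia.
  by congr ((_ %:~R)%:C *: _); have := mM i; lia.
by rewrite mxE mulfK.
Qed.

End Periods.

Section LeafCover.
Variables (R : realType) (S : PK0curve R) (n : nat) (L : lattice R n).
Notation C := (Cplx R).
Implicit Types (x y z : S) (c : chart S C).
Variables (q : S -> torus L) (e : 'rV[C]_n) (x0 : S).
Hypothesis e0 : e != 0.
Hypothesis qlift : liftable q.
Hypothesis qx0 : unit_form q e x0.
Hypothesis qfin : forall y : torus L, finite_set (q @^-1` [set y]).

(** Along a piece where [q] has the affine form, moving changes [q] by multiples of
[e]; so the points with value on the complex line b + C e spread over the curve. *)
Lemma leaf_values : exists (b : 'rV[C]_n) (tau : S -> C),
  forall x, q x = torus_proj L (tau x *: e + b).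
Proof.
have uf := unit_form_all qlift qx0.
have [b bE] := torus_proj_surj (q x0); exists b.
suff : forall x, exists t, q x = torus_proj L (t *: e + b) by move=> /choice [tau h]; exists tau.
apply: (connected_spread (@PK0_connected _ S) (P := fun x => exists t, q x = torus_proj L (t *: e + b)) (x0 := x0)).
  by exists 0; rewrite scale0r add0r.
move=> x; have [c [alpha [hc cx]]] := pow_chart_exists x.
have [a [b' [a1 hx]]] := uf x c alpha hc cx.
exists (interior [set y | q y = torus_proj L ((a * c y ^+ alpha) *: e + b')]); split.
- exact: open_interior.
- exact: hx.
move=> z /interior_subset /= -> [t /torus_projP tL] y /interior_subset /= ->.
have E (r s u : C) : s *: e + b' - ((s - r + u) *: e + b) = r *: e + b' - (u *: e + b).
  by apply/rowP => i; rewrite !mxE; ring.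
exists (a * c y ^+ alpha - a * c z ^+ alpha + t); apply/torus_projP.
by rewrite E.
Qed.

(** The map [tau] of [leaf_values] is well defined modulo the group [G] of periods, and
locally of the form a c^alpha + b there. Its fibres modulo [G] are fibres of [q]. *)
Theorem leaf_covering : ramified_covering_of_torus (curve_space S).
Proof.
have [b [tau qE]] := leaf_values.
pose G : set C := [set g | in_lattice L (g *: e)].
have G0 : G 0 by rewrite /G /= scale0r; exact: in_lattice0.
have GD u v : G u -> G v -> G (u + v).
  by rewrite /G /= scalerDl; exact: in_latticeD.
have GN u : G u -> G (- u) by rewrite /G /= scaleNr; exact: in_latticeN.
have loc c alpha x : pow_chart c alpha -> dom c x -> exists a : C, `|a| = 1 /\
    \forall y \near x, G (tau y - (tau x + a * (c y ^+ alpha - c x ^+ alpha))).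
  move=> hc cx; have [a [b' [a1 hx]]] := unit_form_all qlift qx0 hc cx.
  have E (r s u v : C) : (r - (s + a * (u - v))) *: e =
      (r *: e + b - ((a * u) *: e + b')) - (s *: e + b - ((a * v) *: e + b')).
    by apply/rowP => i; rewrite !mxE; ring.
  exists a; split => //; have := nbhs_singleton hx.
  rewrite qE => /torus_projP h1; apply: filterS hx => y.
  rewrite qE => /torus_projP h2; rewrite /G /=.
  by rewrite E; exact: in_latticeB.
have reach := reached_all GD GN loc.
have co := cocompact GD GN loc.
have [L1 L1E] := rank2_lattice G0 GD GN (leaf_finite L e0) co.
have GE g : in_lattice1 L1 g <-> G g by rewrite /in_lattice1 L1E mxE.
apply: (@cover_of_tau _ _ L1 tau).
- move=> c alpha x hc cx; have [a [a1 hx]] := loc c alpha x hc cx.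
  by exists a; split => //; apply: filterS hx => y /GE.
- by move=> t; have [x hx] := reach t; exists x; apply/GE.
move=> t; apply: sub_finite_set (qfin (torus_proj L (t *: e + b))) => x /= /GE h.
rewrite /preimage /= qE; apply/torus_projP.
by rewrite (_ : _ - _ = (tau x - t) *: e)//; apply/rowP => i; rewrite !mxE; ring.
Qed.

End LeafCover.

(** * Holomorphic isometries *)

Section DotNorm.
Variables (R : realType) (n : nat).
Notation C := (Cplx R).
Variable h : {dot 'rV[C]_n for Num.conj}.
Implicit Types (u v : 'rV[C]_n).

Let M : 'M[C]_n := \matrix_(j, k) h (delta_mx 0 j) (delta_mx 0 k).

Lemma dot_suml (I : finType) (F : I -> 'rV[C]_n) g : h (\sum_i F i) g = \sum_i h (F i) g.
Proof.
elim: (index_enum I) => [|i s ih].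
  by rewrite !big_nil -[X in h X _](subrr g) dotBl subrr.
by rewrite !big_cons dotDl ih.
Qed.

Lemma dot_sumr (I : finType) (F : I -> 'rV[C]_n) v : h v (\sum_i F i) = \sum_i h v (F i).
Proof. by rewrite dotC dot_suml rmorph_sum; apply: eq_bigr => i _; rewrite [RHS]dotC. Qed.

Lemma dot_gram v g : h v g = (v *m M *m (map_mx Num.conj g)^T) 0 0.
Proof.
rewrite -mulmxA mxE {1}(row_sum_delta v) dot_suml; apply: eq_bigr => j _.
rewrite dotZl; congr (_ * _).
rewrite mxE {1}(row_sum_delta g) dot_sumr; apply: eq_bigr => k _.
by rewrite dotZr !mxE mulrC.
Qed.

Lemma gram_unit : M \in unitmx.
Proof.
rewrite -row_free_unit -kermx_eq0; apply/rowV0P => v /sub_kermxP vM.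
apply/eqP; apply: contraT => v0; have := dot_gt0 h v0.
by rewrite dot_gram vM mul0mx mxE ltxx.
Qed.

(** Riesz representation, through the inverse of the Gram matrix. *)
Lemma dot_coord i : exists g, forall v, v 0 i = h v g.
Proof.
exists (map_mx Num.conj (invmx M *m delta_mx i 0)^T) => v; rewrite dot_gram.
rewrite -map_mx_comp (_ : map_mx _ _ = (invmx M *m delta_mx i 0)^T); last first.
  by apply/matrixP => j k; rewrite !mxE /= conjCK.
rewrite trmxK mulmxA mulmxK ?gram_unit// mxE (bigD1 i)//= mxE !eqxx mulr1.
by rewrite big1 ?addr0// => j /negbTE ji; rewrite mxE ji mulr0.
Qed.

(** Cauchy-Schwarz inequality against the vectors representing the coordinates. *)
Lemma dot_control : exists2 K : R, 0 < K &
  forall v i, nrm (v 0 i) ^+ 2 <= K * nrm (h v v).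
Proof.
have /choice [g hg] := dot_coord.
pose K := \sum_i nrm (h (g i) (g i)) + 1.
exists K; first by rewrite ltr_wpDl// sumr_ge0// => i _; exact: nrm_ge0.
move=> v i; rewrite (hg i v).
have [CS _] := CauchySchwarz h v (g i).
have : nrm (h v (g i)) ^+ 2 <= nrm (h v v) * nrm (h (g i) (g i)).
  rewrite -lecR rmorphXn rmorphM /= !nrmE.
  by rewrite (ger0_norm (dnorm_ge0 h v)) (ger0_norm (dnorm_ge0 h (g i))).
move=> /le_trans; apply; rewrite mulrC ler_wpM2r ?nrm_ge0//.
rewrite /K (bigD1 i)//= -addrA lerDl addr_ge0// sumr_ge0// => j _; exact: nrm_ge0.
Qed.

Lemma dot_bound u : exists2 K : R, 0 <= K &
  forall v (e : R), (forall i, nrm (v 0 i) <= e) -> nrm (h v u) <= K * e.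
Proof.
exists (\sum_i nrm (h (delta_mx 0 i) u)); first by apply: sumr_ge0 => i _; exact: nrm_ge0.
move=> v e ve; rewrite {1}(row_sum_delta v) dot_suml mulr_suml.
have nsum (s : seq 'I_n) (F : 'I_n -> C) : nrm (\sum_(i <- s) F i) <= \sum_(i <- s) nrm (F i).
  elim: s => [|i s ih]; first by rewrite !big_nil nrm0.
  by rewrite !big_cons (le_trans (nrmD _ _))// lerD2l.
rewrite (le_trans (nsum _ _))//; apply: ler_sum => i _.
by rewrite dotZl nrmM mulrC ler_wpM2l ?nrm_ge0.
Qed.

(** The real part of [X] is seen along real [t], its imaginary part along imaginary [t]. *)
Lemma re_small_eq0 (X : C) : (forall e : R, 0 < e -> exists2 d : R, 0 < d &
   forall t : C, nrm t < d -> `|Re (Num.conj t * X)| <= e * nrm t) -> X = 0.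
Proof.
move=> H.
have small (x : R) : (forall e, 0 < e -> `|x| <= e) -> x = 0.
  move=> hx; apply/eqP; rewrite -normr_eq0 eq_le normr_ge0 andbT leNgt; apply/negP => x0.
  have := hx (`|x| / 2); rewrite divr_gt0// => /(_ isT); lra.
apply/eqP; rewrite eq_complex; apply/andP; split; apply/eqP; apply: small => e e0;
  have [d d0 hd] := H e e0; have d2 : 0 < d / 2 by [rewrite divr_gt0]; have dd : d / 2 < d by lra.
- have := hd (d / 2)%:C; rewrite nrmR (ger0_norm (ltW d2)) => /(_ dd).
  rewrite (_ : Num.conj _ = (d / 2)%:C); last by rewrite -[LHS]/(conjc _) conjc_real.
  rewrite ReZ normrM (ger0_norm (ltW d2)) mulrC ler_pM2r //.
- have := hd ('i * (d / 2)%:C); rewrite nrmM nrmi mul1r nrmR (ger0_norm (ltW d2)) => /(_ dd).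
  rewrite (_ : Re _ = d / 2 * Im X); last first.
    by rewrite -[Num.conj _]/(conjc _); case: (X) => p q /=; ring.
  rewrite normrM (ger0_norm (ltW d2)) mulrC ler_pM2r //.
Qed.

(** By polarization f preserves the real scalar products of increments from [w0]. Let
[e] be the derivative; comparing the increments s and t and letting t tend to 0
in all complex directions gives h(e, f(w0 + s) - f(w0)) = conj(s), and then
h(e, e) = 1. With these values the square norm of f(w) - f(w0) - (w - w0) e
expands to zero. *)
Lemma isometry_affine (f : C -> 'rV[C]_n) (w0 : C) (r : R) : 0 < r ->
  (forall i, differentiable (fun w => f w 0 i) w0) ->
  (forall w w', nrm (w - w0) < r -> nrm (w' - w0) < r ->
    h (f w - f w') (f w - f w') = `|w - w'| ^+ 2) ->
  exists e : 'rV[C]_n, h e e = 1 /\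
    forall w, nrm (w - w0) < r -> f w = f w0 + (w - w0) *: e.
Proof.
move=> r0 df iso.
have /choice [l hl] i := differentiableC (df i).
pose e : 'rV[C]_n := \row_i l i.
have approx (ep : R) : 0 < ep -> exists2 d : R, 0 < d & forall t, nrm t < d ->
    forall i, nrm ((f (w0 + t) - f w0 - t *: e) 0 i) <= ep * nrm t.
  move=> ep0; have /choice [d hd] : forall i, exists d : R, 0 < d /\ forall w, nrm (w - w0) < d ->
      nrm (f w 0 i - f w0 0 i - l i * (w - w0)) <= ep * nrm (w - w0).
    by move=> i; have [d d0 hd] := hl i ep ep0; exists d.
  have : \forall t \near (0 : C), forall i, nrm ((f (w0 + t) - f w0 - t *: e) 0 i) <= ep * nrm t.
    apply: (@filter_forall _ _ _ _ (nbhs_filter (0 : C))) => i; have [d0 hdi] := hd i.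
    apply/nbhs_nrmP; exists (d i); split => // t; rewrite subr0 => td.
    have := hdi (w0 + t); rewrite addrC addKr => /(_ td).
    by rewrite !mxE [t * _]mulrC [w0 + t]addrC.
  by move=> /nbhs_nrmP [d' [d'0 hd']]; exists d' => // t td; apply: hd'; rewrite subr0.
have nconj (z : C) : nrm (Num.conj z) = nrm z.
  by apply: complexI; rewrite !nrmE norm_conjC.
have Ee (t : C) u : h (f (w0 + t) - f w0) u = t * h e u + h (f (w0 + t) - f w0 - t *: e) u.
  by rewrite -dotZl -dotDl [t *: e + _]addrC subrK.
have rest u (ep : R) : 0 < ep -> exists2 d : R, 0 < d & forall t, nrm t < d ->
    nrm (h (f (w0 + t) - f w0 - t *: e) u) <= ep * nrm t.
  move=> ep0; have [K K0 hK] := dot_bound u.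
  have K1 : 0 < K + 1 by lra.
  have [|d d0 hd] := approx (ep / (K + 1)); first by rewrite divr_gt0.
  exists d => // t td; apply: le_trans (hK _ _ (hd t td)) _.
  have k1 : K / (K + 1) <= 1 by rewrite ler_pdivrMr// mul1r; lra.
  rewrite (_ : K * _ = ep * nrm t * (K / (K + 1))); last by ring.
  by rewrite -[leRHS]mulr1 ler_wpM2l// mulr_ge0 ?nrm_ge0// ltW.
have pol s t : nrm s < r -> nrm t < r ->
    Re (h (f (w0 + t) - f w0) (f (w0 + s) - f w0)) = Re s * Re t + Im s * Im t.
  move=> hs ht.
  have [u uE] : exists u, u = f (w0 + s) - f w0 by exists (f (w0 + s) - f w0).
  have [v vE] : exists v, v = f (w0 + t) - f w0 by exists (f (w0 + t) - f w0).
  rewrite -uE -vE.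
  have z0 : nrm (w0 - w0) < r by rewrite subrr nrm0.
  have nrm2 (z : C) : Re (`|z| ^+ 2) = Re z ^+ 2 + Im z ^+ 2.
    by rewrite -nrmE -rmorphXn /= nrm_sqrt sqr_sqrtr// addr_ge0 ?sqr_ge0.
  have hu : Re (h u u) = Re s ^+ 2 + Im s ^+ 2.
    by rewrite uE iso// addrC addKr// nrm2.
  have hv : Re (h v v) = Re t ^+ 2 + Im t ^+ 2.
    by rewrite vE iso// addrC addKr// nrm2.
  have : Re (h (u - v) (u - v)) = (Re s - Re t) ^+ 2 + (Im s - Im t) ^+ 2.
    rewrite uE vE opprB addrA subrK iso; [|by rewrite addrC addKr|by rewrite addrC addKr].
    by rewrite nrm2 (_ : w0 + s - (w0 + t) = s - t) ?ReD ?ImD ?ReN ?ImN//; ring.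
  rewrite dotBl !dotBr !(ReD, ReN) hu hv (dotC h u v).
  rewrite (_ : Re (Num.conj _) = Re (h v u)); last by case: (h v u).
  nra.
have hue s : nrm s < r -> h e (f (w0 + s) - f w0) = Num.conj s.
  move=> hs; apply/eqP; rewrite -subr_eq0; apply/eqP; apply: re_small_eq0 => ep ep0.
  set u := f (w0 + s) - f w0.
  have [d d0 hd] := rest u ep ep0.
  exists (Num.min d r); first by rewrite lt_min d0.
  move=> t ht; pose t' := Num.conj t.
  have : nrm t' < d /\ nrm t' < r by rewrite /t' nconj; move: ht; rewrite lt_min => /andP.
  move=> [td tr]; have := pol s t' hs tr; rewrite Ee -/u => E2.
  have -> : Re (t' * (h e u - Num.conj s)) = - Re (h (f (w0 + t') - f w0 - t' *: e) u).
    rewrite mulrBr ReD ReN; move: E2; rewrite ReD => E2.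
    have -> : Re (t' * Num.conj s) = Re s * Re t' + Im s * Im t'.
      by rewrite -[Num.conj s]/(conjc s); case: (t') (s) => [p1 p2] [q1 q2] /=; ring.
    lra.
  by rewrite normrN (le_trans (Re_nrm _))// (le_trans (hd t' td))// /t' nconj.
have hee : h e e = 1.
  apply/eqP; rewrite -subr_eq0; apply/eqP; apply: re_small_eq0 => ep ep0.
  have [d d0 hd] := rest e ep ep0.
  exists (Num.min d r); first by rewrite lt_min d0.
  move=> t; rewrite lt_min => /andP[td tr].
  rewrite (le_trans (Re_nrm _))// nrmM nconj -nrmM mulrBr mulr1.
  have E := Ee t e; rewrite [LHS]dotC hue// conjCK in E.
  have -> : t * h e e - t = - h (f (w0 + t) - f w0 - t *: e) e.
    have alg (A B c : C) : c = A + B -> A - c = - B by move=> ->; rewrite opprD addrA subrr sub0r.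
    exact: alg E.
  by rewrite nrmN; exact: hd.
exists e; split => // w hw.
apply/eqP; rewrite -subr_eq0; apply: contraT => nz.
have := dot_gt0 h nz.
rewrite opprD addrA.
have [u uE] : exists u, u = f w - f w0 by exists (f w - f w0).
have [s sE] : exists s, s = w - w0 by exists (w - w0).
rewrite -uE -sE.
have hs : nrm s < r by rewrite sE.
have fu : f (w0 + s) - f w0 = u by rewrite sE [w0 + _]addrC subrK uE.
have heu : h e u = Num.conj s by rewrite -fu hue.
have hue' : h u e = s by rewrite dotC heu conjCK.
have huu : h u u = `|s| ^+ 2 by rewrite uE sE iso// subrr nrm0.
rewrite dotBl !dotBr !dotZl !dotZr hue' heu hee huu mulr1 normCK.
rewrite (_ : _ - _ = 0) ?ltxx//; ring.
Qed.

End DotNorm.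

(** * Slices of a covering of a product *)

Section SliceCover.
Variables (R : realType) (S : PK0curve R) (n : nat) (L : lattice R n).
Notation C := (Cplx R).
Implicit Types (x y z : S) (c : chart S C).

(** The isometric lift [F] and a holomorphic lift differ by a constant, so the latter
is a holomorphic isometry near [x0], and is affine there. This is the local form
which [leaf_covering] propagates. *)
Lemma slice_cover (q : S -> torus L) (h : {dot 'rV[C]_n for Num.conj})
    (x0 : S) (c : chart S C) (W : set S) (F : S -> 'rV[C]_n) :
  liftable q -> (forall y : torus L, finite_set (q @^-1` [set y])) ->
  ~ vertices x0 -> flat_chart c -> dom c x0 -> nbhs x0 W ->
  (forall y, W y -> q y = torus_proj L (F y)) ->
  (forall y y', W y -> W y' -> h (F y - F y') (F y - F y') = `|c y - c y'| ^+ 2) ->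
  ramified_covering_of_torus (curve_space S).
Proof.
move=> ql qf nx fc cx nW qF iso.
have hc : pow_chart c 1 by left.
have [_ cc _] := pow_chartP hc.
have Wx := nbhs_singleton nW.
have [G [Gd qG]] := ql c 1%N x0 hc cx.
have [K K0 hK] := dot_control h.
(* A map that preserves distances is continuous, as [lift_unique] requires. *)
have Fc : {for x0, continuous F}.
  move=> A /nbhs_row [e [e0 HA]]; rewrite nbhs_simpl /=.
  have d0 : 0 < e / (K + 1) by rewrite divr_gt0//; lra.
  have := chart_cont cc cx (nbhs_nrm_ball (c x0) d0); rewrite nbhs_simpl /= => cd.
  apply: filterS2 nW cd => y Wy yd; apply: HA => i.
  have := hK (F y - F x0) i; rewrite iso// !mxE -nrmE -rmorphXn /= nrmR.
  rewrite ger0_norm ?exprn_ge0 ?nrm_ge0// => h1.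
  rewrite ltNge; apply/negP => h2.
  have : e ^+ 2 <= K * nrm (c y - c x0) ^+ 2.
    by rewrite (le_trans _ h1)// lerXn2r ?nnegrE ?nrm_ge0// ltW.
  have : nrm (c y - c x0) ^+ 2 <= (e / (K + 1)) ^+ 2.
    by rewrite lerXn2r ?nnegrE ?nrm_ge0 ?(ltW d0)// ltW.
  move=> h3 h4; have {h3}h3 := ler_wpM2l (ltW K0) h3.
  have : e ^+ 2 <= K * (e / (K + 1)) ^+ 2 by exact: le_trans h4 h3.
  have K1 : 0 < K + 1 by lra.
  rewrite expr_div_n mulrA ler_pdivlMr ?exprn_gt0// => h5.
  have : 0 < e ^+ 2 * (K ^+ 2 + K + 1).
    by rewrite mulr_gt0 ?exprn_gt0//; have := sqr_ge0 K; lra.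
  lra.
have Gdx := nbhs_singleton Gd.
have Gc : {for x0, continuous (fun y => G (c y))}.
  apply: (@continuous_comp _ _ _ (c : S -> C) G); first exact: (chart_cont cc cx).
  exact: differentiable_continuous Gdx.
have FG : \forall y \near x0, torus_proj L (F y) = torus_proj L (G (c y)).
  by apply: filterS2 nW qG => y Wy <-; rewrite qF.
have := lift_unique Fc Gc FG; set k := F x0 - _ => hk.
have /nbhs_nrmP [r [r0 hr]] := chart_nbhs cc cx (nbhs_setI nW hk).
have [||e [ee Ge]] := @isometry_affine _ _ h G (c x0) r r0.
- move=> i; apply: (differentiable_comp (g := fun N : 'rV[C]_n => N 0 i) Gdx).
  exact: differentiable_coord.
- move=> w w' /hr [y [[Wy Fy] _ <-]] /hr [y' [[Wy' Fy'] _ <-]].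
  rewrite -iso//; have E z : F z - G (c z) = k -> F z = G (c z) + k.
    by move=> /eqP; rewrite subr_eq addrC => /eqP.
  by rewrite (E y)// (E y')// opprD addrACA subrr addr0.
have e0 : e != 0.
  apply/eqP => e0; move: ee; rewrite e0 -[X in h X _](subrr 0) dotBl subrr => /eqP.
  by rewrite eq_sym oner_eq0.
have form : has_form q e c 1 1 (G (c x0) - c x0 *: e) x0.
  have := chart_cont cc cx (nbhs_nrm_ball (c x0) r0); rewrite nbhs_simpl /= => cr.
  apply: filterS2 qG cr => y -> yr; congr (torus_proj L _).
  rewrite (Ge _ yr); apply/rowP => i; rewrite !mxE expr1; ring.
have uf := form_change hc cx nx (normr1 _) form.
exact: leaf_covering e0 ql uf qf.
Qed.

End SliceCover.

Section Prod.
Variables (R : realType) (C1 C2 : PK0curve R).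
Notation C := (Cplx R).
Notation X := (prod_space (curve_space C1) (curve_space C2)).
Variables (L : lattice R (1 + 1)) (h : {dot 'rV[C]_(1 + 1) for Num.conj}) (p : X -> torus L).
Hypothesis pcov : ramified_covering p.
Hypothesis pflat : flat_compatible p h.

Definition slice1 (k w : C) : 'rV[C]_(1 + 1) := row_mx (const_mx w) (const_mx k).
Definition slice2 (k w : C) : 'rV[C]_(1 + 1) := row_mx (const_mx k) (const_mx w).

Lemma affine_row_diff n (v k : 'rV[C]_n) (w : C) : differentiable (fun w : C => w *: v + k) w.
Proof.
apply: differentiableD; last exact: differentiable_cst.
exact: ex_diff.
Qed.

Lemma slice1_diff k w : differentiable (slice1 k) w.
Proof.
rewrite (_ : slice1 k = fun w : C => w *: row_mx (const_mx 1) 0 + row_mx 0 (const_mx k)).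
  exact: affine_row_diff.
apply/funext => u; rewrite /slice1 scale_row_mx add_row_mx scaler0 add0r addr0.
by congr row_mx; apply/rowP => i; rewrite !mxE mulr1.
Qed.

Lemma slice2_diff k w : differentiable (slice2 k) w.
Proof.
rewrite (_ : slice2 k = fun w : C => w *: row_mx 0 (const_mx 1) + row_mx (const_mx k) 0).
  exact: affine_row_diff.
apply/funext => u; rewrite /slice2 scale_row_mx add_row_mx scaler0 add0r addr0.
by congr row_mx; apply/rowP => i; rewrite !mxE mulr1.
Qed.

Lemma prod_pow_chart c alpha d beta : pow_chart (S := C1) c alpha -> pow_chart (S := C2) d beta ->
  @hol_atlas _ _ X (prod_chart (row_chart c) (row_chart d)).
Proof.
move=> hc hd; exists (row_chart c), (row_chart d); split => //; apply/curve_atlasP.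
  by exists c, alpha.
by exists d, beta.
Qed.

Lemma prod_flat_chart c d : flat_chart (S := C1) c -> flat_chart (S := C2) d ->
  @flat_atlas _ _ X (prod_chart (row_chart c) (row_chart d)).
Proof.
by move=> hc hd; exists (row_chart c), (row_chart d); split => //; [exists c|exists d].
Qed.

Lemma exists_nonvertex (S : PK0curve R) : exists x : S, ~ vertices x.
Proof.
apply: contrapT => no.
have [x _] := PK0_nonempty S.
have : interior (vertices (S := S)) x.
  by apply: filterE => y; apply: contrapT => ny; apply: no; exists y.
by rewrite (finite_interior (vertices_finite S)).
Qed.

Lemma nonvertex_open (S : PK0curve R) : open (~` vertices (S := S)).
Proof.
apply: closed_openC.
apply: (accessible_finite_set_closed.1 (hausdorff_accessible (@PK0_hausdorff _ S))).
exact: vertices_finite.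
Qed.

(** The covering is even, hence unramified, off its branch set, whose preimage has no
interior; the vertices are finitely many. *)
Lemma base_point : exists x0 y0, [/\ ~ vertices x0, ~ vertices y0 & ~ ramification_locus p (x0, y0)].
Proof.
have [_ _ [B [_ Bint Bev]]] := pcov.
have [x1 nx1] := exists_nonvertex C1; have [y1 ny1] := exists_nonvertex C2.
have [[x0 y0] [[nx ny] nB]] : exists z : X, (~ vertices z.1 /\ ~ vertices z.2) /\ ~ B (p z).
  apply: contrapT => no.
  suff : interior (p @^-1` B) (x1, y1) by rewrite Bint.
  exists (~` vertices (S := C1), ~` vertices (S := C2)) => /=.
    by split; apply: open_nbhs_nbhs; split => //; exact: nonvertex_open.
  by move=> [x y] [/= nx ny]; apply: contrapT => nB; apply: no; exists (x, y).
exists x0, y0; split => // ram.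
have [U [d [V [Uy UV _ HV]]]] := Bev _ nB.
have [i _ Vi] : (\bigcup_i V i) (x0, y0) by rewrite -UV.
have [_ V0] := HV i.
have : (V i `&` ramification_locus p) (x0, y0) by [].
by rewrite V0.
Qed.

Lemma liftable1 y0 : liftable (fun x : C1 => p (x, y0)).
Proof.
move=> c alpha x hc cx; have [d [beta [hd dy]]] := pow_chart_exists y0.
have [hp _ _] := pcov.
have [G [Gd pG]] := hp _ (x, y0) (prod_pow_chart hc hd) (conj cx dy).
exists (fun w => G (slice1 (d y0) w)); split.
  have := differentiable_continuous (slice1_diff (d y0) (c x)) Gd; rewrite nbhs_simpl /=.
  move=> H; apply: (@filterS _ _ (nbhs_filter (c x)) _ _ _ H) => w Gw; apply: (differentiable_comp (slice1_diff _ _)); exact: Gw.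
by move: pG => [[A B] [/= nA nB] AB]; apply: filterS nA => y Ay; apply: (AB (y, y0)); split => //=; exact: nbhs_singleton nB.
Qed.

Lemma liftable2 x0 : liftable (fun y : C2 => p (x0, y)).
Proof.
move=> d beta y hd dy; have [c [alpha [hc cx]]] := pow_chart_exists x0.
have [hp _ _] := pcov.
have [G [Gd pG]] := hp _ (x0, y) (prod_pow_chart hc hd) (conj cx dy).
exists (fun w => G (slice2 (c x0) w)); split.
  have := differentiable_continuous (slice2_diff (c x0) (d y)) Gd; rewrite nbhs_simpl /=.
  move=> H; apply: (@filterS _ _ (nbhs_filter (d y)) _ _ _ H) => w Gw; apply: (differentiable_comp (slice2_diff _ _)); exact: Gw.
by move: pG => [[A B] [/= nA nB] AB]; apply: filterS nB => z Bz; apply: (AB (x0, z)); split => //=; exact: nbhs_singleton nA.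
Qed.

(** In a slice the displacement along the other factor is zero, so that the product
metric restricts to the metric of the curve. *)
Theorem factors_cover : ramified_covering_of_torus (curve_space C1) /\
  ramified_covering_of_torus (curve_space C2).
Proof.
have [x0 [y0 [nx ny nram]]] := base_point.
have [c fc cx] := PK0_flat nx; have [d fd dy] := PK0_flat ny.
have [W [F [nW pF iso]]] := pflat (prod_flat_chart fc fd) (conj cx dy : dom (prod_chart (row_chart c) (row_chart d)) (x0, y0)) nram.
have [_ pfib _] := pcov.
have sumE (u v : 'rV[C]_1) : \sum_i `|(row_mx u v : 'rV[C]_(1 + 1)) 0 i| ^+ 2 = `|u 0 0| ^+ 2 + `|v 0 0| ^+ 2.
  by rewrite big_split_ord /= !big_ord1 row_mxEl row_mxEr.
have isoE x y x' y' : W (x, y) -> W (x', y') ->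
    h (F (x, y) - F (x', y')) (F (x, y) - F (x', y')) = `|c x - c x'| ^+ 2 + `|d y - d y'| ^+ 2.
  by move=> w w'; rewrite iso// /= opp_row_mx add_row_mx sumE !mxE.
move: nW => [[A B] [/= nA nB] AB]; split.
- apply: (@slice_cover _ _ _ _ (fun x => p (x, y0)) h x0 c A (fun x => F (x, y0))) => //.
  + exact: liftable1.
  + move=> y; have [_ fin] := pfib y.
    by apply: sub_finite_set (finite_image (@fst C1 C2) fin) => x px; exists (x, y0).
  + by move=> x Ax; apply: pF; apply: AB; split => //; exact: nbhs_singleton nB.
  + move=> x x' Ax Ax'; rewrite isoE; first by rewrite subrr normr0 expr0n addr0.
      by apply: AB; split => //; exact: nbhs_singleton nB.
    by apply: AB; split => //; exact: nbhs_singleton nB.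
apply: (@slice_cover _ _ _ _ (fun y => p (x0, y)) h y0 d B (fun y => F (x0, y))) => //.
- exact: liftable2.
- move=> y; have [_ fin] := pfib y.
  by apply: sub_finite_set (finite_image (@snd C1 C2) fin) => x px; exists (x0, x).
- by move=> x Ax; apply: pF; apply: AB; split => //; exact: nbhs_singleton nA.
- move=> x x' Ax Ax'; rewrite isoE; first by rewrite subrr normr0 expr0n add0r.
    by apply: AB; split => //; exact: nbhs_singleton nA.
  by apply: AB; split => //; exact: nbhs_singleton nA.
Qed.

End Prod.

(** * Products of lattices *)

Section Block.
Variables (K : numFieldType) (n m : nat).

Lemma lsubmx_cont : continuous (lsubmx : 'rV[K]_(n + m) -> 'rV[K]_n).
Proof. by move=> w; apply: differentiable_continuous; exact: differentiable_lsubmx. Qed.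

Lemma rsubmx_cont : continuous (rsubmx : 'rV[K]_(n + m) -> 'rV[K]_m).
Proof. by move=> w; apply: differentiable_continuous; exact: differentiable_rsubmx. Qed.

Lemma row_mxl_cont : continuous (fun a : 'rV[K]_n => row_mx a 0 : 'rV[K]_(n + m)).
Proof.
move=> a A /nbhs_ballP [e /= e0 HA]; apply/nbhs_ballP; exists e => // b [_ hb].
apply: HA; split => // i j; rewrite -(splitK j); case: (fintype.split j) => k /=.
  by rewrite !row_mxEl.
by rewrite !row_mxEr; apply: ballxx.
Qed.

Lemma row_mxr_cont : continuous (fun b : 'rV[K]_m => row_mx 0 b : 'rV[K]_(n + m)).
Proof.
move=> a A /nbhs_ballP [e /= e0 HA]; apply/nbhs_ballP; exists e => // b [_ hb].
apply: HA; split => // i j; rewrite -(splitK j); case: (fintype.split j) => k /=.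
  by rewrite !row_mxEl; apply: ballxx.
by rewrite !row_mxEr.
Qed.

Lemma linear_diff (V W : normedModType K) (f : V -> W) (x : V) : linear f -> continuous f ->
  differentiable f x /\ 'd f x = f :> (V -> W).
Proof.
move=> lin fc.
pose fM := GRing.isLinear.Build K V W _ _ lin.
pose g : {linear V -> W} := HB.pack f fM.
rewrite -[f]/(g : V -> W).
by split; [exact: linear_differentiable|rewrite diff_lin].
Qed.

Definition block_fun (G1 : 'rV[K]_n -> 'rV[K]_n) (G2 : 'rV[K]_m -> 'rV[K]_m)
    (w : 'rV[K]_(n + m)) : 'rV[K]_(n + m) :=
  row_mx (G1 (lsubmx w)) (G2 (rsubmx w)).

Lemma block_diff G1 G2 w : differentiable G1 (lsubmx w) -> differentiable G2 (rsubmx w) ->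
  differentiable (block_fun G1 G2) w /\
  forall v, 'd (block_fun G1 G2) w v = row_mx ('d G1 (lsubmx w) (lsubmx v)) ('d G2 (rsubmx w) (rsubmx v)).
Proof.
move=> d1 d2.
pose il (a : 'rV[K]_n) : 'rV[K]_(n + m) := row_mx a 0.
pose ir (b : 'rV[K]_m) : 'rV[K]_(n + m) := row_mx 0 b.
have ill : linear il.
  by move=> k u v; rewrite /il scale_row_mx add_row_mx scaler0 addr0.
have irl : linear ir.
  by move=> k u v; rewrite /ir scale_row_mx add_row_mx scaler0 addr0.
have [dl el] := linear_diff w (@linearP _ _ _ _ (@lsubmx K 1 n m)) lsubmx_cont.
have [dr er] := linear_diff w (@linearP _ _ _ _ (@rsubmx K 1 n m)) rsubmx_cont.
have [dil eil] := linear_diff (G1 (lsubmx w)) ill row_mxl_cont.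
have [dir eir] := linear_diff (G2 (rsubmx w)) irl row_mxr_cont.
have c1 := differentiable_comp dl d1; have c2 := differentiable_comp dr d2.
have D1 := differentiable_comp c1 dil; have D2 := differentiable_comp c2 dir.
have E : block_fun G1 G2 = (il \o (G1 \o lsubmx)) + (ir \o (G2 \o rsubmx)).
  apply/funext => u; rewrite /block_fun -[RHS]/(il _ + ir _) /il /ir.
  by rewrite add_row_mx addr0 add0r.
rewrite E; split; first exact: differentiableD.
move=> v.
have A1 : 'd (il \o (G1 \o lsubmx)) w v = il ('d G1 (lsubmx w) (lsubmx v)).
  have a1 := congr1 (fun F => F v) (diff_comp c1 dil).
  have a2 := congr1 (fun F => F ('d (G1 \o lsubmx) w v)) eil.
  have a3 := congr1 (fun F => F v) (diff_comp dl d1).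
  have a4 := congr1 (fun F => 'd G1 (lsubmx w) (F v)) el.
  exact: etrans a1 (etrans a2 (congr1 il (etrans a3 a4))).
have A2 : 'd (ir \o (G2 \o rsubmx)) w v = ir ('d G2 (rsubmx w) (rsubmx v)).
  have a1 := congr1 (fun F => F v) (diff_comp c2 dir).
  have a2 := congr1 (fun F => F ('d (G2 \o rsubmx) w v)) eir.
  have a3 := congr1 (fun F => F v) (diff_comp dr d2).
  have a4 := congr1 (fun F => 'd G2 (rsubmx w) (F v)) er.
  exact: etrans a1 (etrans a2 (congr1 ir (etrans a3 a4))).
have A3 := congr1 (fun F => F v) (diffD D1 D2).
apply: etrans A3 _; apply: etrans (congr2 +%R A1 A2) _.
by rewrite /il /ir add_row_mx addr0 add0r.
Qed.

Lemma block_jacobian G1 G2 w : differentiable G1 (lsubmx w) -> differentiable G2 (rsubmx w) ->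
  \det ('J (block_fun G1 G2) w) = \det ('J G1 (lsubmx w)) * \det ('J G2 (rsubmx w)).
Proof.
move=> d1 d2; have [_ dE] := block_diff d1 d2.
rewrite -(det_ublock _ 0); congr determinant.
have ld (i : 'I_n) : lsubmx (delta_mx 0 (lshift m i) : 'rV[K]_(n + m)) = delta_mx 0 i.
  by apply/rowP => j; rewrite !mxE /= (inj_eq (@lshift_inj n m)).
have rd (i : 'I_m) : rsubmx (delta_mx 0 (rshift n i) : 'rV[K]_(n + m)) = delta_mx 0 i.
  by apply/rowP => j; rewrite !mxE /= (inj_eq (@rshift_inj n m)).
have l0 (i : 'I_m) : lsubmx (delta_mx 0 (rshift n i) : 'rV[K]_(n + m)) = 0.
  by apply/rowP => j; rewrite !mxE /= eq_lrshift.
have r0 (i : 'I_n) : rsubmx (delta_mx 0 (lshift m i) : 'rV[K]_(n + m)) = 0.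
  by apply/rowP => j; rewrite !mxE /= eq_rlshift.
apply/matrixP => i j; rewrite [LHS]mxE dE.
rewrite -(splitK i) -(splitK j); case: (fintype.split i) => i'; case: (fintype.split j) => j' /=.
- by rewrite row_mxEl block_mxEul ld [RHS]mxE.
- by rewrite row_mxEr block_mxEur r0 linear0 !mxE.
- by rewrite row_mxEl block_mxEdl l0 linear0 !mxE.
- by rewrite row_mxEr block_mxEdr rd [RHS]mxE.
Qed.

End Block.

Lemma jacobian_addC (K : numFieldType) n (G : 'rV[K]_n -> 'rV[K]_n) (k w : 'rV[K]_n) :
  differentiable G w -> 'J (fun u => G u + k) w = 'J G w.
Proof.
move=> dG; have dk : differentiable (cst k : 'rV[K]_n -> 'rV[K]_n) w by exact: differentiable_cst.
apply/matrixP => i j; rewrite [LHS]mxE [RHS]mxE.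
have E := congr1 (fun F : 'rV[K]_n -> 'rV[K]_n => F (delta_mx 0 i) 0 j) (diffD dG dk).
apply: etrans E _.
have E2 := congr1 (fun F : 'rV[K]_n -> 'rV[K]_n => F (delta_mx 0 i)) (diff_cst k w).
have add0 (a b : 'rV[K]_n) : b = 0 -> (a + b) 0 j = a 0 j by move=> ->; rewrite addr0.
exact: add0 _ _ E2.
Qed.

Section ProdLattice.
Variables (R : realType) (n m : nat) (L1 : lattice R n) (L2 : lattice R m).
Notation C := (Cplx R).

(** The index type of a basis of [C^(n + m)] splits as (n + m) + (n + m); the vectors
have to be regrouped into n + n and m + m. *)
Definition pindex (i : 'I_((n + m) + (n + m))) : 'I_(n + n) + 'I_(m + m) :=
  match fintype.split i with
  | inl j => match fintype.split j with inl a => inl (lshift n a) | inr b => inr (lshift m b) end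
  | inr j => match fintype.split j with inl a => inl (rshift n a) | inr b => inr (rshift m b) end
  end.

Definition punindex (s : 'I_(n + n) + 'I_(m + m)) : 'I_((n + m) + (n + m)) :=
  match s with
  | inl i => match fintype.split i with inl a => lshift _ (lshift m a) | inr a => rshift _ (lshift m a) end
  | inr i => match fintype.split i with inl b => lshift _ (rshift n b) | inr b => rshift _ (rshift n b) end
  end.

Lemma pindexK : cancel pindex punindex.
Proof.
move=> i; rewrite /pindex -{2}(splitK i); case: (fintype.split i) => j /=;
  rewrite -{2}(splitK j); case: (fintype.split j) => a /=.
- by rewrite (unsplitK (inl a)).
- by rewrite (unsplitK (inl a)).
- by rewrite (unsplitK (inr a)).
- by rewrite (unsplitK (inr a)).
Qed.

Lemma punindexK : cancel punindex pindex.
Proof.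
move=> [i|i]; rewrite /pindex /punindex -{2}(splitK i); case: (fintype.split i) => a /=.
- by rewrite (unsplitK (inl (lshift m a))) (unsplitK (inl a)).
- by rewrite (unsplitK (inr (lshift m a))) (unsplitK (inl a)).
- by rewrite (unsplitK (inl (rshift n a))) (unsplitK (inr a)).
- by rewrite (unsplitK (inr (rshift n a))) (unsplitK (inr a)).
Qed.

Definition pbasis (i : 'I_((n + m) + (n + m))) : 'rV[C]_(n + m) :=
  match pindex i with inl a => row_mx (lat_basis L1 a) 0 | inr b => row_mx 0 (lat_basis L2 b) end.

Lemma pbasis_comb (k : 'I_((n + m) + (n + m)) -> R) :
  \sum_i (k i)%:C *: pbasis i =
  row_mx (\sum_a (k (punindex (inl a)))%:C *: lat_basis L1 a)
         (\sum_b (k (punindex (inr b)))%:C *: lat_basis L2 b).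
Proof.
rewrite (reindex punindex); last by exists pindex => x _; rewrite ?punindexK ?pindexK.
rewrite big_sumType.
transitivity (\sum_a row_mx ((k (punindex (inl a)))%:C *: lat_basis L1 a) (0 : 'rV[C]_m) +
    \sum_b row_mx (0 : 'rV[C]_n) ((k (punindex (inr b)))%:C *: lat_basis L2 b)).
  by congr (_ + _); apply: eq_bigr => a _; rewrite /pbasis punindexK scale_row_mx scaler0.
apply/rowP => j; rewrite mxE !summxE -(splitK j); case: (fintype.split j) => i /=.
  rewrite row_mxEl summxE [X in _ + X]big1 ?addr0; last by move=> b _; rewrite row_mxEl mxE.
  by apply: eq_bigr => a _; rewrite row_mxEl.
rewrite row_mxEr summxE [X in X + _]big1 ?add0r; last by move=> b _; rewrite row_mxEr mxE.
by apply: eq_bigr => a _; rewrite row_mxEr.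
Qed.

Lemma pbasis_free (k : 'I_((n + m) + (n + m)) -> R) :
  \sum_i (k i)%:C *: pbasis i = 0 -> forall i, k i = 0.
Proof.
rewrite pbasis_comb -row_mx0 => /eq_row_mx [/lat_free h1 /lat_free h2] i.
by rewrite -(pindexK i); case: (pindex i) => a; [exact: h1|exact: h2].
Qed.

Definition prod_lattice : lattice R (n + m) := Lattice pbasis_free.

Lemma in_prod_lattice u v : in_lattice prod_lattice (row_mx u v) <->
  in_lattice L1 u /\ in_lattice L2 v.
Proof.
split.
  move=> /in_latticeE [k]; rewrite pbasis_comb => /eq_row_mx [uE vE].
  by split; apply/in_latticeE; eexists; [exact: uE|exact: vE].
move=> [/in_latticeE [k1 uE] /in_latticeE [k2 vE]]; apply/in_latticeE.
exists (fun i => match pindex i with inl a => k1 a | inr b => k2 b end).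
rewrite pbasis_comb uE vE; congr row_mx; apply: eq_bigr => i _;
by rewrite punindexK.
Qed.

Lemma prod_torus_projP u v u' v' :
  torus_proj prod_lattice (row_mx u v) = torus_proj prod_lattice (row_mx u' v') <->
  torus_proj L1 u = torus_proj L1 u' /\ torus_proj L2 v = torus_proj L2 v'.
Proof.
rewrite !torus_projP opp_row_mx add_row_mx; exact: in_prod_lattice.
Qed.

End ProdLattice.

(** * Products of coverings *)

Section ProdCover.
Variables (R : realType) (n m : nat) (X : flat_space R n) (Y : flat_space R m).
Notation C := (Cplx R).
Hypothesis X_chart : forall c, @hol_atlas _ _ X c -> is_chart c.
Hypothesis Y_chart : forall d, @hol_atlas _ _ Y d -> is_chart d.
Hypothesis X_cover : forall x : X, exists2 c, @hol_atlas _ _ X c & dom c x.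
Hypothesis Y_cover : forall y : Y, exists2 d, @hol_atlas _ _ Y d & dom d y.
Variables (L1 : lattice R n) (L2 : lattice R m) (p1 : X -> torus L1) (p2 : Y -> torus L2).
Hypothesis cov1 : ramified_covering p1.
Hypothesis cov2 : ramified_covering p2.

Let L := prod_lattice L1 L2.
Let XY := prod_space X Y.
Implicit Types (x : X) (y : Y).

(** Coset representatives of both values are chosen; [prod_mapP] shows that the
projection is independent of this choice. *)
Definition prod_map (z : XY) : torus L :=
  torus_proj L (row_mx (repr (p1 z.1)) (repr (p2 z.2))).

Lemma prod_mapP x y u v : prod_map (x, y) = torus_proj L (row_mx u v) <->
  p1 x = torus_proj L1 u /\ p2 y = torus_proj L2 v.
Proof.
rewrite /prod_map prod_torus_projP /torus_proj !reprK //.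
Qed.

Lemma torus_row (t : torus L) : exists u v, t = torus_proj L (row_mx u v).
Proof.
have [w ->] := torus_proj_surj t.
by exists (lsubmx w), (rsubmx w); rewrite hsubmxK.
Qed.

Lemma near_block (r : R) (w w' : 'rV[C]_(n + m)) : near_row r w w' <->
  near_row r (lsubmx w) (lsubmx w') /\ near_row r (rsubmx w) (rsubmx w').
Proof.
split=> [h|[h1 h2] i]; first by split => i; rewrite !mxE; exact: h.
rewrite -(splitK i); case: (fintype.split i) => j /=.
  by have := h1 j; rewrite !mxE.
by have := h2 j; rewrite !mxE.
Qed.

Lemma block_lift c d x y G1 G2 : local_lift p1 c x G1 -> local_lift p2 d y G2 ->
  local_lift prod_map (prod_chart c d) (x, y) (block_fun G1 G2).
Proof.
move=> [/nbhs_row [r1 [r10 G1d]] pG1] [/nbhs_row [r2 [r20 G2d]] pG2]; split.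
  apply/nbhs_row; exists (Num.min r1 r2); rewrite lt_min r10; split => // w hw.
  have [h1 h2] : near_row r1 (c x) (lsubmx w) /\ near_row r2 (d y) (rsubmx w).
    split => i; rewrite mxE.
      by have := hw (lshift m i); rewrite /= row_mxEl lt_min => /andP[].
    by have := hw (rshift n i); rewrite /= row_mxEr lt_min => /andP[].
  by have [] := block_diff (G1d _ h1) (G2d _ h2).
exists ([set x' | p1 x' = torus_proj L1 (G1 (c x'))], [set y' | p2 y' = torus_proj L2 (G2 (d y'))]) => //.
move=> [x' y'] [/= h1 h2]; rewrite /block_fun.
by apply/prod_mapP; rewrite row_mxKl row_mxKr.
Qed.

Lemma prod_holo : holomorphic_to_torus prod_map.
Proof.
move=> e [x y] [c [d [hc hd ->]]] [/= cx dy].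
have [H1 _ _] := cov1; have [H2 _ _] := cov2.
have [G1 l1] := H1 c x hc cx; have [G2 l2] := H2 d y hd dy.
exists (block_fun G1 G2); exact: block_lift l1 l2.
Qed.

(** The lifts [G] and [block_fun G1 G2] differ by a constant, and the Jacobian matrix of
the latter is block diagonal. *)
Lemma lift_jacobian c d x y G G1 G2 :
  @hol_atlas _ _ X c -> @hol_atlas _ _ Y d -> dom c x -> dom d y ->
  local_lift prod_map (prod_chart c d) (x, y) G ->
  local_lift p1 c x G1 -> local_lift p2 d y G2 ->
  \det ('J G (row_mx (c x) (d y))) = \det ('J G1 (c x)) * \det ('J G2 (d y)).
Proof.
move=> hc hd cx dy [Gd pG] l1 l2.
have [Bd pB] := block_lift l1 l2.
have Gdx := nbhs_singleton Gd; have Bdx := nbhs_singleton Bd.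
have [[[A1 A2] /= [nA1 nA2] hA] [[B1 B2] /= [nB1 nB2] hB]] := (pG, pB).
have n1 := chart_nbhs (X_chart hc) cx (nbhs_setI nA1 nB1).
have n2 := chart_nbhs (Y_chart hd) dy (nbhs_setI nA2 nB2).
move: n1 n2 => /nbhs_row [r1 [r10 h1]] /nbhs_row [r2 [r20 h2]].
have GB : \forall w \near row_mx (c x) (d y), torus_proj L (G w) = torus_proj L (block_fun G1 G2 w).
  apply/nbhs_row; exists (Num.min r1 r2); rewrite lt_min r10; split => // w hw.
  have [|x' [[Ax Bx] cx' xE]] := h1 (lsubmx w).
    by move=> i; rewrite mxE; have := hw (lshift m i); rewrite row_mxEl lt_min => /andP[].
  have [|y' [[Ay By] dy' yE]] := h2 (rsubmx w).
    by move=> i; rewrite mxE; have := hw (rshift n i); rewrite row_mxEr lt_min => /andP[].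
  have wE : w = row_mx (c x') (d y') by rewrite xE yE hsubmxK.
  have e1 := hA (x', y') (conj Ax Ay); have e2 := hB (x', y') (conj Bx By).
  by rewrite wE; exact: etrans (esym e1) e2.
have := lift_unique (differentiable_continuous Gdx) (differentiable_continuous Bdx) GB.
set k := _ - _ => hk.
have [l1d _] := l1; have [l2d _] := l2.
have d1 := nbhs_singleton l1d; have d2 := nbhs_singleton l2d.
pose G1' w := G1 w + lsubmx k; pose G2' w := G2 w + rsubmx k.
have dG1' : differentiable G1' (lsubmx (row_mx (c x) (d y))).
  by rewrite row_mxKl; apply: differentiableD; [exact: d1|exact: differentiable_cst].
have dG2' : differentiable G2' (rsubmx (row_mx (c x) (d y))).
  by rewrite row_mxKr; apply: differentiableD; [exact: d2|exact: differentiable_cst].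
have Gk : \forall w \near row_mx (c x) (d y), block_fun G1' G2' w = G w.
  apply: filterS hk => w hw; rewrite -[G w](subrK (block_fun G1 G2 w)) hw.
  by rewrite /block_fun /G1' /G2' -{3}(hsubmxK k) add_row_mx [lsubmx k + _]addrC [rsubmx k + _]addrC.
have [db _] := block_diff dG1' dG2'.
have J1 := etrans (congr1 (fun w => 'J G1' w) (row_mxKl (c x) (d y))) (jacobian_addC (lsubmx k) d1).
have J2 := etrans (congr1 (fun w => 'J G2' w) (row_mxKr (c x) (d y))) (jacobian_addC (rsubmx k) d2).
apply: etrans (congr1 determinant (near_eq_jacobian Gk db)) _.
apply: etrans (block_jacobian dG1' dG2') _.
exact: (congr2 *%R (congr1 determinant J1) (congr1 determinant J2)).
Qed.

Lemma prod_ram x y : ramification_locus prod_map (x, y) <->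
  ramification_locus p1 x \/ ramification_locus p2 y.
Proof.
have [H1 _ _] := cov1; have [H2 _ _] := cov2.
split.
  move=> [e [G [[c [d [hc hd ->]]] [/= cx dy] lG J0]]].
  have [G1 l1] := H1 c x hc cx; have [G2 l2] := H2 d y hd dy.
  have JE := lift_jacobian hc hd cx dy lG l1 l2.
  have /eqP : \det ('J G1 (c x)) * \det ('J G2 (d y)) = 0 by exact: etrans (esym JE) J0.
  rewrite mulf_eq0 => /orP[/eqP j0|/eqP j0]; [left|right].
    by exists c, G1; split.
  by exists d, G2; split.
move=> [[c [G1 [hc cx l1 J0]]]|[d [G2 [hd dy l2 J0]]]].
  have [d hd dy] := Y_cover y; have [G2 l2] := H2 d y hd dy.
  exists (prod_chart c d), (block_fun G1 G2); split => //.
  - by exists c, d.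
  - exact: block_lift.
  have JE := lift_jacobian hc hd cx dy (block_lift l1 l2) l1 l2.
  by apply: etrans JE _; rewrite J0 mul0r.
have [c hc cx] := X_cover x; have [G1 l1] := H1 c x hc cx.
exists (prod_chart c d), (block_fun G1 G2); split => //.
- by exists c, d.
- exact: block_lift.
have JE := lift_jacobian hc hd cx dy (block_lift l1 l2) l1 l2.
by apply: etrans JE _; rewrite J0 mulr0.
Qed.

Lemma prod_fiber (t : torus L) : prod_map @^-1` [set t] !=set0 /\ finite_set (prod_map @^-1` [set t]).
Proof.
have [u [v ->]] := torus_row t.
have [_ F1 _] := cov1; have [_ F2 _] := cov2.
have [[x hx] f1] := F1 (torus_proj L1 u); have [[y hy] f2] := F2 (torus_proj L2 v).
split; first by exists (x, y); apply/prod_mapP.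
by apply: sub_finite_set (finite_setX f1 f2) => -[x' y'] /prod_mapP.
Qed.

(** The union of B1 x T2 and T1 x B2. *)
Definition prod_branch (B1 : set (torus L1)) (B2 : set (torus L2)) : set (torus L) :=
  [set t | exists u v, t = torus_proj L (row_mx u v) /\
    (B1 (torus_proj L1 u) \/ B2 (torus_proj L2 v))].

Lemma prod_branchP B1 B2 w : prod_branch B1 B2 (torus_proj L w) <->
  B1 (torus_proj L1 (lsubmx w)) \/ B2 (torus_proj L2 (rsubmx w)).
Proof.
rewrite -{1}(hsubmxK w); split; last by move=> h; exists (lsubmx w), (rsubmx w).
by move=> [u [v [/prod_torus_projP [-> ->]]]].
Qed.

Lemma torus_box_open (U1 : set (torus L1)) (U2 : set (torus L2)) : open U1 -> open U2 ->
  open [set w : 'rV[C]_(n + m) | U1 (torus_proj L1 (lsubmx w)) /\ U2 (torus_proj L2 (rsubmx w))].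
Proof.
move=> o1 o2.
apply: (openI (A := [set w : 'rV[C]_(n + m) | U1 (torus_proj L1 (lsubmx w))])
  (B := [set w : 'rV[C]_(n + m) | U2 (torus_proj L2 (rsubmx w))])).
  apply: (open_comp (f := fun w : 'rV[C]_(n + m) => torus_proj L1 (lsubmx w))) => // w _.
  apply: (@continuous_comp _ _ _ (fun w : 'rV[C]_(n + m) => lsubmx w) (torus_proj L1)).
    exact: lsubmx_cont.
  exact: torus_proj_continuous.
apply: (open_comp (f := fun w : 'rV[C]_(n + m) => torus_proj L2 (rsubmx w))) => // w _.
apply: (@continuous_comp _ _ _ (fun w : 'rV[C]_(n + m) => rsubmx w) (torus_proj L2)).
  exact: rsubmx_cont.
exact: torus_proj_continuous.
Qed.

Lemma near_row_refl k (r : R) (u : 'rV[C]_k) : 0 < r -> near_row r u u.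
Proof. by move=> r0 i; rewrite subrr nrm0. Qed.

(** The product of the local equations of [B1] and [B2] is an equation of the union: if
it vanishes on a box, one of the factors does on a side of the box. *)
Lemma prod_branch_thin B1 B2 : thin B1 -> thin B2 -> thin (prod_branch B1 B2).
Proof.
move=> [c1 t1] [c2 t2]; split.
  rewrite -[prod_branch _ _]setCK; apply: open_closedC; rewrite torus_openE.
  have := torus_box_open (closed_openC c1) (closed_openC c2).
  congr open; apply/seteqP; split => w.
    by move=> [h1 h2] /prod_branchP [].
  by move=> h; split => hB; apply: h; apply/prod_branchP; [left|right].
move=> u; have [W1 [g1 [oW1 W1u dg1 i1 z1]]] := t1 (lsubmx u).
have [W2 [g2 [oW2 W2u dg2 i2 z2]]] := t2 (rsubmx u).
exists [set w | W1 (lsubmx w) /\ W2 (rsubmx w)], (fun w => g1 (lsubmx w) * g2 (rsubmx w)); split.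
- apply: (openI (A := [set w : 'rV[C]_(n + m) | W1 (lsubmx w)]) (B := [set w : 'rV[C]_(n + m) | W2 (rsubmx w)])).
    by apply: (open_comp (f := fun w : 'rV[C]_(n + m) => lsubmx w)) => // w _; exact: lsubmx_cont.
  by apply: (open_comp (f := fun w : 'rV[C]_(n + m) => rsubmx w)) => // w _; exact: rsubmx_cont.
- by [].
- move=> w [w1 w2]; apply: differentiableM.
    apply: (differentiable_comp (f := fun w : 'rV[C]_(n + m) => lsubmx w)); first exact: differentiable_lsubmx.
    exact: dg1.
  apply: (differentiable_comp (f := fun w : 'rV[C]_(n + m) => rsubmx w)); first exact: differentiable_rsubmx.
  exact: dg2.
- rewrite -subset0 => w /nbhs_row [r [r0 hr]].
  have box a b : near_row r (lsubmx w) a -> near_row r (rsubmx w) b ->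
      [/\ W1 a, W2 b & g1 a * g2 b = 0].
    move=> ha hb; have [|[]] := hr (row_mx a b).
      by apply/near_block; rewrite row_mxKl row_mxKr.
    by rewrite /preimage /= row_mxKl row_mxKr.
  have [a na ga] : exists2 a, near_row r (lsubmx w) a & g1 a <> 0.
    apply: contrapT => no.
    suff : interior (W1 `&` g1 @^-1` [set 0]) (lsubmx w) by rewrite i1.
    apply/nbhs_row; exists r; split => // a na; split.
      by have [] := box a (rsubmx w) na (near_row_refl _ r0).
    by apply: contrapT => ga; apply: no; exists a.
  have [b nb gb] : exists2 b, near_row r (rsubmx w) b & g2 b <> 0.
    apply: contrapT => no.
    suff : interior (W2 `&` g2 @^-1` [set 0]) (rsubmx w) by rewrite i2.
    apply/nbhs_row; exists r; split => // b nb; split.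
      by have [] := box (lsubmx w) b (near_row_refl _ r0) nb.
    by apply: contrapT => gb; apply: no; exists b.
  have [_ _ /eqP] := box a b na nb; rewrite mulf_eq0 => /orP[/eqP|/eqP] //.
- move=> w [w1 w2] /prod_branchP [h|h].
    by rewrite z1// mul0r.
  by rewrite z2// mulr0.
Qed.

Lemma prod_branch_interior B1 B2 : interior (p1 @^-1` B1) = set0 ->
  interior (p2 @^-1` B2) = set0 -> interior (prod_map @^-1` prod_branch B1 B2) = set0.
Proof.
move=> i1 i2; rewrite -subset0 => -[x y] [[A1 A2] /= [n1 n2] hA].
have [a Aa na] : exists2 a, A1 a & ~ B1 (p1 a).
  apply: contrapT => no; suff : interior (p1 @^-1` B1) x by rewrite i1.
  by apply: filterS n1 => a Aa; apply: contrapT => na; apply: no; exists a.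
have [b Ab nb] : exists2 b, A2 b & ~ B2 (p2 b).
  apply: contrapT => no; suff : interior (p2 @^-1` B2) y by rewrite i2.
  by apply: filterS n2 => b Ab; apply: contrapT => nb; apply: no; exists b.
have := hA (a, b) (conj Aa Ab) => -[u [v [/prod_mapP [e1 e2]]]].
by rewrite -e1 -e2 => -[].
Qed.

Lemma prod_homeo V1 V2 (U1 : set (torus L1)) (U2 : set (torus L2)) :
  open_homeo V1 U1 p1 -> open_homeo V2 U2 p2 ->
  open_homeo (V1 `*` V2 : set XY)
    [set t | exists u v, [/\ t = torus_proj L (row_mx u v), U1 (torus_proj L1 u) & U2 (torus_proj L2 v)]]
    prod_map.
Proof.
move=> [oV1 oU1 [m1 in1 s1] ct1 op1] [oV2 oU2 [m2 in2 s2] ct2 op2].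
split.
- rewrite openE => -[x y] [/= Vx Vy]; exists (V1, V2) => //=.
  by split; exact: open_nbhs_nbhs.
- rewrite torus_openE; have := torus_box_open oU1 oU2; congr open; apply/seteqP; split => w.
    by move=> [h1 h2]; exists (lsubmx w), (rsubmx w); rewrite hsubmxK.
  by move=> [u [v []]]; rewrite -{1}(hsubmxK w) => /prod_torus_projP [e1 e2]; split; rewrite ?e1 ?e2.
- split.
  + move=> [x y] [/= Vx Vy]; exists (repr (p1 x)), (repr (p2 y)); rewrite /torus_proj !reprK.
    by split => //; [exact: m1|exact: m2].
  + move=> [x y] [x' y'] /set_mem [/= Vx Vy] /set_mem [/= Vx' Vy'] /prod_mapP.
    rewrite /torus_proj !reprK => -[e1 e2].
    by congr pair; [apply: in1|apply: in2] => //; rewrite inE.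
  + move=> _ [u [v [-> /s1 [x Vx e1] /s2 [y Vy e2]]]].
    by exists (x, y) => //; apply/prod_mapP.
- move=> [x y] [/= Vx Vy] N nN.
  have [u e1] := torus_proj_surj (p1 x); have [v e2] := torus_proj_surj (p2 y).
  have PE : prod_map (x, y) = torus_proj L (row_mx u v) by apply/prod_mapP.
  rewrite PE in nN; have /nbhs_row [r [r0 hr]] := @torus_proj_continuous _ _ L _ _ nN.
  have near1 : nbhs x (p1 @^-1` (torus_proj L1 @` interior [set u' | near_row r u u'])).
    apply: (ct1 x Vx); apply: open_nbhs_nbhs; split; first exact/torus_proj_open/open_interior.
    by exists u => //; exact: near_row_nbhs.
  have near2 : nbhs y (p2 @^-1` (torus_proj L2 @` interior [set v' | near_row r v v'])).
    apply: (ct2 y Vy); apply: open_nbhs_nbhs; split; first exact/torus_proj_open/open_interior.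
    by exists v => //; exact: near_row_nbhs.
  exists (p1 @^-1` (torus_proj L1 @` interior [set u' | near_row r u u']),
     p2 @^-1` (torus_proj L2 @` interior [set v' | near_row r v v'])) => //.
  move=> [x' y'] [/= [u' /interior_subset hu' eu'] [v' /interior_subset hv' ev']].
  have -> : prod_map (x', y') = torus_proj L (row_mx u' v') by apply/prod_mapP.
  by apply: hr; apply/near_block; rewrite !row_mxKl !row_mxKr.
- move=> W WV oW; rewrite torus_openE openE => w [[x y] Wxy].
  rewrite -{1}(hsubmxK w) => /prod_mapP [e1 e2].
  have [[A1 A2] /= [n1 n2] hA] : nbhs ((x, y) : XY) W by exact: open_nbhs_nbhs.
  have [/= Vx Vy] := WV _ Wxy.
  have o1 : open (p1 @` (interior A1 `&` V1)).
    by apply: op1 => [z []//|]; apply: openI => //; exact: open_interior.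
  have o2 : open (p2 @` (interior A2 `&` V2)).
    by apply: op2 => [z []//|]; apply: openI => //; exact: open_interior.
  have := torus_box_open o1 o2 => o12.
  have : nbhs w [set w | (p1 @` (interior A1 `&` V1)) (torus_proj L1 (lsubmx w)) /\
                         (p2 @` (interior A2 `&` V2)) (torus_proj L2 (rsubmx w))].
    apply: open_nbhs_nbhs; split => //; split.
      by exists x => //; split.
    by exists y => //; split.
  move=> H; apply: (@filterS _ _ (nbhs_filter w) _ _ _ H).
  move=> w' [[x' [/interior_subset Ax' _] ex'] [y' [/interior_subset Ay' _] ey']].
  exists (x', y'); first exact: hA.
  by rewrite -(hsubmxK w'); apply/prod_mapP.
Qed.

Lemma prod_evenly B1 B2 : (forall t, ~ B1 t -> evenly_covered p1 t) ->
  (forall t, ~ B2 t -> evenly_covered p2 t) ->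
  forall t, ~ prod_branch B1 B2 t -> evenly_covered prod_map t.
Proof.
move=> E1 E2 t; have [u [v ->]] := torus_row t => nB.
have [|U1 [d1 [V1 [U1u pU1 tr1 H1]]]] := E1 (torus_proj L1 u).
  by move=> h; apply: nB; exists u, v; split => //; left.
have [|U2 [d2 [V2 [U2v pU2 tr2 H2]]]] := E2 (torus_proj L2 v).
  by move=> h; apply: nB; exists u, v; split => //; right.
pose I := ('I_d1 * 'I_d2)%type.
exists [set t | exists u v, [/\ t = torus_proj L (row_mx u v), U1 (torus_proj L1 u) & U2 (torus_proj L2 v)]].
exists #|{: I}|, (fun k => V1 (enum_val k).1 `*` V2 (enum_val k).2); split.
- by exists u, v.
- apply/seteqP; split => -[x y].
    move=> [u' [v' [/prod_mapP [e1 e2] h1 h2]]].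
    have [i _ Vi] : (\bigcup_i V1 i) x by rewrite -pU1 /preimage /= e1.
    have [j _ Vj] : (\bigcup_i V2 i) y by rewrite -pU2 /preimage /= e2.
    exists (enum_rank ((i, j) : I)) => //; split; rewrite enum_rankK //.
  move=> [k _ [/= Vi Vj]].
  exists (repr (p1 x)), (repr (p2 y)); rewrite /torus_proj !reprK; split => //.
    have : (p1 @^-1` U1) x by rewrite pU1; exists (enum_val k).1.
    by [].
  have : (p2 @^-1` U2) y by rewrite pU2; exists (enum_val k).2.
  by [].
- move=> k l _ _ [[x y] [[/= Vi Vj] [/= Vi' Vj']]]; apply: enum_val_inj.
  rewrite [enum_val k]surjective_pairing [enum_val l]surjective_pairing; congr pair.
    by apply: tr1 => //; exists x.
  by apply: tr2 => //; exists y.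
move=> k; have [h1 r1] := H1 (enum_val k).1; have [h2 r2] := H2 (enum_val k).2; split.
  exact: prod_homeo.
rewrite -subset0 => -[x y] [[/= Vi Vj] /prod_ram [ram|ram]].
  by have : (V1 (enum_val k).1 `&` ramification_locus p1) x by []; rewrite r1.
by have : (V2 (enum_val k).2 `&` ramification_locus p2) y by []; rewrite r2.
Qed.

Lemma prod_covering : ramified_covering prod_map.
Proof.
have [_ _ [B1 [t1 i1 e1]]] := cov1; have [_ _ [B2 [t2 i2 e2]]] := cov2.
split; [exact: prod_holo|exact: prod_fiber|exists (prod_branch B1 B2); split].
- exact: prod_branch_thin.
- exact: prod_branch_interior.
- exact: prod_evenly.
Qed.

Lemma prod_dot (h1 : {dot 'rV[C]_n for Num.conj}) (h2 : {dot 'rV[C]_m for Num.conj}) :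
  exists h : {dot 'rV[C]_(n + m) for Num.conj},
    forall u v, h u v = h1 (lsubmx u) (lsubmx v) + h2 (rsubmx u) (rsubmx v).
Proof.
apply: dot_of_form.
- by move=> v a u u'; rewrite !linearP !dotDl !dotZl; ring.
- by move=> u v; rewrite rmorphD /= -!dotC.
move=> u u0; have ge0 k (h : {dot 'rV[C]_k for Num.conj}) (w : 'rV[C]_k) : 0 <= h w w by exact: dnorm_ge0.
rewrite lt_def addr_ge0 ?ge0// andbT paddr_eq0 ?ge0//.
apply: contra u0 => /andP[]; rewrite !dnorm_eq0 => /eqP l0 /eqP r0.
by rewrite -(hsubmxK u) l0 r0 row_mx0.
Qed.

Lemma prod_flat h1 h2 : flat_compatible p1 h1 -> flat_compatible p2 h2 ->
  exists h, flat_compatible prod_map h.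
Proof.
move=> f1 f2; have [h hE] := prod_dot h1 h2; exists h.
move=> e [x y] [c [d [hc hd ->]]] [/= cx dy] nram.
have [|W1 [F1 [n1 pF1 i1]]] := f1 c x hc cx; first by move=> ram; apply: nram; apply/prod_ram; left.
have [|W2 [F2 [n2 pF2 i2]]] := f2 d y hd dy; first by move=> ram; apply: nram; apply/prod_ram; right.
exists (W1 `*` W2), (fun z => row_mx (F1 z.1) (F2 z.2)); split.
- by exists (W1, W2).
- by move=> [x' y'] [/= Wx Wy]; apply/prod_mapP; rewrite pF1// pF2.
move=> [x' y'] [x2 y2] [/= Wx Wy] [/= Wx2 Wy2].
rewrite hE opp_row_mx add_row_mx row_mxKl row_mxKr i1// i2// big_split_ord /=.
by congr (_ + _); apply: eq_bigr => i _; rewrite !mxE ?row_mxEl ?row_mxEr //; rewrite /= ?(unsplitK (inl i)) ?(unsplitK (inr i)).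
Qed.

End ProdCover.

(** * The equivalence *)

Section RowChart.
Variables (R : realType) (S : topologicalType).
Notation C := (Cplx R).

Lemma open_coord (B : set C) : open B -> open [set v : 'rV[C]_1 | B (v 0 0)].
Proof.
move=> oB; apply: (open_comp (f := fun v : 'rV[C]_1 => v 0 0)) => // v _.
exact: coord_continuous.
Qed.

Lemma row_chart_is_chart (c : chart S C) : is_chart c -> is_chart (row_chart c).
Proof.
move=> [B [oA oB [m ci s] cont op]]; exists [set v : 'rV[C]_1 | B (v 0 0)].
split => //.
- exact: open_coord.
- split.
  + by move=> x /m; rewrite /= mxE.
  + move=> x y xA yA /= /(congr1 (fun v : 'rV[C]_1 => v 0 0)).
    by rewrite !mxE => /ci; apply.
  + move=> v /s [x Ax cx]; exists x => //=.
    by rewrite -[RHS]const_mxK cx.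
- move=> x Ax; apply: (@continuous_comp _ _ _ (c : S -> C) (fun w : C => const_mx w : 'rV[C]_1)).
    exact: cont.
  exact: const_mx_continuous.
- move=> W WA oW.
  rewrite (_ : _ @` W = [set v : 'rV[C]_1 | (c @` W) (v 0 0)]).
    by apply: open_coord; exact: op.
  apply/seteqP; split => v.
    by move=> [x Wx <-] /=; exists x => //; rewrite mxE.
  by move=> [x Wx cx]; exists x => //=; rewrite -[RHS]const_mxK cx.
Qed.

End RowChart.

Section CurveAtlas.
Variables (R : realType) (S : PK0curve R).

Lemma curve_hol_chart c : @hol_atlas _ _ (curve_space S) c -> is_chart c.
Proof.
by move=> /curve_atlasP [c' [alpha [/pow_chartP [_ cc _] ->]]]; exact: row_chart_is_chart.
Qed.

Lemma curve_hol_cover (x : curve_space S) : exists2 c, @hol_atlas _ _ (curve_space S) c & dom c x.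
Proof.
have [c [alpha [hc cx]]] := pow_chart_exists x.
by exists (row_chart c) => //; apply/curve_atlasP; exists c, alpha.
Qed.

End CurveAtlas.

Theorem theoremB (R : realType) (C1 C2 : PK0curve R) :
  ramified_covering_of_torus (prod_space (curve_space C1) (curve_space C2)) <->
  ramified_covering_of_torus (curve_space C1) /\
  ramified_covering_of_torus (curve_space C2).
Proof.
split=> [[L [h [p [pcov pflat]]]]|[[L1 [h1 [p1 [cov1 f1]]]] [L2 [h2 [p2 [cov2 f2]]]]]].
  exact: factors_cover pcov pflat.
have [h fh] := prod_flat (@curve_hol_chart _ C1) (@curve_hol_chart _ C2)
  (@curve_hol_cover _ C1) (@curve_hol_cover _ C2) cov1 cov2 f1 f2.
exists (prod_lattice L1 L2), h, (prod_map p1 p2); split; last exact: fh.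
exact: (prod_covering (@curve_hol_chart _ C1) (@curve_hol_chart _ C2)
  (@curve_hol_cover _ C1) (@curve_hol_cover _ C2) cov1 cov2).
Qed.
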